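(* Let $(L_n)_{n\in\mathbb N}$ be a sequence of Latinons, where each $L_n$ may be defined over its own separable atomless probability space. Then there exist a subsequence $(L_{n_i})_{i\in\mathbb N}$ and a Latinon $(W,f)$ over the ground space $\Omega$ such that $L_{n_i}$ left-converges to $(W,f)$, i.e. $\lim_{i\to\infty} t(A,L_{n_i})=t(A,(W,f))$ for every $k,\ell\in\mathbb N$ and every $A\in\mathcal R(k,\ell)$.
   Context: $(\Omega,\mu)$ denotes a fixed separable atomless probability space, $\lambda$ is Lebesgue measure on $[0,1]$, and $\mathcal B$ is the set of Borel probability measures on $[0,1]$. A permuton is a Borel probability measure on $[0,1]^2$ both of whose marginals equal $\lambda$. A Latinon over a separable atomless probability space $(\Omega,\mu)$ is a pair $(W,f)$ where $W:\Omega^2\to\mathcal B$ is measurable and $f:\Omega\to[0,1]$ is measure preserving, such that (i) for almost every $x\in\Omega$ the measure $\mu^1_x$ on $[0,1]^2$ determined by $\mu^1_x(S\times T)=\int_{y\in f^{-1}(S)}W(x,y)(T)\,d\mu(y)$ is a permuton, and (ii) for almost every $y\in\Omega$ the measure $\mu^2_y$ determined by $\mu^2_y(S\times T)=\int_{x\in f^{-1}(S)}W(x,y)(T)\,d\mu(x)$ is a permuton. Latinons agreeing almost everywhere are identified. For $k,\ell\in\mathbb N$, $\mathcal R(k,\ell)$ (patterns) is the set of $k\times\ell$ matrices with entries in $\{1,\dots,k\ell\}$ in which every value appears exactly once. For a real matrix $A$, let $p_A$ map each entry value to its rank among the distinct values of $A$ (smallest value has rank 1). Two real $k\times\ell$ matrices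 $A,B$ are structurally equivalent, $A\equiv B$, if $p_A(a_{i,j})=p_B(b_{i,j})$ for all $i,j$; for $S\subseteq\mathbb R$ let $\mathcal R^A(S)=\{M\in S^{k\times\ell}: M\equiv A\}$. Write $x<_f y$ iff $f(x)<f(y)$, and $\Omega^k_{<_f}$ for the set of $(x_1,\dots,x_k)\in\Omega^k$ with $f(x_1)<\dots<f(x_k)$. The density of $A\in\mathcal R(k,\ell)$ in a Latinon $(W,f)$ is $t(A,(W,f))=k!\,\ell!\int_{\mathbf x\in\Omega^k_{<_f}}\int_{\mathbf y\in\Omega^\ell_{<_f}}\Big(\bigotimes_{(i,j)\in[k]\times[\ell]}W(x_i,y_j)\Big)(\mathcal R^A([0,1]))\,d\mathbf y\,d\mathbf x$, where the integrals are with respect to the product measures $\mu^{\otimes k},\mu^{\otimes\ell}$ and $\bigotimes$ is the product measure on $[0,1]^{k\times\ell}$. *)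

(* Defs.v *)
From HB Require Import structures.
From mathcomp Require Import all_boot all_order all_algebra.
From mathcomp Require Import all_classical all_reals all_analysis.

Set Implicit Arguments.
Unset Strict Implicit.
Unset Printing Implicit Defensive.

Import Order.TTheory GRing.Theory Num.Theory.
Import numFieldNormedType.Exports.

Local Open Scope classical_set_scope.
Local Open Scope ring_scope.

(* Convention: a measure on [0,1] (resp. on [0,1]^2) is a measure on R (resp.
   on R * R) giving full mass to [0,1] (resp. [0,1]^2), and a map into [0,1]
   is a map into R with values in [0,1]. *)

Section ground_spaces.
Context (d : measure_display) (T : measurableType d) (R : realType).
Variable mu : probability T R.

(* Separability of the metric space of measurable sets, with distance
   mu (A `+` B). *)
Definition separable_prob : Prop :=
  exists C : (set T)^nat,
    (forall n, measurable (C n)) /\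
    forall A (e : R), measurable A -> 0 < e ->
      exists n, (mu (A `+` C n) < e%:E)%E.

Definition atomless : Prop :=
  forall A, measurable A -> (0 < mu A)%E ->
    exists B, [/\ measurable B, B `<=` A, (0 < mu B)%E & (mu B < mu A)%E].

End ground_spaces.

Section product_of_probabilities.
Context (d : measure_display) (T : measurableType d) (R : realType).

Definition tuple_cons n (p : T * n.-tuple T) : n.+1.-tuple T :=
  [the n.+1.-tuple T of p.1 :: p.2].

Lemma measurable_tuple_cons n : measurable_fun setT (@tuple_cons n).
Proof. exact: measurable_cons. Qed.

HB.instance Definition _ n :=
  isMeasurableFun.Build _ _ _ _ (@tuple_cons n) (@measurable_tuple_cons n).

(* Product measure of a finite family; see [tuple_prob_box]. *)
Fixpoint tuple_prob n : ('I_n -> probability T R) -> probability (n.-tuple T) R :=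
  match n with
  | 0 => fun _ => dirac [tuple]
  | n'.+1 => fun P =>
      distribution (P ord0 \x tuple_prob (fun i => P (lift ord0 i)))%E
        (@tuple_cons n')
  end.

Lemma tuple_prob_box n (P : 'I_n -> probability T R) (A : 'I_n -> set T) :
  (forall i, measurable (A i)) ->
  tuple_prob P [set t | forall i, A i (tnth t i)] = (\prod_(i < n) P i (A i))%E.
Proof.
elim: n => [|n IHn] in P A * => mA.
  by rewrite big_ord0 /= diracE mem_set//; case.
rewrite big_ord_recl /= /distribution /pushforward /=.
set B := [set t : n.-tuple T | forall i, A (lift ord0 i) (tnth t i)].
have mB : measurable B.
  rewrite [B](_ : _ = \big[setI/setT]_(i < n)
      ((fun t : n.-tuple T => tnth t i) @^-1` A (lift ord0 i))).
    apply: bigsetI_measurable => i _; rewrite -[X in measurable X]setTI.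
    exact: measurable_tnth.
  apply/seteqP; split=> t /=.
    by move=> Bt; elim/big_ind: _ => //= i _; exact: Bt.
  by move=> + i; rewrite (bigD1 i)//= => -[].
rewrite [X in product_measure1 _ _ X](_ : _ = A ord0 `*` B).
  by rewrite product_measure1E//; congr (_ * _)%E; exact: IHn.
apply/seteqP; split=> -[x t] /=.
  by move=> At; split=> [|i]; [exact: (At ord0)|have := At (lift ord0 i); rewrite tnthS].
move=> [Ax Bt] i; case: (unliftP ord0 i) => [j|] ->; last exact: Ax.
by rewrite tnthS; exact: Bt.
Qed.

End product_of_probabilities.

Section latinons.
Context (R : realType).

Local Notation I01 := (`[0%R, 1%R]%classic : set R).

Definition is_permuton (m : probability (R * R)%type R) : Prop :=
  m (I01 `*` I01) = 1%E /\
  forall S : set R, measurable S -> S `<=` I01 ->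
    m (S `*` I01) = lebesgue_measure S /\ m (I01 `*` S) = lebesgue_measure S.

(* [pprobability R R] carries the sigma-algebra generated by the evaluations
   m |-> m U; on the probability measures on [0,1] it is the Borel
   sigma-algebra of the weak topology. Latinons that agree almost everywhere
   are not quotiented; [density] below does not distinguish them. *)
Record latinon (d : measure_display) (T : measurableType d)
    (mu : probability T R) := Latinon {
  lat_W : {mfun (T * T)%type >-> pprobability R R} ;
  lat_f : {mfun T >-> R} ;
  lat_W01 : forall z, (lat_W z : probability R R) I01 = 1%E ;
  lat_f01 : forall x, I01 (lat_f x) ;
  lat_f_preserving : forall S : set R, measurable S -> S `<=` I01 ->
    mu (lat_f @^-1` S) = lebesgue_measure S ;
  lat_permuton1 : {ae mu, forall x, exists2 m : probability (R * R)%type R,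
    is_permuton m &
    forall S U : set R, measurable S -> measurable U ->
      S `<=` I01 -> U `<=` I01 ->
      m (S `*` U) =
      (\int[mu]_(y in lat_f @^-1` S) (lat_W (x, y) : probability R R) U)%E} ;
  lat_permuton2 : {ae mu, forall y, exists2 m : probability (R * R)%type R,
    is_permuton m &
    forall S U : set R, measurable S -> measurable U ->
      S `<=` I01 -> U `<=` I01 ->
      m (S `*` U) =
      (\int[mu]_(x in lat_f @^-1` S) (lat_W (x, y) : probability R R) U)%E}
}.

Definition is_pattern k l (A : 'M[nat]_(k, l)) : Prop :=
  (forall i j, (1 <= A i j <= k * l)%N) /\
  (forall v, (1 <= v <= k * l)%N ->
    exists! ij : 'I_k * 'I_l, A ij.1 ij.2 = v).

(* p_A(a): the rank of a among the distinct entries of A, starting from 1. *)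
Definition entry_rank k l (A : 'M[R]_(k, l)) (a : R) : nat :=
  count (fun v => v <= a) (undup [seq A ij.1 ij.2 | ij : 'I_k * 'I_l]).

Definition struct_equiv k l (A B : 'M[R]_(k, l)) : Prop :=
  forall i j, entry_rank A (A i j) = entry_rank B (B i j).

(* A real k x l matrix as the k-tuple of its rows. *)
Definition mx_of_rows k l (M : k.-tuple (l.-tuple R)) : 'M[R]_(k, l) :=
  \matrix_(i, j) tnth (tnth M i) j.

Definition struct_class k l (A : 'M[R]_(k, l)) (S : set R) :
    set (k.-tuple (l.-tuple R)) :=
  [set M | (forall i j, S (mx_of_rows M i j)) /\ struct_equiv (mx_of_rows M) A].

Section density.
Context (d : measure_display) (T : measurableType d) (mu : probability T R).

Definition increasing_tuples k (f : T -> R) : set (k.-tuple T) :=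
  [set x | forall i j : 'I_k, (i < j)%N -> f (tnth x i) < f (tnth x j)].

(* The product over (i, j) of the W(x_i, y_j), as a product over rows i of
   products over columns j. *)
Definition entries_prob k l (W : T * T -> pprobability R R)
    (x : k.-tuple T) (y : l.-tuple T) : probability (k.-tuple (l.-tuple R)) R :=
  tuple_prob (fun i => tuple_prob (fun j => W (tnth x i, tnth y j))).

Definition density k l (A : 'M[nat]_(k, l)) (L : latinon mu) : \bar R :=
  ((k`! * l`!)%N%:R%:E *
   \int[tuple_prob (fun _ : 'I_k => mu)]_(x in increasing_tuples (lat_f L))
   \int[tuple_prob (fun _ : 'I_l => mu)]_(y in increasing_tuples (lat_f L))
     entries_prob (lat_W L) x y (struct_class (map_mx (fun n => n%:R) A) I01))%E.

End density.

End latinons.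

(* Main.v *)
(** A Latinon (W, f) is observed through the kernels u_q (x, y) = W (x, y) (]-oo, q])
    and the sets D_q = {f <= q}, for q rational in [0, 1]. Weak (Frieze-Kannan)
    regularity gives, for each term of the sequence, successively refined partitions
    whose numbers of classes do not depend on the term, so that along a diagonal
    subsequence the masses of the classes and the averages of the u_q over pairs
    of classes all converge. The limiting masses are realised by nested partitions
    of the atomless space (Sierpinski); the limiting averages then form a bounded
    martingale, hence converge almost everywhere to kernels w_q, and the counting
    lemma shows that all densities of patterns decorated by differences of the u_q
    and of the indicators of the D_q converge to those of the limit (w_q, E_q).

    The limit is again a Latinon: f is the infimum of the q with x in E_q, and
    W (x, y) is the law of the infimum of the q with v <= w_q (x, y), v uniform.
    The permuton conditions say that the degrees of w_q are constant, which is a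
    condition on the first two moments of the degrees, i.e. on densities of stars.

    Finally, cut [0, 1] into N cells. The sum of the decorated densities over the
    boxes of cells compatible with A differs from the density of A by at most the
    probability that two coordinates share a cell, which is O(1 / N) uniformly over
    all Latinons because of the marginal conditions. *)

From HB Require Import structures.
Require Import Defs.
From mathcomp Require Import all_boot all_order all_algebra.
From mathcomp Require Import all_classical all_reals all_analysis.
From mathcomp Require Import measurable_realfun ring lra.
Set Implicit Arguments.
Unset Strict Implicit.
Unset Printing Implicit Defensive.
Import Order.TTheory GRing.Theory Num.Theory.
Import numFieldNormedType.Exports.
Local Open Scope classical_set_scope.
Local Open Scope ring_scope.

(** * Bounded measurable functions *)

(** Pattern densities pass to the limit through the cut norm only, and this requires at most one
    kernel for each pair (x_i, y_j). The observables are chosen accordingly: the mass given by W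
    (x_i, y_j) to an interval is one difference of two u_q, so confining every entry to a cell still
    costs one kernel per pair.

    The sets D_q cannot be treated in the same way. A weak limit of indicators is in general only a
    [0, 1]-valued function, no longer equal to its square. Each D_q is therefore made a union of
    classes of the partitions, so that its limit is again a set.

    No pointwise limit of the W is available; the limits w_q are ordered in q only up to null sets
    and need not be right continuous in q. Passing to the quantile function repairs the first
    defect, and the constant degrees show that the second one occurs only on null sets.

    Atoms of W (x, y) could create ties between entries in the limit. The marginals exclude them:
    two distinct entries of a sampled matrix differ in their row or column, and redrawing that index
    makes one entry uniform whatever the other is. *)

Section bounded_measurable.
Context (d : measure_display) (X : measurableType d) (R : realType).
Implicit Types (f g : X -> R).

(** Nearly all integrands are bounded and all measures are probabilities. This predicate gives
    integrability at once and is stable under the operations in use, including partial integration,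
    so that computations take place with real-valued integrals. *)
Definition bmf f := measurable_fun setT f /\ exists c, forall x, `|f x| <= c.

Lemma bmf_cst c : bmf (fun _ => c).
Proof. by split => //; exists `|c|. Qed.

Lemma bmfN f : bmf f -> bmf (fun x => - f x).
Proof.
move=> [mf [c fc]]; split; first exact: measurableT_comp.
by exists c => x; rewrite normrN.
Qed.

Lemma bmfD f g : bmf f -> bmf g -> bmf (fun x => f x + g x).
Proof.
move=> [mf [c fc]] [mg [c' gc]]; split; first exact: measurable_funD.
by exists (c + c') => x; rewrite (le_trans (ler_normD _ _))// lerD.
Qed.

Lemma bmfB f g : bmf f -> bmf g -> bmf (fun x => f x - g x).
Proof. by move=> bf bg; apply: bmfD => //; exact: bmfN. Qed.

Lemma bmfM f g : bmf f -> bmf g -> bmf (fun x => f x * g x).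
Proof.
move=> [mf [c fc]] [mg [c' gc]]; split; first exact: measurable_funM.
by exists (c * c') => x; rewrite normrM ler_pM.
Qed.

Lemma bmfZ c f : bmf f -> bmf (fun x => c * f x).
Proof. by move=> bf; apply: bmfM => //; exact: bmf_cst. Qed.

Lemma bmf_norm f : bmf f -> bmf (fun x => `|f x|).
Proof.
move=> [mf [c fc]]; split; first exact: measurableT_comp.
by exists c => x; rewrite normr_id.
Qed.

Lemma bmfX f n : bmf f -> bmf (fun x => f x ^+ n).
Proof.
move=> bf; elim: n => [|n IH].
  by rewrite (_ : (fun _ => _) = fun=> 1)//; exact: bmf_cst.
rewrite (_ : (fun _ => _) = fun x => f x * f x ^+ n); first exact: bmfM.
by apply/funext => x; rewrite exprS.
Qed.

Lemma bmf_indic (A : set X) : measurable A -> bmf (\1_A).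
Proof.
by move=> mA; split => //; exists 1 => x; rewrite indicE; case: (_ \in _); rewrite ?normr1 ?normr0.
Qed.

Lemma bmf_sum (I : Type) (r : seq I) (p : pred I) (f : I -> X -> R) :
  (forall i, bmf (f i)) -> bmf (fun x => \sum_(i <- r | p i) f i x).
Proof.
move=> bf; elim: r => [|i r IH].
  under eq_fun do rewrite big_nil; exact: bmf_cst.
under eq_fun do rewrite big_cons; case: (p i) => //; exact: bmfD.
Qed.

Lemma bmf_prod (I : Type) (r : seq I) (p : pred I) (f : I -> X -> R) :
  (forall i, bmf (f i)) -> bmf (fun x => \prod_(i <- r | p i) f i x).
Proof.
move=> bf; elim: r => [|i r IH].
  under eq_fun do rewrite big_nil; exact: bmf_cst.
under eq_fun do rewrite big_cons; case: (p i) => //; exact: bmfM.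
Qed.

End bounded_measurable.

Lemma bmf_comp (d d' : measure_display) (X : measurableType d)
    (Y : measurableType d') (R : realType) (f : Y -> R) (phi : X -> Y) :
  bmf f -> measurable_fun setT phi -> bmf (fun x => f (phi x)).
Proof.
move=> [mf [c fc]] mphi; split; last by exists c.
exact: measurableT_comp.
Qed.

Section bounded_integrals.
Context (d : measure_display) (X : measurableType d) (R : realType).
Variable P : probability X R.
Implicit Types (f g : X -> R).

Lemma bmf_integrable f : bmf f -> P.-integrable setT (EFin \o f).
Proof.
move=> [mf [c fc]]; apply: measurable_bounded_integrable => //.
  by rewrite -ge0_fin_numE// fin_num_measure.
exists c; split; first exact: num_real.
by move=> M cM x _; rewrite /= (le_trans (fc x))// ltW.
Qed.

Lemma EFin_int f : bmf f -> (\int[P]_x (f x)%:E)%E = (\int[P]_x f x)%:E.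
Proof.
move=> bf; rewrite /Rintegral fineK//.
exact/integrable_fin_num/bmf_integrable.
Qed.

Lemma int_cst c : \int[P]_x c = c.
Proof. by rewrite Rintegral_cst// [X in fine X](probability_setT P) mulr1. Qed.

Lemma intD f g : bmf f -> bmf g ->
  \int[P]_x (f x + g x) = \int[P]_x f x + \int[P]_x g x.
Proof. by move=> bf bg; rewrite RintegralD//; exact: bmf_integrable. Qed.

Lemma intB f g : bmf f -> bmf g ->
  \int[P]_x (f x - g x) = \int[P]_x f x - \int[P]_x g x.
Proof. by move=> bf bg; rewrite RintegralB//; exact: bmf_integrable. Qed.

Lemma intZl c f : bmf f -> \int[P]_x (c * f x) = c * \int[P]_x f x.
Proof. by move=> bf; rewrite RintegralZl//; exact: bmf_integrable. Qed.

Lemma intZr c f : bmf f -> \int[P]_x (f x * c) = (\int[P]_x f x) * c.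
Proof. by move=> bf; rewrite RintegralZr//; exact: bmf_integrable. Qed.

Lemma int_sum (I : Type) (r : seq I) (p : pred I) (f : I -> X -> R) :
  (forall i, bmf (f i)) ->
  \int[P]_x (\sum_(i <- r | p i) f i x) = \sum_(i <- r | p i) \int[P]_x f i x.
Proof.
move=> bf; elim: r => [|i r IH].
  by rewrite big_nil; under eq_Rintegral do rewrite big_nil; rewrite int_cst.
rewrite big_cons; under eq_Rintegral do rewrite big_cons.
case: (p i) => //; rewrite intD ?IH//; exact: bmf_sum.
Qed.

Lemma int_le f g : bmf f -> bmf g -> (forall x, f x <= g x) ->
  \int[P]_x f x <= \int[P]_x g x.
Proof. by move=> bf bg fg; apply: le_Rintegral => //; exact: bmf_integrable. Qed.

Lemma int_ge0 f : (forall x, 0 <= f x) -> 0 <= \int[P]_x f x.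
Proof. by move=> f0; exact: Rintegral_ge0. Qed.

Lemma int_norm f : bmf f -> `|\int[P]_x f x| <= \int[P]_x `|f x|.
Proof. by move=> bf; apply: le_normr_Rintegral => //; exact: bmf_integrable. Qed.

Lemma int_le_cst c f : bmf f -> (forall x, f x <= c) -> \int[P]_x f x <= c.
Proof. by move=> bf fc; rewrite -[leRHS]int_cst; apply: int_le => //; exact: bmf_cst. Qed.

Lemma int_norm_le_cst c f : bmf f -> (forall x, `|f x| <= c) ->
  `|\int[P]_x f x| <= c.
Proof.
move=> bf fc; rewrite (le_trans (int_norm bf))//.
by apply: int_le_cst => //; exact: bmf_norm.
Qed.

Lemma int_indic (A : set X) : measurable A -> \int[P]_x \1_A x = fine (P A).
Proof. by move=> mA; rewrite /Rintegral integral_indic// setIT. Qed.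

Lemma int_ae f g : bmf f -> bmf g -> {ae P, forall x, f x = g x} ->
  \int[P]_x f x = \int[P]_x g x.
Proof.
move=> [mf _] [mg _] fg; rewrite /Rintegral; congr fine.
apply: ae_eq_integral => //; try exact/measurable_EFinP.
by apply: filterS fg => x /= + _ => ->.
Qed.

Lemma int_norm_eq0 f : bmf f -> \int[P]_x `|f x| = 0 -> {ae P, forall x, f x = 0}.
Proof.
move=> bf f0; have mf : measurable_fun setT (EFin \o f) by apply/measurable_EFinP; case: bf.
have : (\int[P]_x `|(EFin \o f) x| = 0)%E.
  by rewrite -[RHS]/(0%:E) -f0 -EFin_int//; exact: bmf_norm.
move/(ae_eq_integral_abs P measurableT mf).
by apply: filterS => x /(_ I)[].
Qed.

(* Jensen's inequality for the square, through the variance. *)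
Lemma int_sqr_le f : bmf f -> (\int[P]_x f x) ^+ 2 <= \int[P]_x f x ^+ 2.
Proof.
move=> bf; set m := \int[P]_x f x.
have : 0 <= \int[P]_x (f x - m) ^+ 2 by apply: int_ge0 => x; exact: sqr_ge0.
rewrite (_ : (fun x => (f x - m) ^+ 2) = (fun x => f x ^+ 2 - (m *+ 2 * f x - m ^+ 2))); last first.
  by apply/funext => x; ring.
have bX : bmf (fun x => f x ^+ 2) by exact: bmfX.
rewrite intB//; last by apply: bmfB; [exact: bmfZ|exact: bmf_cst].
rewrite intB//; [|exact: bmfZ|exact: bmf_cst].
by rewrite intZl// int_cst -/m mulrnAl -expr2 mulr2n addrK subr_ge0.
Qed.

Lemma int_cvg (f_ : nat -> X -> R) f c : (forall n, measurable_fun setT (f_ n)) ->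
  (forall n x, `|f_ n x| <= c) -> bmf f ->
  {ae P, forall x, f_ ^~ x @ \oo --> f x} ->
  (fun n => \int[P]_x f_ n x) @ \oo --> \int[P]_x f x.
Proof.
move=> mf_ f_c bf ff.
have bf_ n : bmf (f_ n) by split => //; exists c.
have mF n : measurable_fun setT (EFin \o f_ n) by exact/measurable_EFinP.
have mf : measurable_fun setT (EFin \o f) by apply/measurable_EFinP; case: bf.
have FF : \forall x \ae P, setT x -> (EFin \o f_ n) x @[n --> \oo] --> (EFin \o f) x.
  apply: filterS ff => x fx _; apply: cvg_EFin => //.
  by apply: nearW.
have Fc : \forall x \ae P, forall n, setT x -> (`|(EFin \o f_ n) x| <= (cst c%:E) x)%E.
  by apply: aeW => x n _ /=; rewrite lee_fin.
have [_ _] := dominated_convergence measurableT mF mf FF (bmf_integrable (bmf_cst _ c)) Fc.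
by rewrite [X in _ --> X]EFin_int// => /fine_cvgP[].
Qed.

End bounded_integrals.

Section bounded_fubini.
Context (d d' : measure_display) (X : measurableType d) (Y : measurableType d')
  (R : realType) (P : probability X R) (Q : probability Y R).
Implicit Types f : X * Y -> R.

Lemma bmf_xsection f x : bmf f -> bmf (fun y => f (x, y)).
Proof. by move=> bf; apply: (bmf_comp bf); exact: pair1_measurable. Qed.

Lemma bmf_ysection f y : bmf f -> bmf (fun x => f (x, y)).
Proof. by move=> bf; apply: (bmf_comp bf); exact: pair2_measurable. Qed.

Lemma bmf_fst (f : X -> R) : bmf f -> bmf (fun z : X * Y => f z.1).
Proof. by move=> bf; exact: bmf_comp. Qed.

Lemma bmf_snd (f : Y -> R) : bmf f -> bmf (fun z : X * Y => f z.2).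
Proof. by move=> bf; exact: bmf_comp. Qed.

Lemma bmf_int2 f : bmf f -> bmf (fun x => \int[Q]_y f (x, y)).
Proof.
move=> bf; split; last first.
  have [_ [c fc]] := bf; exists c => x.
  by apply: int_norm_le_cst => //; exact: bmf_xsection.
apply/measurable_EFinP.
rewrite (_ : _ \o _ = fubini_F Q (EFin \o f)); last first.
  apply/funext => x; rewrite /fubini_F /= EFin_int//; exact: bmf_xsection.
exact/measurable_fubini_F/(bmf_integrable (P \x Q)%E).
Qed.

Lemma bmf_int1 f : bmf f -> bmf (fun y => \int[P]_x f (x, y)).
Proof.
move=> bf; split; last first.
  have [_ [c fc]] := bf; exists c => y.
  by apply: int_norm_le_cst => //; exact: bmf_ysection.
apply/measurable_EFinP.
rewrite (_ : _ \o _ = fubini_G P (EFin \o f)); last first.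
  apply/funext => y; rewrite /fubini_G /= EFin_int//; exact: bmf_ysection.
exact/(@measurable_fubini_G _ _ _ _ _ P Q)/(bmf_integrable (P \x Q)%E).
Qed.

Lemma int_prod12 f : bmf f ->
  \int[(P \x Q)%E]_z f z = \int[P]_x \int[Q]_y f (x, y).
Proof.
move=> bf; rewrite /Rintegral -integral12_prod_meas1; last exact: (bmf_integrable (P \x Q)%E).
congr fine; apply: eq_integral => x _; rewrite /fubini_F EFin_int//.
exact: bmf_xsection.
Qed.

Lemma int_prod21 f : bmf f ->
  \int[(P \x Q)%E]_z f z = \int[Q]_y \int[P]_x f (x, y).
Proof.
move=> bf; rewrite /Rintegral -integral21_prod_meas1; last exact: (bmf_integrable (P \x Q)%E).
congr fine; apply: eq_integral => x _; rewrite /fubini_G EFin_int//.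
exact: bmf_ysection.
Qed.

Lemma int_swap f : bmf f ->
  \int[P]_x \int[Q]_y f (x, y) = \int[Q]_y \int[P]_x f (x, y).
Proof. by move=> bf; rewrite -int_prod12// int_prod21. Qed.

Lemma int_distribution (phi : {mfun X >-> Y}) (f : Y -> R) : bmf f ->
  \int[distribution P phi]_y f y = \int[P]_x f (phi x).
Proof.
move=> bf; rewrite /Rintegral integral_distribution//.
  by apply/measurable_EFinP; case: bf.
by apply: bmf_integrable; apply: bmf_comp bf _.
Qed.

End bounded_fubini.

(** * Averages over finite partitions and weak regularity *)

Section finite_code.
Context (d : measure_display) (X : measurableType d) (I : finType).
Implicit Types c : X -> I.

(** A finite partition is represented by the map sending a point to its class. Coarsening is then
    composition with a map of labels, and the join of two partitions is pairing. *)
Definition mcode c := forall i, measurable (c @^-1` [set i]).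

Lemma mcode_preimage c (A : set I) : mcode c -> measurable (c @^-1` A).
Proof.
move=> mc; rewrite (_ : _ @^-1` _ = \bigcup_(i in A) (c @^-1` [set i])); last first.
  by apply/seteqP; split=> [x Ax|x [i /= Ai] cx]; [by exists (c x)|by rewrite /= cx].
by apply: fin_bigcup_measurable => // i _; exact: mc.
Qed.

Variable R : realType.

Lemma bmf_code_eq c i : mcode c -> bmf (fun x => (c x == i)%:R : R).
Proof.
move=> mc; rewrite (_ : (fun _ => _) = \1_(c @^-1` [set i])); first exact: bmf_indic.
by apply/funext => x; rewrite indicE; congr (nat_of_bool _)%:R; apply/eqP/idP; rewrite inE.
Qed.

Lemma code_sumE c (h : I -> R) x : h (c x) = \sum_i h i * (c x == i)%:R.
Proof.
rewrite (bigD1 (c x))//= eqxx mulr1 big1 ?addr0// => i /negbTE; rewrite eq_sym => ->.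
by rewrite mulr0.
Qed.

Lemma bmf_code c (h : I -> R) : mcode c -> bmf (fun x => h (c x)).
Proof.
move=> mc; rewrite (_ : (fun _ => _) = fun x => \sum_i h i * (c x == i)%:R).
  by apply: bmf_sum => i; apply/bmfZ/bmf_code_eq.
by apply/funext => x; exact: code_sumE.
Qed.

End finite_code.

Lemma mcode_comp (d : measure_display) (X : measurableType d) (I J : finType)
  (c : X -> I) (r : I -> J) : mcode c -> mcode (fun x => r (c x)).
Proof. by move=> mc j; exact: (mcode_preimage [set i | r i = j] mc). Qed.

Lemma mcode_pair (d : measure_display) (X : measurableType d) (I J : finType)
  (c : X -> I) (c' : X -> J) : mcode c -> mcode c' -> mcode (fun x => (c x, c' x)).
Proof.
move=> mc mc' [i j].
rewrite (_ : _ @^-1` _ = c @^-1` [set i] `&` c' @^-1` [set j]).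
  exact: measurableI.
by apply/seteqP; split => x /= [-> ->].
Qed.

Section averages.
Context (d : measure_display) (X : measurableType d) (R : realType).
Variable P : probability X R.

Section one_code.
Context (I : finType) (c : X -> I).
Hypothesis mc : mcode c.
Implicit Types u : X -> R.

Definition cprob i := \int[P]_x (c x == i)%:R.

(* This is 0 on null classes, where the division is by 0. *)
Definition avg u i := (\int[P]_x (u x * (c x == i)%:R)) / cprob i.

(** The conditional expectation of [u] given the finite sigma-algebra generated by [c]. *)
Definition ce u x := avg u (c x).

Lemma int_codeM (h : I -> R) u : bmf u ->
  \int[P]_x (h (c x) * u x) = \sum_i h i * \int[P]_x (u x * (c x == i)%:R).
Proof.
move=> bu.
under eq_Rintegral do rewrite code_sumE mulr_suml.
rewrite int_sum; last first.
  by move=> i; apply: bmfM => //; apply/bmfZ/bmf_code_eq.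
apply: eq_bigr => i _; rewrite -intZl; last by apply: bmfM => //; exact: bmf_code_eq.
by apply: eq_Rintegral => x _; rewrite mulrAC -mulrA.
Qed.

Lemma cprob_ge0 i : 0 <= cprob i.
Proof. by apply: int_ge0 => x; rewrite ler0n. Qed.

Lemma cprob_le1 i : cprob i <= 1.
Proof.
by apply: int_le_cst; [exact: bmf_code_eq|move=> x; case: (_ == _)].
Qed.

Lemma int_code (h : I -> R) : \int[P]_x h (c x) = \sum_i h i * cprob i.
Proof.
under eq_Rintegral do rewrite -[h _]mulr1.
rewrite (int_codeM _ (bmf_cst _ 1)).
by apply: eq_bigr => i _; congr (_ * _); apply: eq_Rintegral => x _; rewrite mul1r.
Qed.

(** Null classes are harmless: there the right-hand side is at most a bound of [u] times the mass of
    the class, hence 0 like the left-hand side. *)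
Lemma avgM u i : bmf u -> avg u i * cprob i = \int[P]_x (u x * (c x == i)%:R).
Proof.
move=> bu; have [p0|p0] := eqVneq (cprob i) 0; last by rewrite /avg divfK.
rewrite p0 mulr0; have [_ [C uC]] := bu.
have bui : bmf (fun x => u x * (c x == i)%:R) by apply: bmfM => //; exact: bmf_code_eq.
apply/esym/eqP; rewrite -normr_le0 (le_trans (int_norm _ bui))//.
rewrite -(mulr0 C) -p0 /cprob -intZl; last exact: bmf_code_eq.
apply: int_le; [exact: bmf_norm|exact/bmfZ/bmf_code_eq|move=> x].
by rewrite normrM (ger0_norm (ler0n _ _)) ler_wpM2r// ler0n.
Qed.

Lemma bmf_ce u : bmf (ce u).
Proof. exact: bmf_code. Qed.

Lemma int_ce (h : I -> R) u : bmf u ->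
  \int[P]_x (h (c x) * ce u x) = \int[P]_x (h (c x) * u x).
Proof.
move=> bu; rewrite [RHS]int_codeM// [LHS](int_code (fun i => h i * avg u i)).
by apply: eq_bigr => i _; rewrite -mulrA avgM.
Qed.

Lemma avg01 u i : bmf u -> (forall x, 0 <= u x <= 1) -> 0 <= avg u i <= 1.
Proof.
move=> bu u01; apply/andP; split.
  apply: divr_ge0; last exact: cprob_ge0.
  by apply: int_ge0 => x; have /andP[u0 _] := u01 x; rewrite mulr_ge0.
have [p0|p0] := eqVneq (cprob i) 0; first by rewrite /avg p0 invr0 mulr0.
have pp : 0 < cprob i by rewrite lt_def p0 cprob_ge0.
rewrite /avg ler_pdivrMr// mul1r; apply: int_le.
- by apply: bmfM => //; exact: bmf_code_eq.
- exact: bmf_code_eq.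
- by move=> x; have /andP[_ u1] := u01 x; rewrite ler_piMl.
Qed.

(** The potential of the energy increment argument: bounded by 1 for [u] with values in [0, 1], and
    monotone under refinement. *)
Definition energy u := \int[P]_x (ce u x) ^+ 2.

Lemma energy01 u : bmf u -> (forall x, 0 <= u x <= 1) -> 0 <= energy u <= 1.
Proof.
move=> bu u01; apply/andP; split; first by apply: int_ge0 => x; exact: sqr_ge0.
apply: int_le_cst; first exact/bmfX/bmf_ce.
move=> x; have /andP[a0 a1] := avg01 (c x) bu u01.
exact: exprn_ile1.
Qed.

End one_code.

(** Averages depend on the partition and not on its labels; this allows a code to be padded with
    constant bits. *)
Lemma avg_eq (I J : finType) (c : X -> I) (c' : X -> J) u x :
  (forall x y, (c x == c y) = (c' x == c' y)) -> avg c u (c x) = avg c' u (c' x).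
Proof.
move=> cc'; rewrite /avg /cprob; congr (_ / _).
  by apply: eq_Rintegral => y _; rewrite cc'.
by apply: eq_Rintegral => y _; rewrite cc'.
Qed.

Section refinement.
Context (I J : finType) (c : X -> I) (r : I -> J) (u : X -> R).
Hypotheses (mc : mcode c) (bu : bmf u).
Let c' x := r (c x).
Let mc' : mcode c' := mcode_comp r mc.

(** Pythagoras: [ce c' u] is the orthogonal projection of [ce c u] on the functions of the coarser
    code. *)
Lemma energy_refine :
  energy c u - energy c' u = \int[P]_x (ce c u x - ce c' u x) ^+ 2.
Proof.
have bc := bmf_ce mc u; have bc' := bmf_ce mc' u.
rewrite (_ : (fun x => (_ - _) ^+ 2) = (fun x => ce c u x ^+ 2 -
    (2 * (ce c' u x * ce c u x) - ce c' u x ^+ 2))); last by apply/funext => x; ring.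
have bcc' : bmf (fun x => ce c' u x * ce c u x) by exact: bmfM.
rewrite !intB//; try exact: bmfX; try exact: bmfZ; last first.
  by apply: bmfB; [exact: bmfZ|exact: bmfX].
rewrite intZl//.
have -> : \int[P]_x (ce c' u x * ce c u x) = \int[P]_x ce c' u x ^+ 2.
  rewrite (int_ce mc (fun i => avg c' u (r i)) bu).
  under [RHS]eq_Rintegral do rewrite expr2.
  by rewrite (int_ce mc' (fun i => avg c' u i) bu).
by rewrite -!/(energy _ _); move: (energy c u) (energy c' u) => a b; ring.
Qed.

Lemma energy_le_refine : energy c' u <= energy c u.
Proof. by rewrite -subr_ge0 energy_refine; apply: int_ge0 => x; exact: sqr_ge0. Qed.

(** A test function of the finer code cannot tell [u] from [ce c u], so Cauchy-Schwarz bounds the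
    test by the norm of [ce c u - ce c' u]. Any witness of irregularity is thus paid for by a gain
    of energy. *)
Lemma energy_incr (h : I -> R) : (forall i, `|h i| <= 1) ->
  (\int[P]_x ((u x - ce c' u x) * h (c x))) ^+ 2 <= energy c u - energy c' u.
Proof.
move=> h1; have bc := bmf_ce mc u; have bc' := bmf_ce mc' u.
have bh : bmf (fun x => h (c x)) by exact: bmf_code.
have -> : \int[P]_x ((u x - ce c' u x) * h (c x)) =
    \int[P]_x ((ce c u x - ce c' u x) * h (c x)).
  under eq_Rintegral do rewrite mulrC mulrBr.
  under [RHS]eq_Rintegral do rewrite mulrC mulrBr.
  by rewrite intB ?[in RHS]intB ?int_ce//; exact: bmfM.
have bb : bmf (fun x => ce c u x - ce c' u x) by exact: bmfB.
rewrite (le_trans (int_sqr_le _ _))//; first exact: bmfM.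
rewrite energy_refine; apply: int_le; [exact/bmfX/bmfM|exact: bmfX|move=> x].
rewrite exprMn ler_piMr ?sqr_ge0//.
by rewrite -real_normK ?num_real// exprn_ile1.
Qed.

End refinement.
End averages.

(** * The cut norm, in functional and in set form *)

Section cut_norm.
Context (d : measure_display) (T : measurableType d) (R : realType).
Variable mu : probability T R.
Implicit Types (w : T * T -> R) (phi : T -> R).

(** The functional form is what the counting lemma consumes. The set form [cut_set_le] is what
    regularity produces, because its failure yields two sets with which to refine a partition. Both
    are stated as upper bounds, which avoids a supremum. *)
Definition cut_le w (e : R) := forall g h : T -> R,
  measurable_fun setT g -> measurable_fun setT h ->
  (forall x, `|g x| <= 1) -> (forall x, `|h x| <= 1) ->
  `|\int[(mu \x mu)%E]_z (w z * (g z.1 * h z.2))| <= e.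

Definition cut_set_le w (e : R) := forall S U : set T, measurable S -> measurable U ->
  `|\int[(mu \x mu)%E]_z (w z * (\1_S z.1 * \1_U z.2))| <= e.

Lemma bmf1 (g : T -> R) : measurable_fun setT g -> (forall x, `|g x| <= 1) -> bmf g.
Proof. by move=> mg g1; split => //; exists 1. Qed.

(* The extreme g is the sign of phi. *)
Lemma int_sign phi (e : R) (g : T -> R) : bmf phi ->
  (forall S, measurable S -> `|\int[mu]_x (phi x * \1_S x)| <= e) ->
  measurable_fun setT g -> (forall x, `|g x| <= 1) ->
  `|\int[mu]_x (phi x * g x)| <= 2 * e.
Proof.
move=> bphi phie mg g1; have bg := bmf1 mg g1.
pose S := [set x | 0 <= phi x].
have mS : measurable S.
  rewrite -[S]setTI (_ : _ `&` _ = setT `&` phi @^-1` `[0, +oo[); last first.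
    by rewrite !setTI; apply/seteqP; split => x /=; rewrite in_itv/= andbT.
  by case: bphi => mphi _; apply: mphi.
have := phie _ mS; have := phie _ (measurableC mS).
rewrite !ler_norml => /andP[H1 _] /andP[_ H2].
rewrite -ler_norml (le_trans (int_norm _ _))//; first exact: bmfM.
apply: (@le_trans _ _ (\int[mu]_x (phi x * \1_S x - phi x * \1_(~` S) x))).
  apply: int_le.
  - by apply/bmf_norm/bmfM.
  - by apply: bmfB; apply: bmfM => //; apply: bmf_indic => //; exact: measurableC.
  - move=> x; rewrite normrM (le_trans (ler_wpM2l _ (g1 x)))// mulr1 !indicE in_setC.
    have [xS|xS] := boolP (x \in S).
      by rewrite mulr1 mulr0 subr0 ger0_norm//; move: xS; rewrite inE.
    rewrite mulr1 mulr0 sub0r ltr0_norm// ltNge; apply: contra xS => h; exact/mem_set.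
rewrite intB; [|by apply: bmfM => //; exact: bmf_indic|
  by apply: bmfM => //; apply: bmf_indic; exact: measurableC].
by rewrite mulr_natl mulr2n lerD// lerNl.
Qed.

Lemma bmf_cutx w (h : T -> R) : bmf w -> bmf h ->
  bmf (fun x => \int[mu]_y (w (x, y) * h y)).
Proof.
move=> bw bh; have bwh : bmf (fun z : T * T => w z * h z.2) by apply: bmfM => //; exact: bmf_snd.
exact: (bmf_int2 mu mu bwh).
Qed.

Lemma bmf_cuty w (g : T -> R) : bmf w -> bmf g ->
  bmf (fun y => \int[mu]_x (w (x, y) * g x)).
Proof.
move=> bw bg; have bwg : bmf (fun z : T * T => w z * g z.1) by apply: bmfM => //; exact: bmf_fst.
exact: (bmf_int1 mu mu bwg).
Qed.

Lemma int_cutx w (g h : T -> R) : bmf w -> bmf g -> bmf h ->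
  \int[(mu \x mu)%E]_z (w z * (g z.1 * h z.2)) =
  \int[mu]_x ((\int[mu]_y (w (x, y) * h y)) * g x).
Proof.
move=> bw bg bh; rewrite int_prod12; last first.
  by apply: bmfM => //; apply: bmfM; [exact: bmf_fst|exact: bmf_snd].
apply: eq_Rintegral => x _; rewrite -intZr; last first.
  by apply: bmfM => //; exact: bmf_xsection.
by apply: eq_Rintegral => y _ /=; rewrite [g x * _]mulrC mulrA.
Qed.

Lemma int_cuty w (g h : T -> R) : bmf w -> bmf g -> bmf h ->
  \int[(mu \x mu)%E]_z (w z * (g z.1 * h z.2)) =
  \int[mu]_y ((\int[mu]_x (w (x, y) * g x)) * h y).
Proof.
move=> bw bg bh; rewrite int_prod21; last first.
  by apply: bmfM => //; apply: bmfM; [exact: bmf_fst|exact: bmf_snd].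
apply: eq_Rintegral => y _; rewrite -intZr; last first.
  by apply: bmfM => //; exact: bmf_ysection.
by apply: eq_Rintegral => x _ /=; rewrite mulrA.
Qed.

(** A factor 2 for each variable: with one test function frozen, the integral is linear in the
    other, which [int_sign] replaces by an indicator. *)
Lemma cut_set_cut w (e : R) : bmf w -> cut_set_le w e -> cut_le w (4 * e).
Proof.
move=> bw we g h mg mh g1 h1; have bg := bmf1 mg g1; have bh := bmf1 mh h1.
rewrite int_cutx// (_ : 4 * e = 2 * (2 * e)); last by ring.
apply: int_sign => //; first exact: bmf_cutx.
move=> S mS; have bS := bmf_indic R mS.
rewrite -int_cutx// int_cuty//.
apply: int_sign => //; first exact: bmf_cuty.
move=> U mU; have bU := bmf_indic R mU.
by rewrite -int_cuty//; exact: we.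
Qed.

End cut_norm.

(** * Weak regularity with a number of classes independent of the space *)

Section regularity.
Context (R : realType).

Definition code2 (T : Type) (I : finType) (c : T -> I) (z : T * T) := (c z.1, c z.2).

Lemma mcode_code2 (d : measure_display) (T : measurableType d) (I : finType)
  (c : T -> I) : mcode c -> mcode (code2 c).
Proof.
move=> mc; apply: mcode_pair => i.
  by have := @measurable_fst _ _ T T measurableT _ (mc i); rewrite setTI.
by have := @measurable_snd _ _ T T measurableT _ (mc i); rewrite setTI.
Qed.

Definition regular (d : measure_display) (T : measurableType d)
    (mu : probability T R) (I : finType) (c : T -> I) (u : T * T -> R) e :=
  cut_set_le mu (fun z => u z - ce (mu \x mu)%E (code2 c) u z) e.

(** One pair of bits per refinement step, for the two sets that witness a failure of regularity. The
    type depends on the number of steps alone, hence not on the space. *)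
Fixpoint bitpairs n : finType :=
  if n is m.+1 then (bitpairs m * (bool * bool))%type else unit.

Lemma sum_increment (Q : nat) (a b : nat -> R) q (x e : R) : (q < Q)%N ->
  (forall k, a k <= b k) -> e <= b q - a q -> x <= \sum_(k < Q) a k ->
  x + e <= \sum_(k < Q) b k.
Proof.
move=> qQ ab eq xa; rewrite (le_trans (lerD xa eq))// addrC -lerBrDr -sumrB.
rewrite (bigD1 (Ordinal qQ))//= lerDl; apply: sumr_ge0 => k _.
by rewrite subr_ge0.
Qed.

(** Each failure of regularity, for some kernel and sets [S] and [U], is turned into two new bits.
    Testing against the product of these bits shows that the energy of that kernel rises by at least
    the square of [e], while refinement lowers no other energy. *)
Lemma regularity_step (d : measure_display) (T : measurableType d)
    (mu : probability T R) (I : finType) (c : T -> I) (u : nat -> T * T -> R)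
    (Q : nat) (e : R) (n : nat) : 0 < e -> mcode c ->
    (forall q, bmf (u q)) -> (forall q z, 0 <= u q z <= 1) ->
  exists2 new : T -> bitpairs n, mcode new &
    (forall q, (q < Q)%N -> regular mu (fun x => (c x, new x)) (u q) e) \/
    n%:R * e ^+ 2 <= \sum_(q < Q) energy (mu \x mu)%E (code2 (fun x => (c x, new x))) (u q).
Proof.
move=> e0 mc bu u01; elim: n => [|n [new mnew H]].
  exists (fun=> tt) => [[]|].
    by rewrite (_ : _ @^-1` _ = setT)//; apply/seteqP; split.
  right; rewrite mul0r; apply: sumr_ge0 => q _.
  by have /andP[] := energy01 (mu \x mu)%E (mcode_code2 (mcode_pair mc
   (mcode_comp (fun=> tt) mc))) (bu q) (u01 q).
pose c1 x := (c x, new x).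
have mc1 : mcode c1 by exact: mcode_pair.
have [reg|] := pselect (forall q, (q < Q)%N -> regular mu c1 (u q) e).
  (* Constant bits keep the prescribed type without changing the partition. *)
  exists (fun x => (new x, (false, false))); first exact: (mcode_comp (fun i => (i, (false, false))) mnew).
  left => q qQ S U mS mU.
  rewrite [X in `|X|](_ : _ = \int[(mu \x mu)%E]_z ((u q z - ce (mu \x mu)%E (code2 c1) (u q) z) *
      (\1_S z.1 * \1_U z.2))); first exact: reg.
  apply: eq_Rintegral => z _; congr ((_ - _) * _); apply: avg_eq => -[x1 x2] [y1 y2].
  by rewrite /code2/= /c1 !xpair_eqE !andbT.
case: H => [//|H] /existsNP[q /not_implyP[qQ]].
move=> /existsNP[S] /existsNP[U] /not_implyP[mS] /not_implyP[mU] /negP; rewrite -ltNge => viol.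
pose bS x := x \in S; pose bU x := x \in U.
have mbS V : measurable V -> mcode (fun x : T => x \in V).
  move=> mV [|].
    by rewrite (_ : _ @^-1` _ = V)//; apply/seteqP; split => x /=; [exact: set_mem|exact: mem_set].
  rewrite (_ : _ @^-1` _ = ~` V); first exact: measurableC.
  by apply/seteqP; split => x /=; [move=> + Vx; rewrite mem_set|move=> Vx; apply/negbTE/negP; rewrite inE].
pose new' x := (new x, (bS x, bU x)).
have mnew' : mcode new' by apply: mcode_pair => //; apply: mcode_pair; exact: mbS.
exists new' => //; right.
pose c' x := (c x, new' x); have mc' : mcode c' by exact: mcode_pair.
pose r1 (i : I * bitpairs n.+1) := (i.1, i.2.1).
pose r (i : (I * bitpairs n.+1) * (I * bitpairs n.+1)) := (r1 i.1, r1 i.2).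
have cE : code2 c1 = (fun z => r (code2 c' z)) by [].
have mono k : energy (mu \x mu)%E (code2 c1) (u k) <= energy (mu \x mu)%E (code2 c') (u k).
  by rewrite cE; apply: energy_le_refine => //; exact: mcode_code2.
(* The indicator of [S] in the first variable times that of [U] in the second, read off from the
   finer code. *)
pose h (i : (I * bitpairs n.+1) * (I * bitpairs n.+1)) : R :=
  i.1.2.2.1%:R * i.2.2.2.2%:R.
have h1 i : `|h i| <= 1.
  rewrite /h -natrM normr_nat lern1 (leq_trans (leq_mul (leq_b1 _) (leq_b1 _)))//.
have incr := energy_incr (mu \x mu)%E r (mcode_code2 mc') (bu q) h1.
have {}incr : e ^+ 2 <= energy (mu \x mu)%E (code2 c') (u q) - energy (mu \x mu)%E (code2 c1) (u q).
  apply: le_trans incr; rewrite -[leRHS]real_normK ?num_real// ler_sqr ?nnegrE ?normr_ge0 ?(ltW e0)//.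
  exact: ltW.
have -> : n.+1%:R * e ^+ 2 = n%:R * e ^+ 2 + e ^+ 2 by rewrite -addn1 natrD mulrDl mul1r.
exact: (sum_increment qQ mono incr H).
Qed.

(** The type [J] is chosen before the space, the measure, the given code and the kernels: all terms
    of the sequence get partitions with the same labels, whose masses and averages can be
    compared. *)
Lemma regularity (Q : nat) (e : R) : 0 < e ->
  exists J : finType, forall (d : measure_display) (T : measurableType d)
    (mu : probability T R) (I : finType) (c : T -> I) (u : nat -> T * T -> R),
    mcode c -> (forall q, bmf (u q)) -> (forall q z, 0 <= u q z <= 1) ->
  exists2 new : T -> J, mcode new &
    forall q, (q < Q)%N -> regular mu (fun x => (c x, new x)) (u q) e.
Proof.
(* Each of the [Q] energies is at most 1, and [n] increments by the square of [e] would bring their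
   sum above [Q]. *)
move=> e0; pose n := (Num.truncn (Q%:R / e ^+ 2)).+1.
exists (bitpairs n) => d T mu I c u mc bu u01.
have [new mnew [reg|]] := regularity_step mu Q n e0 mc bu u01; first by exists new.
have : Q%:R < n%:R * e ^+ 2.
  rewrite -ltr_pdivrMr ?exprn_gt0//.
  exact: truncnS_gt.
move=> lt le; exfalso; have := lt_le_trans lt le; apply/negP; rewrite -leNgt.
rewrite (le_trans (y := \sum_(q < Q) 1))//; last by rewrite sumr_const card_ord.
apply: ler_sum => q _.
by have /andP[] := energy01 (mu \x mu)%E (mcode_code2 (mcode_pair mc mnew)) (bu q) (u01 q).
Qed.

End regularity.

(** * Diagonal subsequences and sets of prescribed measure *)

Lemma strict_subseq (P : nat -> nat -> Prop) :
  (forall m N, exists2 n, (N <= n)%N & P m n) ->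
  exists s : nat -> nat, {homo s : i j / (i < j)%N} /\ forall m, P m (s m).
Proof.
move=> H.
have {}H mN : {n | (mN.2 <= n)%N & P mN.1 n} by apply/cid2; exact: H.
pose pick m N := s2val (H (m, N)).
pose s := fix s m := if m is k.+1 then pick m (s k).+1 else pick 0 0.
exists s; split; last first.
  by case=> [|m]; rewrite /s /pick -/s; case: (H _).
apply: homo_ltn => //.
- by move=> y x z; exact: ltn_trans.
- by move=> m; rewrite /= /pick; case: (H _).
Qed.

(** The sequence lives in a power of [0, 1], compact by Tychonoff, and has a cluster point [l].
    Since [K] is countable, terms can be picked that are within 1 / (m + 1) of [l] on the
    coordinates numbered below m, and these converge in every coordinate. *)
Lemma diag_subseq (R : realType) (K : countType) (a : nat -> K -> R) :
  (forall n k, 0 <= a n k <= 1) ->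
  exists s : nat -> nat, {homo s : i j / (i < j)%N} /\
    exists l : K -> R, forall k, (fun n => a (s n) k) @ \oo --> l k.
Proof.
move=> a01; have bE (x y e : R) : ball x e y -> `|x - y| < e by rewrite -ball_normE.
pose A (k : K) : set R := `[0, 1]%classic.
have cA : compact [set f : prod_topology (fun _ : K => R) | forall k, A k (f k)].
  by apply: tychonoff => k; exact: segment_compact.
have aA : (fmap (a : nat -> prod_topology (fun _ : K => R)) \oo) [set f | forall k, A k (f k)].
  by exists 0%N => // n _ k; rewrite /A /= in_itv; exact: a01.
have [l [_ al]] := cA _ _ aA.
have nb m : nbhs (l : prod_topology (fun _ : K => R))
    [set f | forall k, (pickle k < m)%N -> `|l k - f k| < m.+1%:R^-1].
  pose B i : set (prod_topology (fun _ : K => R)) := if @unpickle K i is Some k then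
    @proj K (fun=> R) k @^-1` ball (l k) m.+1%:R^-1 else setT.
  have nB i : nbhs (l : prod_topology (fun _ : K => R)) (B i).
    rewrite /B; case: unpickle => [k|]; last exact: filterT.
    have nb : nbhs (l k) (ball (l k) m.+1%:R^-1) by apply: nbhsx_ballx; rewrite invr_gt0.
    exact: (@proj_continuous K (fun=> R) k l _ nb).
  have H N : nbhs (l : prod_topology (fun _ : K => R)) [set f | forall i, (i < N)%N -> B i f].
    elim: N => [|N IH]; first by apply: filterS filterT => f _ i.
    apply: filterS (filterI IH (nB N)) => f [Bf BN] i; rewrite ltnS leq_eqVlt => /orP[/eqP->//|].
    exact: Bf.
  apply: filterS (H m) => f Bf k km; have := Bf _ km.
  by rewrite /B pickleK => /bE.
have [|s [s_incr sP]] := @strict_subseq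
    (fun m n => forall k, (pickle k < m)%N -> `|l k - a n k| < m.+1%:R^-1).
  move=> m N.
  have aN : (fmap (a : nat -> prod_topology (fun _ : K => R)) \oo) (a @` [set n | (N <= n)%N]).
    by exists N => // n /= Nn; exists n.
  have [_ [[n Nn <-] H]] := al _ _ aN (nb m).
  by exists n.
exists s; split => //; exists l => k.
apply/cvgrPdist_lt => e e0; near=> n.
apply: (@lt_trans _ _ n.+1%:R^-1).
  by apply: sP; near: n; exact: nbhs_infty_gt.
by near: n; exact: near_infty_natSinv_lt (PosNum e0).
Unshelve. all: by end_near.
Qed.

(** * Sierpinski's theorem for atomless probabilities *)

Section sierpinski.
Context (d : measure_display) (T : measurableType d) (R : realType).
Variable mu : probability T R.
Hypothesis mu_atomless : atomless mu.
Local Open Scope ereal_scope.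

Lemma mu_fin A : measurable A -> mu A \is a fin_num.
Proof. exact: fin_num_measure. Qed.

(** Split the set and keep the smaller piece: the measure is at least halved each time. *)
Lemma atomless_small A : measurable A -> 0 < mu A -> forall n,
  exists B, [/\ measurable B, B `<=` A, 0 < mu B & mu B <= (2^-1 ^+ n)%:E].
Proof.
move=> mA A0; elim=> [|n [B [mB BA B0 Bn]]].
  by exists A; split => //; exact: probability_le1.
have [C [mC CB C0 CltB]] := mu_atomless mB B0.
have mBC : measurable (B `\` C) by exact: measurableD.
have BE : mu B = mu C + mu (B `\` C).
  rewrite -measureU//; last by rewrite setDE setIA setIAC setICr set0I.
  by rewrite setDE setUIr setUCr setIT (setUidr CB).
move: C0 CltB Bn BE.
rewrite -(fineK (mu_fin mB)) -(fineK (mu_fin mC)) -(fineK (mu_fin mBC)).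
rewrite -EFinD !lte_fin !lee_fin => C0 CltB Bn [BE].
have [h|h] := leP (fine (mu C)) (fine (mu (B `\` C))).
  exists C; split => //; first exact: subset_trans BA.
    by rewrite -(fineK (mu_fin mC)) lte_fin.
  rewrite -(fineK (mu_fin mC)) lee_fin exprS.
  move: Bn h BE; move: (2^-1 ^+ n)%R (fine (mu B)) (fine (mu C)) (fine (mu (B `\` C))) => x y z t.
  lra.
exists (B `\` C); split => //; first by apply: subset_trans BA; exact: subDsetl.
  by rewrite -(fineK (mu_fin mBC)) lte_fin; lra.
rewrite -(fineK (mu_fin mBC)) lee_fin exprS.
move: Bn h BE; move: (2^-1 ^+ n)%R (fine (mu B)) (fine (mu C)) (fine (mu (B `\` C))) => x y z t.
lra.
Qed.

Local Notation m B := (fine (mu B)).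

Lemma fine_mu_le A B : measurable A -> measurable B -> A `<=` B -> (m A <= m B)%R.
Proof.
by move=> mA mB AB; rewrite fine_le ?mu_fin// le_measure ?inE.
Qed.

Lemma fine_muU A B : measurable A -> measurable B -> A `&` B = set0 ->
  m (A `|` B) = (m A + m B)%R.
Proof. by move=> mA mB AB; rewrite measureU// fineD ?mu_fin. Qed.

(** Greedy exhaustion: at each step add a set that keeps the mass below [t] and has at least half
    the largest mass possible. If the union fell short of [t], a small set [C] of positive measure
    outside it would have been admissible at every step, so each step would have added at least half
    the mass of [C], and the total would exceed 1. *)
Lemma sierpinski A (t : R) : measurable A -> (0 <= t)%R -> (t <= m A)%R ->
  exists B, [/\ measurable B, B `<=` A & m B = t].
Proof.
move=> mA t0 tA.
pose F (B C : set T) := [/\ measurable C, C `<=` A `\` B & (m B + m C <= t)%R].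
pose good (B : set T) := [/\ measurable B, B `<=` A & (m B <= t)%R].
have step B : exists C, good B -> F B C /\ forall C', F B C' -> (m C' <= 2 * m C)%R.
  have [gB|/asboolPn nB] := pselect (good B); last by exists set0 => gB; exfalso; move/asboolP: nB; exact.
  have [mB BA Bt] := gB.
  (* The supremum of the admissible masses need not be attained, whence the factor 2. *)
  pose E := [set m C' | C' in F B].
  have F0 : F B set0 by split => //; rewrite measure0 addr0.
  have E0 : E 0%R by exists set0 => //; rewrite measure0.
  have hE : has_sup E.
    split; first by exists 0%R.
    exists 1%R => _ [C' [mC' _ _] <-].
    by rewrite -[1%R]/(fine 1%E) fine_le ?mu_fin// probability_le1.
  have [s0|s0] := leP (sup E) 0%R.
    exists set0 => _; split => // C' FC'; rewrite measure0 mulr0 (le_trans _ s0)//.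
    by apply: ub_le_sup; [case: hE|exists C'].
  have [_ [C FC <-] ltC] := @sup_adherent _ E (sup E / 2) (divr_gt0 s0 (ltr0n _ 2)) hE.
  exists C => _; split => // C' FC'.
  have : (m C' <= sup E)%R by apply: ub_le_sup; [case: hE|exists C'].
  by move: ltC; set a := sup E; set b := m C; set c := m C'; lra.
have [f fP] := choice step.
pose Bn := fix Bn n := if n is k.+1 then Bn k `|` f (Bn k) else set0.
have BnS n : Bn n.+1 = Bn n `|` f (Bn n) by [].
have gBn n : good (Bn n).
  elim: n => [|n IH]; first by split => //=; rewrite measure0.
  have [mB BA Bt] := IH; have [[mf fA ft] _] := fP _ IH.
  rewrite BnS; split; first exact: measurableU.
  - by rewrite subUset; split => //; apply: (subset_trans fA); exact: subDsetl.
  - by rewrite fine_muU//; apply/disjoints_subset => x Bx /fA[].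
have mBn n : measurable (Bn n) by have [] := gBn n.
have Bn_mono : nondecreasing_seq Bn.
  by apply/nondecreasing_seqP => n; apply/subsetPset; rewrite BnS; exact: subsetUl.
pose B := \bigcup_n Bn n.
have mB : measurable B by exact: bigcupT_measurable.
have BA : B `<=` A by apply: bigcup_sub => n _; have [] := gBn n.
have mBnB n : (m (Bn n) <= m B)%R by apply: fine_mu_le => //; exact: bigcup_sup.
have Bt : (m B <= t)%R.
  have /(_ _ mu) cv := nondecreasing_cvg_mu mBn mB Bn_mono.
  rewrite -lee_fin (fineK (mu_fin mB)).
  rewrite -(cvg_lim _ cv)//; apply: lime_le; first by apply/cvg_ex; eexists; exact: cv.
  apply: nearW => n /=; rewrite -(fineK (mu_fin (mBn n))) lee_fin.
  by have [] := gBn n.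
exists B; split => //; apply/eqP; rewrite eq_le Bt/= leNgt; apply/negP => Btlt.
have mAB : measurable (A `\` B) by exact: measurableD.
have AE : m A = (m B + m (A `\` B))%R.
  rewrite -fine_muU//; last by rewrite setDE setIA setIAC setICr set0I.
  by rewrite setDE setUIr setUCr setIT (setUidr BA).
have AB0 : 0 < mu (A `\` B).
  rewrite -(fineK (mu_fin mAB)) lte_fin.
  by move: AE Btlt tA; move: (m A) (m B) (m (A `\` B)) => x y z; lra.
have [n nt] : exists n, ((2^-1 : R) ^+ n <= t - m B)%R.
  have h0 : (0 < t - m B)%R by rewrite subr_gt0.
  have h1 : (`|2^-1 : R| < 1)%R by rewrite ger0_norm ?invr_ge0// invf_lt1// ltr1n.
  have /cvgrPdist_lt := cvg_expr h1 => /(_ _ h0) [n _ /(_ n (leqnn n))].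
  rewrite sub0r normrN => /ltW H; exists n; apply: le_trans H; exact: ler_norm.
have [C [mC CAB C0 Cn]] := atomless_small mAB AB0 n.
have {}C0 : (0 < m C)%R by rewrite -lte_fin (fineK (mu_fin mC)).
have {}Cn : (m C <= t - m B)%R.
  by apply: le_trans nt; rewrite -lee_fin (fineK (mu_fin mC)).
have FC k : F (Bn k) C.
  split => //; first by apply: (subset_trans CAB); apply: setDS; exact: bigcup_sup.
  by rewrite (le_trans (lerD (mBnB k) (lexx (m C))))// -lerBrDl.
have grow k : (k%:R * (m C / 2) <= m (Bn k))%R.
  elim: k => [|k IH]; first by rewrite mul0r /= measure0.
  have [[mf fA ft] fmax] := fP _ (gBn k).
  rewrite BnS fine_muU//; last by apply/disjoints_subset => x Bx /fA[].
  rewrite -addn1 natrD mulrDl mul1r lerD// ler_pdivrMr// mulrC.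
  exact: fmax.
have := grow (Num.truncn (2 / m C)).+1; rewrite leNgt => /negP; apply.
apply: (@le_lt_trans _ _ 1%R).
  by rewrite -[1%R]/(fine 1%E) fine_le ?mu_fin// probability_le1.
rewrite mulrA ltr_pdivlMr// mul1r -ltr_pdivrMr//; exact: truncnS_gt.
Qed.

(** The class [i0] collects what the prescribed sets leave over, so the masses over [s] need only
    fit inside [A] and the induction can carve off one set at a time. *)
Lemma split_seq (I : finType) (i0 : I) (p : I -> R) (s : seq I) (A : set T) :
  uniq (i0 :: s) -> (forall i, 0 <= p i)%R -> measurable A ->
  (\sum_(i <- s) p i <= m A)%R ->
  exists g : T -> I, [/\ mcode g, forall x, g x \in i0 :: s &
    forall i, i \in s -> m (A `&` g @^-1` [set i]) = p i].
Proof.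
move=> + p0; elim: s A => [|i s IH] A us mA.
  move=> _; exists (fun=> i0); split => // [i|x]; last by rewrite mem_seq1.
  have [->|/eqP ii0] := eqVneq i i0.
    by rewrite (_ : _ @^-1` _ = setT)//; apply/seteqP; split.
  by rewrite (_ : _ @^-1` _ = set0)//; apply/seteqP; split => // x /= /esym.
rewrite big_cons => sA.
have s0 : (0 <= \sum_(j <- s) p j)%R by exact: sumr_ge0.
have [B [mB BA Bp]] : exists B, [/\ measurable B, B `<=` A & m B = p i].
  by apply: sierpinski => //; rewrite (le_trans _ sA)// lerDl.
have mAB : measurable (A `\` B) by exact: measurableD.
have AE : m A = (m B + m (A `\` B))%R.
  rewrite -fine_muU//; last by rewrite setDE setIA setIAC setICr set0I.
  by rewrite setDE setUIr setUCr setIT (setUidr BA).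
move: us; rewrite /= inE negb_or => /andP[/andP[i0i i0s] /andP[ins us]].
have [] := IH (A `\` B) _ mAB; first by rewrite /= i0s.
  by move: AE sA; rewrite Bp => ->; rewrite lerD2l.
move=> g [mg gs gp].
have gi x : g x != i.
  by have := gs x; rewrite inE => /orP[/eqP->//|]; apply: contraTneq => ->.
exists (fun x => if x \in B then i else g x); split.
- move=> k; rewrite (_ : _ @^-1` _ =
    (B `&` [set x | i = k]) `|` (~` B `&` g @^-1` [set k])).
    apply: measurableU; apply: measurableI => //; last exact: measurableC.
    have [<-|/eqP ik] := eqVneq i k; first by rewrite (_ : [set _ | _] = setT)//; apply/seteqP; split.
    by rewrite (_ : [set _ | _] = set0)//; apply/seteqP; split.
  apply/seteqP; split => x /=.
    by case: ifPn => [/set_mem xB|/negP xB] ?; [left|right; split => // /mem_set].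
  by move=> [[/mem_set-> ]|[xB <-]] //; rewrite ifF//; apply/negP => /set_mem.
- by move=> x; case: ifP => _; rewrite !inE ?eqxx ?orbT//; have := gs x; rewrite inE => /orP[->|->]//; rewrite !orbT.
- move=> k; rewrite inE => /orP[/eqP ->|ks].
    rewrite -Bp; congr (m _); apply/seteqP; split => x /=.
      by move=> [Ax]; case: ifPn => [/set_mem//|_ /eqP]; rewrite (negbTE (gi x)).
    by move=> Bx; split; [exact: BA|rewrite mem_set].
  rewrite -gp//; congr (m _); apply/seteqP; split => x /=.
    move=> [Ax]; case: ifPn => [_ ik|xB]; first by move: ins; rewrite ik ks.
    by move=> gk; split => //; split => // /mem_set; exact/negP.
  by move=> [[Ax Bx] gk]; split => //; rewrite ifF//; apply/negP => /set_mem.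
Qed.

(** With [i0] as leftover class, its mass comes out right because the fibres exhaust [A]. *)
Lemma split_set (I : finType) (i0 : I) (p : I -> R) (A : set T) :
  (forall i, 0 <= p i)%R -> measurable A -> (\sum_i p i = m A)%R ->
  exists2 g : T -> I, mcode g & forall i, m (A `&` g @^-1` [set i]) = p i.
Proof.
move=> p0 mA pA; pose s := rem i0 (enum I).
have ps : perm_eq (enum I) (i0 :: s) by apply: perm_to_rem; rewrite mem_enum.
have us : uniq (i0 :: s) by rewrite -(perm_uniq ps) enum_uniq.
have sE : (\sum_i p i = p i0 + \sum_(i <- s) p i)%R.
  by rewrite -big_enum (perm_big _ ps) big_cons.
have sA : (\sum_(i <- s) p i <= m A)%R by rewrite -pA sE lerDr.
have [g [mg gs gp]] := split_seq us p0 mA sA.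
exists g => // i; have [ins|ins] := boolP (i \in s); first exact: gp.
have -> : i = i0.
  by have := mem_enum I i; rewrite (perm_mem ps) inE (negbTE ins) orbF inE => /eqP.
have : (\sum_j m (A `&` g @^-1` [set j]) = m A)%R.
  have bA : bmf (\1_A : T -> R) by exact: bmf_indic.
  rewrite -int_indic//; transitivity (\int[mu]_x (1 * \1_A x))%R; last first.
    by apply: eq_Rintegral => x _; rewrite mul1r.
  rewrite (int_codeM mu mg (fun=> 1%R) bA); apply: eq_bigr => j _.
  rewrite mul1r -int_indic; last exact: measurableI.
  apply: eq_Rintegral => x _; rewrite indicI /=; congr (_ * _)%R.
  by rewrite indicE; congr (nat_of_bool _)%:R; apply/idP/eqP; rewrite inE.
rewrite -pA sE -big_enum (perm_big _ ps) big_cons.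
by rewrite (eq_big_seq p) => [/addIr|j /gp].
Qed.

End sierpinski.

(** * Decorated densities and the counting lemma *)

Section tuple_integrals.
Context (d : measure_display) (T : measurableType d) (R : realType).

Lemma bmf_tnth n (f : T -> R) (i : 'I_n) :
  bmf f -> bmf (fun t : n.-tuple T => f (tnth t i)).
Proof. by move=> bf; apply: (bmf_comp bf); exact: measurable_tnth. Qed.

Lemma bmf_cons n (f : n.+1.-tuple T -> R) x :
  bmf f -> bmf (fun t : n.-tuple T => f (tuple_cons (x, t))).
Proof.
move=> bf; apply: (bmf_comp bf).
apply: (@measurableT_comp _ _ _ _ _ _ (@tuple_cons _ T n) setT (fun t => (x, t))).
  exact: measurable_tuple_cons.
exact: pair1_measurable.
Qed.

Lemma int_tuple0 (P : 'I_0 -> probability T R) (f : 0.-tuple T -> R) :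
  bmf f -> \int[tuple_prob P]_t f t = f [tuple].
Proof.
move=> [mf _]; rewrite /Rintegral /= integral_dirac ?diracT ?mul1e//.
exact/measurable_EFinP.
Qed.

Lemma int_tupleS n (P : 'I_n.+1 -> probability T R) (f : n.+1.-tuple T -> R) :
  bmf f -> \int[tuple_prob P]_t f t =
  \int[P ord0]_x \int[tuple_prob (fun i => P (lift ord0 i))]_t f (tuple_cons (x, t)).
Proof.
move=> bf /=.
rewrite (@int_distribution _ _ _ _ R (P ord0 \x tuple_prob (fun i => P (lift ord0 i)))%E)//.
rewrite (@int_prod12 _ _ _ _ R (P ord0) (tuple_prob (fun i => P (lift ord0 i))))//.
by apply: bmf_comp bf _.
Qed.

Lemma int_tuple_prod n (P : 'I_n -> probability T R) (h : 'I_n -> T -> R) :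
  (forall i, bmf (h i)) ->
  \int[tuple_prob P]_t (\prod_i h i (tnth t i)) = \prod_i \int[P i]_x h i x.
Proof.
elim: n P h => [|n IH] P h bh.
  rewrite int_tuple0 ?big_ord0//.
  by apply: bmf_prod => i; exact: bmf_tnth.
rewrite int_tupleS; last by apply: bmf_prod => i; exact: bmf_tnth.
rewrite big_ord_recl -intZr//; apply: eq_Rintegral => x _.
rewrite -IH// -intZl; last by apply: bmf_prod => i; exact: bmf_tnth.
apply: eq_Rintegral => t _; rewrite big_ord_recl /=; congr (_ * _).
by apply: eq_bigr => i _; rewrite tnthS.
Qed.

Definition tset n (t : n.-tuple T) (i : 'I_n) (s : T) : n.-tuple T :=
  [tuple if j == i then s else tnth t j | j < n].

Lemma measurable_tset n (i : 'I_n) :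
  measurable_fun setT (fun ts : n.-tuple T * T => tset ts.1 i ts.2).
Proof.
apply/measurable_fun_tnthP => j.
have [->|ji] := eqVneq j i.
  rewrite (_ : _ \o _ = snd)//.
  by apply/funext => ts; rewrite /= tnth_mktuple eqxx.
rewrite (_ : _ \o _ = (fun t : n.-tuple T => tnth t j) \o fst).
  by apply: measurableT_comp => //; exact: measurable_tnth.
by apply/funext => ts; rewrite /= tnth_mktuple (negbTE ji).
Qed.

Lemma bmf_tset n (i : 'I_n) (f : n.-tuple T -> R) :
  bmf f -> bmf (fun ts : n.-tuple T * T => f (tset ts.1 i ts.2)).
Proof. by move=> bf; apply: (bmf_comp bf); exact: measurable_tset. Qed.

Lemma tset_cons0 n x (t : n.-tuple T) s :
  tset (tuple_cons (x, t)) ord0 s = tuple_cons (s, t).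
Proof.
apply: eq_from_tnth => j; rewrite tnth_mktuple.
by case: (unliftP ord0 j) => [j' ->|->] //=; rewrite !tnthS.
Qed.

Lemma tset_consS n x (t : n.-tuple T) i s :
  tset (tuple_cons (x, t)) (lift ord0 i) s = tuple_cons (x, tset t i s).
Proof.
apply: eq_from_tnth => j; rewrite tnth_mktuple.
case: (unliftP ord0 j) => [j' ->|->] //=; rewrite !tnthS tnth_mktuple.
by rewrite (inj_eq lift_inj).
Qed.

(** Redrawing one coordinate leaves a product law unchanged. This isolates a variable at an
    arbitrary position without cutting the tuple there. *)
Lemma int_resample n (P : 'I_n -> probability T R) (i : 'I_n) (f : n.-tuple T -> R) :
  bmf f ->
  \int[tuple_prob P]_t f t = \int[tuple_prob P]_t \int[P i]_s f (tset t i s).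
Proof.
elim: n P i f => [|n IH] P i f bf; first by case: i.
pose P' j := P (lift ord0 j).
have bfi : bmf (fun t => \int[P i]_s f (tset t i s)).
  exact: (bmf_int2 (tuple_prob P) (P i) (bmf_tset i bf)).
rewrite [RHS]int_tupleS// [LHS]int_tupleS// -/P'.
case: (unliftP ord0 i) => [j ij|i0]; last first.
  rewrite i0; transitivity (\int[tuple_prob P']_t \int[P ord0]_s f (tuple_cons (s, t))).
    apply: (@int_swap _ _ T (n.-tuple T) R (P ord0) (tuple_prob P') (fun z => f (tuple_cons z))).
    exact: (bmf_comp bf (@measurable_tuple_cons _ T n)).
  rewrite -[LHS](int_cst (P ord0)); apply: eq_Rintegral => x _; apply: eq_Rintegral => t _.
  by apply: eq_Rintegral => s _; rewrite tset_cons0.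
apply: eq_Rintegral => x _; rewrite (IH P' j (fun t => f (tuple_cons (x, t)))).
  by apply: eq_Rintegral => t _; rewrite ij; apply: eq_Rintegral => s _; rewrite tset_consS.
exact: bmf_cons.
Qed.

(** * The counting lemma for bipartite patterns *)

Section counting.
Variable mu : probability T R.
Context (k l : nat).

Definition tpow n : probability (n.-tuple T) R := tuple_prob (fun _ : 'I_n => mu).

Local Notation Z := (k.-tuple T * l.-tuple T)%type.
Local Notation PZ := (tpow k \x tpow l)%E.

Lemma bmf_tset2 (i : 'I_k) (j : 'I_l) (f : Z -> R) : bmf f ->
  bmf (fun w : Z * (T * T) => f (tset w.1.1 i w.2.1, tset w.1.2 j w.2.2)).
Proof.
move=> bf; apply: (bmf_comp bf); apply: measurable_fun_pair.
  apply: (@measurableT_comp _ _ _ _ _ _ _ setT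
    (fun w : Z * (T * T) => (w.1.1, w.2.1)) (@measurable_tset k i)).
  apply: measurable_fun_pair.
    by apply: (measurableT_comp measurable_fst); exact: measurable_fst.
  by apply: (measurableT_comp measurable_fst); exact: measurable_snd.
apply: (@measurableT_comp _ _ _ _ _ _ _ setT
    (fun w : Z * (T * T) => (w.1.2, w.2.2)) (@measurable_tset l j)).
apply: measurable_fun_pair.
  by apply: (measurableT_comp measurable_snd); exact: measurable_fst.
by apply: (measurableT_comp measurable_snd); exact: measurable_snd.
Qed.

Lemma bmf_resample2 (i : 'I_k) (j : 'I_l) (f : Z -> R) : bmf f ->
  bmf (fun z : Z => \int[(mu \x mu)%E]_w f (tset z.1 i w.1, tset z.2 j w.2)).
Proof.
by move=> bf; exact: (bmf_int2 PZ (mu \x mu)%E (bmf_tset2 i j bf)).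
Qed.

Lemma int_resample2 (i : 'I_k) (j : 'I_l) (f : Z -> R) : bmf f ->
  \int[PZ]_z f z =
  \int[PZ]_z \int[(mu \x mu)%E]_w f (tset z.1 i w.1, tset z.2 j w.2).
Proof.
move=> bf; have b1 := bmf_tset2 i j bf; have b2 := bmf_resample2 i j bf.
rewrite [RHS]int_prod12// [LHS]int_prod12//.
rewrite (int_resample _ i); last exact: (bmf_int2 (tpow k) (tpow l) bf).
apply: eq_Rintegral => x _ /=.
transitivity (\int[mu]_s \int[tpow l]_y \int[mu]_t f (tset x i s, tset y j t)).
  apply: eq_Rintegral => s _; rewrite (int_resample _ j)//.
  exact: (bmf_xsection (tset x i s) bf).
rewrite (@int_swap _ _ T (l.-tuple T) R mu (tpow l)
  (fun sy => \int[mu]_t f (tset x i sy.1, tset sy.2 j t))); last first.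
  have b3 : bmf (fun w : (T * l.-tuple T) * T => f (tset x i w.1.1, tset w.1.2 j w.2)).
    apply: (bmf_comp b1 (phi := fun w : (T * l.-tuple T) * T => ((x, w.1.2), (w.1.1, w.2)))).
    apply: measurable_fun_pair; apply: measurable_fun_pair => //.
    - by apply: (measurableT_comp measurable_snd); exact: measurable_fst.
    - by apply: (measurableT_comp measurable_fst); exact: measurable_fst.
  exact: (bmf_int2 (mu \x tpow l)%E mu b3).
apply: eq_Rintegral => y _ /=; rewrite int_prod12//.
exact: (bmf_xsection (x, y) b1).
Qed.

(* The shape of functions against which a small cut norm in the variables
   [(x_i, y_j)] can be tested. *)
Definition separated (i : 'I_k) (j : 'I_l) (G : Z -> R) := bmf G /\
  forall z, exists g h : T -> R, [/\ measurable_fun setT g, measurable_fun setT h,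
    (forall s, `|g s| <= 1), (forall t, `|h t| <= 1) &
    forall s t, G (tset z.1 i s, tset z.2 j t) = g s * h t].

Lemma separatedM i j G G' : separated i j G -> separated i j G' ->
  separated i j (fun z => G z * G' z).
Proof.
move=> [bG GP] [bG' GP']; split; first exact: bmfM.
move=> z; have [g [h [mg mh g1 h1 GE]]] := GP z; have [g' [h' [mg' mh' g1' h1' GE']]] := GP' z.
exists (fun s => g s * g' s), (fun t => h t * h' t); split.
- exact: measurable_funM.
- exact: measurable_funM.
- by move=> s; rewrite normrM mulr_ile1.
- by move=> s; rewrite normrM mulr_ile1.
- by move=> s t; rewrite GE GE' mulrACA.
Qed.

Lemma separated1 i j : separated i j (fun=> 1).
Proof.
split; first exact: bmf_cst.
move=> z; exists (fun=> 1), (fun=> 1); split => //; try by move=> ?; rewrite normr1.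
by move=> s t; rewrite mulr1.
Qed.

Lemma separated_prod i j (J : Type) (r : seq J) (p : pred J) (G : J -> Z -> R) :
  (forall e, p e -> separated i j (G e)) -> separated i j (fun z => \prod_(e <- r | p e) G e z).
Proof.
move=> sG; elim: r => [|e r IH].
  by under eq_fun do rewrite big_nil; exact: separated1.
have [pe|pe] := boolP (p e); last by under eq_fun do rewrite big_cons (negbTE pe).
under eq_fun do rewrite big_cons pe.
by apply: separatedM => //; exact: sG.
Qed.

Lemma bmf_edge (v : T * T -> R) i j :
  bmf v -> bmf (fun z : Z => v (tnth z.1 i, tnth z.2 j)).
Proof.
move=> bv; apply: (bmf_comp bv); apply: measurable_fun_pair.
  by apply: (measurableT_comp (@measurable_tnth _ T k i)); exact: measurable_fst.
by apply: (measurableT_comp (@measurable_tnth _ T l j)); exact: measurable_snd.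
Qed.

Lemma separated_row i j (a : T -> R) i' : measurable_fun setT a ->
  (forall s, `|a s| <= 1) -> separated i j (fun z => a (tnth z.1 i')).
Proof.
move=> ma a1; split.
  apply: (@bmf_fst _ _ _ _ _ (fun x : k.-tuple T => a (tnth x i'))).
  by apply: bmf_tnth; exact: bmf1.
move=> z; have [->|ii'] := eqVneq i' i.
  exists a, (fun=> 1); split => //; first by move=> ?; rewrite normr1.
  by move=> s t; rewrite tnth_mktuple eqxx mulr1.
exists (fun=> a (tnth z.1 i')), (fun=> 1); split => //; first by move=> ?; rewrite normr1.
by move=> s t; rewrite tnth_mktuple (negbTE ii') mulr1.
Qed.

Lemma separated_col i j (b : T -> R) j' : measurable_fun setT b ->
  (forall s, `|b s| <= 1) -> separated i j (fun z => b (tnth z.2 j')).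
Proof.
move=> mb b1; split.
  apply: (@bmf_snd _ _ _ _ _ (fun y : l.-tuple T => b (tnth y j'))).
  by apply: bmf_tnth; exact: bmf1.
move=> z; have [->|jj'] := eqVneq j' j.
  exists (fun=> 1), b; split => //; first by move=> ?; rewrite normr1.
  by move=> s t; rewrite tnth_mktuple eqxx mul1r.
exists (fun=> 1), (fun=> b (tnth z.2 j')); split => //; first by move=> ?; rewrite normr1.
by move=> s t; rewrite tnth_mktuple (negbTE jj') mul1r.
Qed.

(** An edge other than [(i, j)] contains at most one of the variables x_i and y_j, so with all other
    coordinates frozen it depends on one of them only. *)
Lemma separated_edge i j (v : T * T -> R) i' j' : measurable_fun setT v ->
  (forall z, `|v z| <= 1) -> (i', j') != (i, j) ->
  separated i j (fun z => v (tnth z.1 i', tnth z.2 j')).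
Proof.
move=> mv v1 ne; have bv : bmf v by split => //; exists 1.
split; first exact: bmf_edge.
move=> z; move: ne; rewrite xpair_eqE; have [-> /= jj'|ii' _] := eqVneq i' i.
  exists (fun s => v (s, tnth z.2 j')), (fun=> 1); split => //.
  - by case: (bmf_ysection (tnth z.2 j') bv).
  - by move=> ?; rewrite normr1.
  - by move=> s t; rewrite !tnth_mktuple eqxx (negbTE jj') mulr1.
have [->|jj'] := eqVneq j' j.
  exists (fun=> 1), (fun t => v (tnth z.1 i', t)); split => //.
  - by case: (bmf_xsection (tnth z.1 i') bv).
  - by move=> ?; rewrite normr1.
  - by move=> s t; rewrite !tnth_mktuple eqxx (negbTE ii') mul1r.
exists (fun=> 1), (fun=> v (tnth z.1 i', tnth z.2 j')); split => //.
  by move=> ?; rewrite normr1.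
by move=> s t; rewrite !tnth_mktuple (negbTE ii') (negbTE jj') mul1r.
Qed.

(** Once x_i and y_j are redrawn with the other coordinates frozen, [G] becomes a product of two
    admissible test functions. *)
Lemma counting_step i j (w : T * T -> R) (e : R) (G : Z -> R) :
  bmf w -> cut_le mu w e -> separated i j G ->
  `|\int[PZ]_z (w (tnth z.1 i, tnth z.2 j) * G z)| <= e.
Proof.
move=> bw we [bG GP].
have bwG : bmf (fun z : Z => w (tnth z.1 i, tnth z.2 j) * G z).
  by apply: bmfM => //; exact: bmf_edge.
rewrite (int_resample2 i j)//.
have H z : `|\int[(mu \x mu)%E]_s (w (tnth (tset z.1 i s.1) i, tnth (tset z.2 j s.2) j) *
    G (tset z.1 i s.1, tset z.2 j s.2))| <= e.
  have [g [h [mg mh g1 h1 GE]]] := GP z.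
  rewrite [X in `|X|](_ : _ = \int[(mu \x mu)%E]_s (w s * (g s.1 * h s.2))).
    exact: we.
  by apply: eq_Rintegral => -[s t] _; rewrite !tnth_mktuple !eqxx GE.
by apply: int_norm_le_cst => //; exact: (bmf_resample2 i j bwG).
Qed.

Definition ub (d' : measure_display) (X : measurableType d') (f : X -> R) :=
  measurable_fun setT f /\ forall x, `|f x| <= 1.

Lemma ub_bmf (d' : measure_display) (X : measurableType d') (f : X -> R) :
  ub f -> bmf f.
Proof. by move=> [mf f1]; split => //; exists 1. Qed.

(** The integrand of a weighted homomorphism density of the complete bipartite graph, with vertex
    weights [a], [b] and edge weights [v]. *)
Definition pattern_fun (a : 'I_k -> T -> R) (b : 'I_l -> T -> R)
    (v : 'I_k * 'I_l -> T * T -> R) (z : Z) : R :=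
  (\prod_i a i (tnth z.1 i)) * (\prod_j b j (tnth z.2 j)) *
  \prod_e v e (tnth z.1 e.1, tnth z.2 e.2).

Definition hom a b v := \int[PZ]_z pattern_fun a b v z.

Section hom_lemmas.
Implicit Types (a : 'I_k -> T -> R) (b : 'I_l -> T -> R)
  (v : 'I_k * 'I_l -> T * T -> R).

Lemma bmf_row a : (forall i, bmf (a i)) -> bmf (fun z : Z => \prod_i a i (tnth z.1 i)).
Proof.
move=> ba; apply: bmf_prod => i.
apply: (@bmf_fst _ _ _ _ _ (fun x : k.-tuple T => a i (tnth x i))).
exact: bmf_tnth.
Qed.

Lemma bmf_col b : (forall j, bmf (b j)) -> bmf (fun z : Z => \prod_j b j (tnth z.2 j)).
Proof.
move=> bb; apply: bmf_prod => j.
apply: (@bmf_snd _ _ _ _ _ (fun y : l.-tuple T => b j (tnth y j))).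
exact: bmf_tnth.
Qed.

Lemma bmf_pattern_fun a b v : (forall i, bmf (a i)) -> (forall j, bmf (b j)) ->
  (forall e, bmf (v e)) -> bmf (pattern_fun a b v).
Proof.
move=> ba bb bv; apply: bmfM; first by apply: bmfM; [exact: bmf_row|exact: bmf_col].
by apply: bmf_prod => e; exact: bmf_edge.
Qed.

(** Telescoping: the kernels are exchanged one edge at a time, and [mix s] is the stage at which the
    edges of [s] have been treated. Each exchange costs the cut norm of one difference. *)
Lemma counting a b v v' (e : 'I_k * 'I_l -> R) :
  (forall i, ub (a i)) -> (forall j, ub (b j)) ->
  (forall e, ub (v e)) -> (forall e, ub (v' e)) ->
  (forall f, cut_le mu (fun z => v f z - v' f z) (e f)) ->
  `|hom a b v - hom a b v'| <= \sum_f e f.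
Proof.
move=> ua ub' uv uv' vv'.
pose mix (s : seq ('I_k * 'I_l)) f := if f \in s then v' f else v f.
have umix s f : ub (mix s f) by rewrite /mix; case: ifP.
have bP w : (forall f, ub (w f)) -> bmf (pattern_fun a b w).
  by move=> uw; apply: bmf_pattern_fun => ?; exact: ub_bmf.
suff H s : uniq s -> `|hom a b v - hom a b (mix s)| <= \sum_(f <- s) e f.
  have := H (enum {: 'I_k * 'I_l}) (enum_uniq _); rewrite big_enum/=.
  rewrite (_ : mix _ = v')//; apply/funext => f; rewrite /mix ifT//.
  exact: mem_enum.
elim: s => [|f s IH].
  rewrite big_nil (_ : mix [::] = v) ?subrr ?normr0//.
move=> /= /andP[fs us]; rewrite big_cons [leRHS]addrC.
rewrite (le_trans (ler_distD (hom a b (mix s)) _ _))// lerD ?IH//.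
pose G z := (\prod_i a i (tnth z.1 i)) * (\prod_j b j (tnth z.2 j)) *
  \prod_(f' | f' != f) mix s f' (tnth z.1 f'.1, tnth z.2 f'.2) : R.
rewrite /hom -intB; [|exact: bP|exact: bP].
rewrite [X in `|X|](_ : _ = \int[PZ]_z ((v f (tnth z.1 f.1, tnth z.2 f.2) -
    v' f (tnth z.1 f.1, tnth z.2 f.2)) * G z)); last first.
  apply: eq_Rintegral => z _; rewrite /pattern_fun [in LHS](bigD1 f)//= [X in _ - _ * X](bigD1 f)//=.
  rewrite [in X in _ - X](eq_bigr (fun f' => mix s f' (tnth z.1 f'.1, tnth z.2 f'.2))); last first.
    by move=> f' ff'; rewrite /mix inE (negbTE ff').
  rewrite /mix (negbTE fs) mem_head -/(mix s) /G; ring.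
apply: (@counting_step f.1 f.2 (fun z => v f z - v' f z)) => //.
  by apply: bmfB; exact: ub_bmf.
apply: separatedM; last first.
  apply: separated_prod => f' ff'; have [mu' u1'] := umix s f'.
  by apply: separated_edge => //; case: f' f ff' {mu' u1' fs G} => [? ?] [? ?].
apply: separatedM; apply: separated_prod => i _.
  by have [ma a1] := ua i; exact: separated_row.
by have [mb b1] := ub' i; exact: separated_col.
Qed.

Lemma cut_le_L1 (w : T * T -> R) : bmf w ->
  cut_le mu w (\int[(mu \x mu)%E]_z `|w z|).
Proof.
move=> bw g h mg mh g1 h1.
have bgh : bmf (fun z : T * T => g z.1 * h z.2).
  by apply: bmfM; [apply: bmf_fst|apply: bmf_snd]; exact: bmf1.
rewrite (le_trans (int_norm _ _))//; first exact: bmfM.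
apply: int_le; [exact/bmf_norm/bmfM|exact: bmf_norm|].
move=> z; rewrite normrM ler_piMr// normrM mulr_ile1//.
Qed.

Lemma int_tnth n (i : 'I_n) (h : T -> R) : bmf h ->
  \int[tpow n]_t h (tnth t i) = \int[mu]_x h x.
Proof.
move=> bh; pose H i' : T -> R := if i' == i then h else fun=> 1.
have bH i' : bmf (H i') by rewrite /H; case: ifP => // _; exact: bmf_cst.
transitivity (\int[tpow n]_t \prod_i' H i' (tnth t i')).
  apply: eq_Rintegral => t _; rewrite (bigD1 i)//= /H eqxx big1 ?mulr1//.
  by move=> i' /negbTE ->.
rewrite int_tuple_prod// (bigD1 i)//= {1}/H eqxx big1 ?mulr1// => i' /negbTE ii'.
by rewrite /H ii' int_cst.
Qed.

Lemma ler_norm_prodB (J : Type) (r : seq J) (x y : J -> R) :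
  (forall i, `|x i| <= 1) -> (forall i, `|y i| <= 1) ->
  `|\prod_(i <- r) x i - \prod_(i <- r) y i| <= \sum_(i <- r) `|x i - y i|.
Proof.
move=> x1 y1; elim: r => [|i r IH]; first by rewrite !big_nil subrr normr0.
rewrite !big_cons.
have py : `|\prod_(j <- r) y j| <= 1.
  by elim/big_ind: _ => [|a b a1 b1|//]; rewrite ?normr1// normrM mulr_ile1.
rewrite (_ : _ - _ = x i * (\prod_(j <- r) x j - \prod_(j <- r) y j) +
  (x i - y i) * \prod_(j <- r) y j); last by ring.
rewrite (le_trans (ler_normD _ _))// addrC lerD// normrM; first exact: ler_piMr.
by rewrite (le_trans _ IH)// ler_piMl.
Qed.

Lemma norm_prod_le1 (J : Type) (r : seq J) (x : J -> R) :
  (forall i, `|x i| <= 1) -> `|\prod_(i <- r) x i| <= 1.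
Proof.
by move=> x1; elim/big_ind: _ => [|a b a1 b1|//]; rewrite ?normr1// normrM mulr_ile1.
Qed.

Lemma hom_weights a b a' b' v :
  (forall i, ub (a i)) -> (forall j, ub (b j)) ->
  (forall i, ub (a' i)) -> (forall j, ub (b' j)) -> (forall e, ub (v e)) ->
  (forall i, {ae mu, forall x, a i x = a' i x}) ->
  (forall j, {ae mu, forall x, b j x = b' j x}) ->
  hom a b v = hom a' b' v.
Proof.
move=> ua ub1 ua' ub1' uv aa' bb'.
have ba i := ub_bmf (ua i); have bb j := ub_bmf (ub1 j).
have ba' i := ub_bmf (ua' i); have bb1 j := ub_bmf (ub1' j).
have bv e := ub_bmf (uv e).
have bd i : bmf (fun x => `|a i x - a' i x|) by apply: bmf_norm; exact: bmfB.
have bd' j : bmf (fun x => `|b j x - b' j x|) by apply: bmf_norm; exact: bmfB.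
have z0 (f f' : T -> R) : ub f -> ub f' -> {ae mu, forall x, f x = f' x} ->
    \int[mu]_x `|f x - f' x| = 0.
  move=> uf uf' ff'; rewrite -[RHS](int_cst mu 0); apply: int_ae.
  - by apply: bmf_norm; apply: bmfB; exact: ub_bmf.
  - exact: bmf_cst.
  - by apply: filterS ff' => x ->; rewrite subrr normr0.
apply/eqP; rewrite -subr_eq0 -normr_le0 /hom -intB; [|exact: bmf_pattern_fun|exact: bmf_pattern_fun].
pose D1 i (z : Z) : R := `|a i (tnth z.1 i) - a' i (tnth z.1 i)|.
pose D2 j (z : Z) : R := `|b j (tnth z.2 j) - b' j (tnth z.2 j)|.
have bD1 i : bmf (D1 i).
  apply: (@bmf_fst _ _ _ _ _ (fun x : k.-tuple T => `|a i (tnth x i) - a' i (tnth x i)|)).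
  exact: (bmf_tnth i (bd i)).
have bD2 j : bmf (D2 j).
  apply: (@bmf_snd _ _ _ _ _ (fun x : l.-tuple T => `|b j (tnth x j) - b' j (tnth x j)|)).
  exact: (bmf_tnth j (bd' j)).
apply: (@le_trans _ _ (\int[PZ]_z (\sum_i D1 i z + \sum_j D2 j z))).
  apply: le_trans (int_norm _ _) _; first by apply: bmfB; exact: bmf_pattern_fun.
  apply: int_le.
  - by apply: bmf_norm; apply: bmfB; exact: bmf_pattern_fun.
  - by apply: bmfD; exact: bmf_sum.
  - move=> z; rewrite /pattern_fun -mulrBl normrM.
    set pa := \prod_i a i _; set pb := \prod_j b j _.
    set pa' := \prod_i a' i _; set pb' := \prod_j b' j _.
    apply: (@le_trans _ _ `|pa * pb - pa' * pb'|).
      by rewrite ler_piMr//; apply: norm_prod_le1 => e; case: (uv e).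
    rewrite (_ : pa * pb - pa' * pb' = (pa - pa') * pb + pa' * (pb - pb')); last by ring.
    rewrite (le_trans (ler_normD _ _))// lerD// normrM.
      rewrite (@le_trans _ _ `|pa - pa'|)//.
        by rewrite ler_piMr//; apply: norm_prod_le1 => e; case: (ub1 e).
      by apply: ler_norm_prodB => i; [case: (ua i)|case: (ua' i)].
    rewrite (@le_trans _ _ `|pb - pb'|)//.
      by rewrite ler_piMl//; apply: norm_prod_le1 => e; case: (ua' e).
    by apply: ler_norm_prodB => i; [case: (ub1 i)|case: (ub1' i)].
rewrite intD; [|exact: bmf_sum|exact: bmf_sum].
rewrite !int_sum// !big1 ?addr0// => i _.
  rewrite int_prod12// -[RHS](int_cst (tpow k) 0); apply: eq_Rintegral => x _.
  by rewrite /D2/= (int_tnth i (bd' i)) z0.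
rewrite int_prod21// -[RHS](int_cst (tpow l) 0); apply: eq_Rintegral => y _.
by rewrite /D1/= (int_tnth i (bd i)) z0.
Qed.

End hom_lemmas.

Section step_functions.
Context (I : finType) (c : T -> I).
Hypothesis mc : mcode c.

Lemma cprob_prod (d1 d2 : measure_display) (X : measurableType d1) (Y : measurableType d2)
  (P : probability X R) (Q : probability Y R) (J J' : finType) (f : X -> J) (g : Y -> J')
  i j : mcode f -> mcode g ->
  cprob (P \x Q)%E (fun z => (f z.1, g z.2)) (i, j) = cprob P f i * cprob Q g j.
Proof.
move=> mf mg; have bf := bmf_code_eq R i mf; have bg := bmf_code_eq R j mg.
rewrite /cprob -intZr//.
transitivity (\int[(P \x Q)%E]_z ((f z.1 == i)%:R * (g z.2 == j)%:R)).
  by apply: eq_Rintegral => z _; rewrite xpair_eqE -natrM mulnb.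
rewrite int_prod12/=; last first.
  by apply: bmfM; [exact: (bmf_fst _ bf)|exact: (bmf_snd _ bg)].
by apply: eq_Rintegral => x _; rewrite intZl.
Qed.

Definition tcode n (t : n.-tuple T) : {ffun 'I_n -> I} := [ffun i => c (tnth t i)].

Lemma tcode_eq n (t : n.-tuple T) rho :
  (tcode t == rho)%:R = \prod_i (c (tnth t i) == rho i)%:R :> R.
Proof.
have [/eqP <-|ne] := boolP (tcode t == rho).
  by rewrite big1// => i _; rewrite ffunE eqxx.
have /existsP[i ii] : [exists i, c (tnth t i) != rho i].
  apply: contraR ne => /existsPn H; apply/eqP/ffunP => i.
  by rewrite ffunE; apply/eqP; move: (H i); rewrite negbK.
by rewrite (bigD1 i)//= (negbTE ii) mul0r.
Qed.

Lemma mcode_tcode n : mcode (@tcode n).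
Proof.
move=> rho; rewrite (_ : _ @^-1` _ =
    \big[setI/setT]_(i < n) ((fun t : n.-tuple T => tnth t i) @^-1` (c @^-1` [set rho i]))).
  apply: bigsetI_measurable => i _; rewrite -[X in measurable X]setTI.
  by apply: measurable_tnth => //; exact: mc.
apply/seteqP; split => t /=.
  by move=> <-; elim/big_ind: _ => //= i _; rewrite ffunE.
by move=> H; apply/ffunP => i; rewrite ffunE; move: H; rewrite (bigD1 i)//= => -[].
Qed.

Lemma cprob_tcode n rho : cprob (tpow n) (@tcode n) rho = \prod_i cprob mu c (rho i).
Proof.
rewrite /cprob -(@int_tuple_prod _ _ (fun i x => (c x == rho i)%:R)).
  by apply: eq_Rintegral => t _; rewrite tcode_eq.
by move=> i; exact: bmf_code_eq.
Qed.

(** For step functions the density is a polynomial in the class masses and in the values on classes,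
    so it converges when these do. *)
Lemma hom_step (al : 'I_k -> I -> R) (be : 'I_l -> I -> R)
    (ph : 'I_k * 'I_l -> I * I -> R) :
  hom (fun i x => al i (c x)) (fun j y => be j (c y)) (fun e z => ph e (code2 c z)) =
  \sum_(r : {ffun 'I_k -> I} * {ffun 'I_l -> I})
    ((\prod_i al i (r.1 i)) * (\prod_j be j (r.2 j)) * \prod_e ph e (r.1 e.1, r.2 e.2)) *
    ((\prod_i cprob mu c (r.1 i)) * \prod_j cprob mu c (r.2 j)).
Proof.
pose C (z : Z) := (tcode z.1, tcode z.2).
have mC : mcode C.
  apply: mcode_pair => rho.
    by have := @measurable_fst _ _ (k.-tuple T) (l.-tuple T) measurableT _ (mcode_tcode rho); rewrite setTI.
  by have := @measurable_snd _ _ (k.-tuple T) (l.-tuple T) measurableT _ (mcode_tcode rho); rewrite setTI.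
pose h (r : {ffun 'I_k -> I} * {ffun 'I_l -> I}) : R :=
  (\prod_i al i (r.1 i)) * (\prod_j be j (r.2 j)) * \prod_e ph e (r.1 e.1, r.2 e.2).
transitivity (\int[PZ]_z h (C z)).
  apply: eq_Rintegral => z _; rewrite /h /pattern_fun /C /=; congr (_ * _ * _);
    by apply: eq_bigr => e _; rewrite !ffunE.
rewrite (int_code PZ mC h); apply: eq_bigr => -[r1 r2] _; congr (_ * _).
by rewrite cprob_prod ?cprob_tcode//; exact: mcode_tcode.
Qed.

End step_functions.

End counting.
End tuple_integrals.

(** * Compactness for families of kernels and sets *)

Section riesz_fischer.
Context (d : measure_display) (X : measurableType d) (R : realType).
Variable P : probability X R.

(** The sum of the absolute increments has integral at most 2, hence is finite almost everywhere,
    and there the sequence converges absolutely. *)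
Lemma ae_cvg_of_summable (f : nat -> X -> R) :
  (forall k, bmf (f k)) ->
  (forall k, \int[P]_x `|f k.+1 x - f k x| <= 2^-1 ^+ k) ->
  {ae P, forall x, cvgn (f ^~ x)}.
Proof.
move=> bf sf.
pose g k x := `|f k.+1 x - f k x|.
have bg k : bmf (g k) by apply: bmf_norm; exact: bmfB.
pose S x : \bar R := (\sum_(0 <= k <oo) (g k x)%:E)%E.
have mg k : measurable_fun setT (fun x => (g k x)%:E).
  by apply/measurable_EFinP; case: (bg k).
have g0 k x : (0 <= (g k x)%:E)%E by rewrite lee_fin; exact: normr_ge0.
have mS : measurable_fun setT S.
  by apply: (@ge0_emeasurable_sum _ _ _ _ (fun k x => (g k x)%:E) predT) => // k x _ _; exact: g0.
have iS : P.-integrable setT S.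
  apply/integrableP; split => //.
  have S0 x : (0 <= S x)%E by apply: nneseries_ge0 => k _ _; exact: g0.
  under eq_integral do rewrite gee0_abs//.
  rewrite integral_nneseries//.
  apply: (@le_lt_trans _ _ 2%:E); last exact: ltry.
  apply: lime_le; first by apply: is_cvg_nneseries => n _ _; apply: integral_ge0 => x _; exact: g0.
  apply: nearW => n; rewrite big_mkord.
  under eq_bigr do rewrite EFin_int//.
  rewrite sumEFin lee_fin; apply: (@le_trans _ _ (\sum_(i < n) 2^-1 ^+ i)).
    by apply: ler_sum => i _; exact: sf.
  suff -> : \sum_(i < n) (2^-1 : R) ^+ i = 2 - 2 * 2^-1 ^+ n.
    by rewrite gerBl mulr_ge0// exprn_ge0// invr_ge0.
  elim: n => [|n IH]; first by rewrite big_ord0 expr0; ring.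
  by rewrite big_ord_recr/= IH exprS; set a := _ ^+ n; lra.
have := integrable_ae measurableT iS.
apply: filterS => x /(_ I) Sfin.
have : cvgn (series (fun k => `|f k.+1 x - f k x|)).
  apply: nondecreasing_is_cvgn.
    apply/nondecreasing_seqP => n; rewrite /series/= big_nat_recr//= lerDl//.
  exists (fine (S x)) => _ [n _ <-].
  rewrite -lee_fin (fineK Sfin) /series/= -sumEFin.
  exact: nneseries_lim_ge.
move/normed_cvg => cs.
rewrite (_ : f^~ x = fun n => f 0%N x + series (fun k => f k.+1 x - f k x) n).
  exact: is_cvgD (is_cvg_cst _) cs.
by apply/funext => n; rewrite /series/= telescope_sumr// addrC subrK.
Qed.

(** The bound is asked only from [N] on, because the diagonal choice of levels in
    [exists_limit_kernels] controls the kernel of index [q] from step [q] on. *)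
Lemma riesz_fischer (f : nat -> X -> R) N :
  (forall k, bmf (f k)) -> (forall k x, 0 <= f k x <= 1) ->
  (forall k, (N <= k)%N -> \int[P]_x `|f k.+1 x - f k x| <= 2^-1 ^+ k) ->
  exists g : X -> R, [/\ bmf g, (forall x, 0 <= g x <= 1),
    {ae P, forall x, f ^~ x @ \oo --> g x} &
    (fun k => \int[P]_x `|f k x - g x|) @ \oo --> 0].
Proof.
move=> bf f01 sf.
(* The clipped limit superior is measurable with values in [0, 1] everywhere, and equals the limit
   wherever there is one. *)
pose g x := Num.max 0 (Num.min 1 (limn_sup (f ^~ x))).
have ub_f t : setT t -> has_ubound (range (f ^~ t)).
  by move=> _; exists 1 => _ [n _ <-]; have /andP[] := f01 n t.
have lb_f t : setT t -> has_lbound (range (f ^~ t)).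
  by move=> _; exists 0 => _ [n _ <-]; have /andP[] := f01 n t.
have mf k : measurable_fun setT (f k) by case: (bf k).
have g01 x : 0 <= g x <= 1.
  by rewrite /g le_max lexx/= ge_max ler01/= ge_min lexx.
have bg : bmf g.
  split; last by exists 1 => x; have /andP[g0 g1] := g01 x; rewrite ger0_norm.
  apply: measurable_maxr => //; apply: measurable_minr => //.
  exact: measurable_fun_limn_sup.
have fg : {ae P, forall x, f ^~ x @ \oo --> g x}.
  have /ae_cvg_of_summable : forall k, bmf (f (N + k)%N) by move=> k.
  have sN k : \int[P]_x `|f (N + k.+1)%N x - f (N + k)%N x| <= 2^-1 ^+ k.
    rewrite addnS (le_trans (sf _ (leq_addr _ _)))// exprD ler_piMl//.
    by rewrite exprn_ile1// ?invr_ge0// invf_le1// ler1n.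
  move=> /(_ sN); apply: filterS => x cx.
  have cx' : cvgn (f ^~ x).
    move: cx => /cvg_ex[l hl]; apply/cvg_ex; exists l.
    rewrite -(cvg_shiftn N); under eq_fun do rewrite addnC.
    exact: hl.
  have l0 : 0 <= limn (f ^~ x) by apply: limr_ge => //; apply: nearW => n; have /andP[] := f01 n x.
  have l1 : limn (f ^~ x) <= 1 by apply: limr_le => //; apply: nearW => n; have /andP[] := f01 n x.
  by rewrite /g cvg_limn_supE// min_r// max_r.
exists g; split => //.
rewrite -[X in _ --> X](int_cst P 0).
apply: (@int_cvg _ _ _ P (fun k x => `|f k x - g x|) (fun=> 0) 1).
- by move=> k; case: (bmf_norm (bmfB (bf k) bg)).
- move=> k x; rewrite normr_id ler_norml.
  have /andP[a0 a1] := f01 k x; have /andP[b0 b1] := g01 x; lra.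
- exact: bmf_cst.
- apply: filterS fg => x fx; rewrite -(normr0 R); apply: cvg_norm.
  rewrite -(subrr (g x)); apply: cvgB => //; exact: cvg_cst.
Qed.

End riesz_fischer.

(** * Nested partitions that capture all sets and kernels *)

Section levels.
Context (R : realType).

(* A level M + 1 code consists of a level M code, of membership in the set of
   index M, and of a class provided by the regularity lemma. *)
Fixpoint levels (J : nat -> finType) M : finType :=
  if M is m.+1 then (levels J m * bool * J m)%type else unit.

(** Consequently each set [D a] is a union of classes from level a + 1 on, and each kernel is
    regular at all later levels with an error tending to 0. *)
Definition code_system (J : nat -> finType) (d : measure_display)
    (T : measurableType d) (mu : probability T R) (u : nat -> T * T -> R)
    (D : nat -> set T) (c : forall M, T -> levels J M) :=
  [/\ forall M, mcode (c M), forall M x, (c M.+1 x).1 = (c M x, x \in D M) &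
    forall M q, (q <= M)%N -> regular mu (c M.+1) (u q) M.+1%:R^-1].

Lemma mcode_mem (d : measure_display) (T : measurableType d) (V : set T) :
  measurable V -> mcode (fun x : T => x \in V).
Proof.
move=> mV [|].
  by rewrite (_ : _ @^-1` _ = V)//; apply/seteqP; split => x /=; [exact: set_mem|exact: mem_set].
rewrite (_ : _ @^-1` _ = ~` V); first exact: measurableC.
by apply/seteqP; split => x /=; [move=> + Vx; rewrite mem_set|move=> Vx; apply/negbTE/negP; rewrite inE].
Qed.

Lemma exists_code_system : exists J : nat -> finType,
  forall (d : measure_display) (T : measurableType d) (mu : probability T R)
    (u : nat -> T * T -> R) (D : nat -> set T),
  (forall q, bmf (u q)) -> (forall q z, 0 <= u q z <= 1) ->
  (forall q, measurable (D q)) ->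
  exists c : forall M, T -> levels J M, code_system mu u D c.
Proof.
have /choice[J HJ] : forall M, exists J : finType,
    forall (d : measure_display) (T : measurableType d)
    (mu : probability T R) (I : finType) (c : T -> I) (u : nat -> T * T -> R),
    mcode c -> (forall q, bmf (u q)) -> (forall q z, 0 <= u q z <= 1) ->
  exists2 new : T -> J, mcode new &
    forall q, (q < M.+1)%N -> regular mu (fun x => (c x, new x)) (u q) M.+1%:R^-1.
  by move=> M; apply: regularity; rewrite invr_gt0.
exists J => d T mu u D bu u01 mD.
(* The new class is chosen as a function of the whole code and for every map [c], arbitrarily when
   [c] is not measurable; this totality lets the levels be defined by recursion before their
   measurability is proved. *)
have H M : exists F : (T -> levels J M * bool) -> (T -> J M), forall c, mcode c ->
    mcode (F c) /\ forall q, (q < M.+1)%N -> regular mu (fun x => (c x, F c x)) (u q) M.+1%:R^-1.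
  suff /choice[F HF] : forall c : T -> levels J M * bool, exists new : T -> J M,
      mcode c -> mcode new /\ forall q, (q < M.+1)%N ->
      regular mu (fun x => (c x, new x)) (u q) M.+1%:R^-1 by exists F.
  move=> c.
  have [mc|nc] := pselect (mcode c).
    by have [new mn rn] := HJ M d T mu _ c u mc bu u01; exists new.
  have mt : mcode (fun _ : T => tt).
    by move=> [] /=; rewrite (_ : _ @^-1` _ = setT)//; apply/seteqP; split.
  by have [new _ _] := HJ M d T mu _ _ u mt bu u01; exists new.
pose F M := projT1 (cid (H M)).
have FP M := projT2 (cid (H M)).
pose c := fix c M : T -> levels J M := if M is m.+1 return T -> levels J M
  then fun x => ((c m x, x \in D m), F m (fun x => (c m x, x \in D m)) x) else fun=> tt.
have mc M : mcode (c M).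
  elim: M => [|M IH].
    by move=> [] /=; rewrite (_ : _ @^-1` _ = setT)//; apply/seteqP; split.
  have mcD : mcode (fun x => (c M x, x \in D M)).
    by apply: mcode_pair => //; exact: mcode_mem.
  by apply: mcode_pair => //; have [] := FP M _ mcD.
exists c; split => // M q qM.
have mcD : mcode (fun x => (c M x, x \in D M)).
  by apply: mcode_pair => //; exact: mcode_mem.
by have [_] := FP M _ mcD; apply.
Qed.

End levels.

Lemma sum_triple (R : realType) (A B C : finType) (f : A * B * C -> R) :
  \sum_a f a = \sum_i \sum_b \sum_j f ((i, b), j).
Proof.
transitivity (\sum_(a : A * B * C) f (a.1, a.2)); first by apply: eq_bigr => -[].
rewrite -(pair_bigA _ (fun ib j => f (ib, j)))/=.
transitivity (\sum_(ib : A * B) \sum_j f ((ib.1, ib.2), j)); first by apply: eq_bigr => -[].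
by rewrite -(pair_bigA _ (fun i b => \sum_j f ((i, b), j))).
Qed.

Section realize_codes.
Context (d : measure_display) (T : measurableType d) (R : realType).
Variable mu : probability T R.

Lemma cprobE (I : finType) (c : T -> I) i : mcode c ->
  cprob mu c i = fine (mu (c @^-1` [set i])).
Proof.
move=> mc; rewrite -int_indic//; apply: eq_Rintegral => x _.
by rewrite indicE; congr (nat_of_bool _)%:R; apply/eqP/idP; rewrite inE.
Qed.

(** Additivity of the masses over the children of a class is exactly what allows each class of level
    M to be split inside itself by [split_set]. *)
Lemma exists_codes (J : nat -> finType) (p : forall M, levels J M -> R) :
  atomless mu -> (forall M i, 0 <= p M i) -> p 0%N tt = 1 ->
  (forall M i, \sum_b \sum_j p M.+1 ((i, b), j) = p M i) ->
  exists c : forall M, T -> levels J M, [/\ forall M, mcode (c M),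
    forall M x, (c M.+1 x).1.1 = c M x & forall M i, cprob mu (c M) i = p M i].
Proof.
move=> atl p0 p1 pS.
have sum1 M : \sum_i p M i = 1.
  elim: M => [|M IH]; first by rewrite (big_pred1 tt)// => -[].
  rewrite -IH; under [RHS]eq_bigr do rewrite -pS.
  exact: sum_triple.
(* A leftover class is needed for the splitting; [J M] has an element since otherwise the total mass
   at level M, which is 1, would be an empty sum. *)
have j0 M : {j : J M | true}.
  have [j _|J0] := pickP (fun _ : J M => true); first by exists j.
  exfalso; have := sum1 M; rewrite big1; first by move/esym/eqP; rewrite oner_eq0.
  by move=> i _; rewrite -pS big1// => b _; rewrite big1// => j _; have := J0 j.
have H M : exists F : (T -> levels J M) -> (T -> bool * J M), forall c, mcode c ->
    (forall i, cprob mu c i = p M i) -> mcode (F c) /\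
    forall i b j, cprob mu (fun x => ((c x, (F c x).1), (F c x).2)) ((i, b), j) = p M.+1 ((i, b), j).
  suff /choice[F HF] : forall c : T -> levels J M, exists new : T -> bool * J M,
    mcode c -> (forall i, cprob mu c i = p M i) -> mcode new /\
    forall i b j, cprob mu (fun x => ((c x, (new x).1), (new x).2)) ((i, b), j) = p M.+1 ((i, b), j).
    by exists F.
  move=> c.
  have [[mc cp]|nc] := pselect (mcode c /\ forall i, cprob mu c i = p M i); last first.
    by exists (fun=> (true, sval (j0 M))) => mc cp; exfalso; apply: nc.
  have /choice[g Hg] : forall i, exists g : T -> bool * J M, mcode g /\
      forall bj, fine (mu (c @^-1` [set i] `&` g @^-1` [set bj])) = p M.+1 ((i, bj.1), bj.2).
    move=> i; have [||g mg gp] := @split_set _ _ _ mu atl _ (true, sval (j0 M))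
        (fun bj => p M.+1 ((i, bj.1), bj.2)) (c @^-1` [set i]) _ (mc i).
    - by move=> bj; exact: p0.
    - by rewrite -cprobE// cp -pS (pair_bigA _ (fun b j => p M.+1 ((i, b), j))).
    - by exists g.
  pose F x := g (c x) x.
  have mF : mcode F.
    move=> bj; rewrite (_ : _ @^-1` _ =
        \bigcup_(i in setT) (c @^-1` [set i] `&` g i @^-1` [set bj])).
      apply: fin_bigcup_measurable; first exact: finite_finset.
      by move=> i _; apply: measurableI => //; case: (Hg i).
    by apply/seteqP; split => [x Fx|x [i _ [/= <-]]//]; exists (c x).
  exists F => _ _; split => // i b j; have [_ /(_ (b, j))/= <-] := Hg i.
  rewrite cprobE; last first.
    by apply: mcode_pair; [apply: mcode_pair => //|];
      [exact: (mcode_comp fst mF)|exact: (mcode_comp snd mF)].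
  congr (fine (mu _)); apply/seteqP; split => x /=; rewrite /F.
    by move=> [<- <- <-]; split => //; rewrite -surjective_pairing.
  by move=> [-> ->].
pose F M := projT1 (cid (H M)).
have FP M := projT2 (cid (H M)).
pose c := fix c M : T -> levels J M := if M is m.+1 return T -> levels J M
  then fun x => ((c m x, (F m (c m) x).1), (F m (c m) x).2) else fun=> tt.
have mc M : mcode (c M) /\ forall i, cprob mu (c M) i = p M i.
  elim: M => [|M [mc cp]].
    split.
      by move=> [] /=; rewrite (_ : _ @^-1` _ = setT)//; apply/seteqP; split.
    by move=> []; rewrite p1 -[RHS](int_cst mu); apply: eq_Rintegral.
  have [mF Fp] := FP M _ mc cp; split => /=; last by move=> [[i b] j].
  by apply: mcode_pair; [apply: mcode_pair => //|];
    [exact: (mcode_comp fst mF)|exact: (mcode_comp snd mF)].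
by exists c; split => // M; case: (mc M).
Qed.

Lemma int_code2 (I : finType) (c : T -> I) (H : I * I -> R) : mcode c ->
  \int[(mu \x mu)%E]_z H (code2 c z) =
  \sum_a H a * (cprob mu c a.1 * cprob mu c a.2).
Proof.
move=> mc; rewrite (int_code (mu \x mu)%E (mcode_code2 mc) H).
by apply: eq_bigr => -[i j] _; rewrite cprob_prod.
Qed.

End realize_codes.

Section refined_codes.
Context (d : measure_display) (T : measurableType d) (R : realType).
Variables (mu : probability T R).

Lemma cprob_children (A B C : finType) (c : T -> A * B * C) i : mcode c ->
  \sum_b \sum_j cprob mu c ((i, b), j) = cprob mu (fun x => (c x).1.1) i.
Proof.
move=> mc.
have -> : cprob mu (fun x => (c x).1.1) i =
  \int[mu]_x (fun a : A * B * C => (a.1.1 == i)%:R) (c x) by [].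
rewrite (int_code mu mc (fun a : A * B * C => (a.1.1 == i)%:R)) sum_triple (bigD1 i)//= [X in _ = _ + X]big1 ?addr0; last first.
  by move=> i' /negbTE ->; rewrite big1// => b _; rewrite big1// => j _; rewrite mul0r.
by apply: eq_bigr => b _; apply: eq_bigr => j _; rewrite eqxx mul1r.
Qed.

(** The tower property of conditional expectation, written as finite sums in masses and averages so
    that it survives the passage to the limit. *)
Lemma avg_refine (I I' : finType) (c' : T -> I') (r : I' -> I) (u : T * T -> R)
    (h : I * I -> R) : mcode c' -> bmf u -> let c x := r (c' x) in
  \sum_a h (r a.1, r a.2) * avg (mu \x mu)%E (code2 c') u a *
    (cprob mu c' a.1 * cprob mu c' a.2) =
  \sum_b h b * avg (mu \x mu)%E (code2 c) u b *
    (cprob mu c b.1 * cprob mu c b.2).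
Proof.
move=> mc' bu c; have mc : mcode c by exact: mcode_comp.
transitivity (\int[(mu \x mu)%E]_z (h (code2 c z) * u z)).
  rewrite -(int_code2 mu (fun a => h (r a.1, r a.2) * avg (mu \x mu)%E (code2 c') u a))//.
  exact: (int_ce (mu \x mu)%E (mcode_code2 mc') (fun a => h (r a.1, r a.2)) bu).
rewrite -(int_code2 mu (fun a => h a * avg (mu \x mu)%E (code2 c) u a))//.
by apply/esym; exact: (int_ce (mu \x mu)%E (mcode_code2 mc) h bu).
Qed.

End refined_codes.

(** The bit recorded on passing from level [a] to level a + 1; the value is [false] at levels up to
    [a], where it is not yet known. *)
Fixpoint dbit (J : nat -> finType) a M : levels J M -> bool :=
  match M return levels J M -> bool with
  | 0%N => fun=> false
  | m.+1 => fun i => if a == m then i.1.2 else dbit a i.1.1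
  end.

Lemma dbitE (J : nat -> finType) (T : Type) (D : nat -> set T)
  (c : forall M, T -> levels J M) a M x :
  (forall M x, (c M.+1 x).1 = (c M x, x \in D M)) ->
  (a < M)%N -> dbit a (c M x) = (x \in D a).
Proof.
move=> cS; elim: M => // M IH; rewrite ltnS leq_eqVlt => /orP[/eqP ->|aM] /=.
  by rewrite eqxx cS.
by rewrite (ltn_eqF aM) cS IH.
Qed.

(** Exchange of two limits: the approximation of [x] is uniform in [n], so convergence at each
    accuracy [j] suffices. Here [j] stands for a level of the partitions, and in the final argument
    for a number of cells. *)
Lemma cvg_approx (R : realType) (x : nat -> R) (y : R) (xs : nat -> nat -> R)
    (ys : nat -> R) (e e' : nat -> R) :
  (\forall j \near \oo, forall n, `|x n - xs j n| <= e j) ->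
  (\forall j \near \oo, `|y - ys j| <= e' j) ->
  (\forall j \near \oo, xs j @ \oo --> ys j) ->
  e @ \oo --> 0 -> e' @ \oo --> 0 -> x @ \oo --> y.
Proof.
move=> xe ye xy /cvgrPdist_lt e0 /cvgrPdist_lt e'0; apply/cvgrPdist_lt => r r0.
have r3 : 0 < r / 3 by rewrite divr_gt0.
near \oo => j.
have xej : forall n, `|x n - xs j n| <= e j by near: j.
have yej : `|y - ys j| <= e' j by near: j.
have ej : `|0 - e j| < r / 3 by near: j; exact: e0.
have e'j : `|0 - e' j| < r / 3 by near: j; exact: e'0.
have /cvgrPdist_lt/(_ _ r3) xyj : xs j @ \oo --> ys j by near: j.
near=> n.
have h1 : `|ys j - xs j n| < r / 3 by near: n.
have h2 := xej n.
move: ej e'j; rewrite !sub0r !normrN => /(le_lt_trans (ler_norm _)) ej /(le_lt_trans (ler_norm _)) e'j.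
rewrite (_ : y - x n = (y - ys j) + (ys j - xs j n) - (x n - xs j n)); last by ring.
rewrite (le_lt_trans (ler_normB _ _))// (le_lt_trans (lerD (ler_normD _ _) (lexx _)))//.
lra.
Unshelve. all: by end_near.
Qed.

(** * Convergence of the martingale of step kernels *)

Section limit_kernels.
Context (d : measure_display) (T : measurableType d) (R : realType).
Variables (mu : probability T R) (J : nat -> finType).
Variables (c : forall M, T -> levels J M).
Variable dd : nat -> forall M, levels J M * levels J M -> R.
Hypotheses (mc : forall M, mcode (c M)).
Hypothesis cS : forall M x, (c M.+1 x).1.1 = c M x.
Hypothesis dd01 : forall q M a, 0 <= dd q (M:=M) a <= 1.
(** Compatibility of the values across levels, tested against all functions [h] of the coarser
    code. *)
Hypothesis dd_martingale : forall q M (h : levels J M * levels J M -> R),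
  \sum_a h (a.1.1.1, a.2.1.1) * dd q (M:=M.+1) a *
    (cprob mu (c M.+1) a.1 * cprob mu (c M.+1) a.2) =
  \sum_b h b * dd q b * (cprob mu (c M) b.1 * cprob mu (c M) b.2).

Definition step_kernel q M z := dd q (code2 (c M) z).

Local Notation U := step_kernel.
Local Notation mu2 := (mu \x mu)%E.

Lemma bmf_step q M : bmf (U q M).
Proof.
rewrite /step_kernel.
exact: (bmf_code (dd q (M:=M)) (mcode_code2 (@mc M))).
Qed.

Lemma code_factor M M' : (M <= M')%N ->
  exists r : levels J M' -> levels J M, forall x, c M x = r (c M' x).
Proof.
elim: M' => [|M' IH]; first by rewrite leqn0 => /eqP ->; exists id.
rewrite leq_eqVlt => /orP[/eqP ->|]; first by exists id.
by rewrite ltnS => /IH[r rE]; exists (fun a => r a.1.1) => x; rewrite cS.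
Qed.

Lemma step_martingale q M M' (h : levels J M * levels J M -> R) : (M <= M')%N ->
  \int[mu2]_z (h (code2 (c M) z) * U q M' z) = \int[mu2]_z (h (code2 (c M) z) * U q M z).
Proof.
elim: M' => [|M' IH]; first by rewrite leqn0 => /eqP M0; subst M.
rewrite leq_eqVlt => /orP[/eqP M0|]; first by subst M.
rewrite ltnS => MM'; rewrite -IH//.
have [r rE] := code_factor MM'.
pose h' (b : levels J M' * levels J M') := h (r b.1, r b.2).
pose H (a : levels J M'.+1 * levels J M'.+1) := h' (a.1.1.1, a.2.1.1) * dd q a.
transitivity (\int[mu2]_z H (code2 (c M'.+1) z)).
  by apply: eq_Rintegral => z _; rewrite /H /h' /code2 /= !cS -!rE.
rewrite (int_code2 mu H (@mc M'.+1)) dd_martingale.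
rewrite -(int_code2 mu (fun b => h' b * dd q b))//.
by apply: eq_Rintegral => z _; rewrite /h' /code2 /= -!rE.
Qed.

Definition step_energy q M := \int[mu2]_z (U q M z) ^+ 2.

(** Orthogonality of martingale increments. *)
Lemma step_energy_diff q M M' : (M <= M')%N ->
  \int[mu2]_z (U q M' z - U q M z) ^+ 2 = step_energy q M' - step_energy q M.
Proof.
move=> MM'; have b := bmf_step q M; have b' := bmf_step q M'.
rewrite (_ : (fun z => (_ - _) ^+ 2) = (fun z => U q M' z ^+ 2 -
    (2 * (U q M z * U q M' z) - U q M z ^+ 2))); last by apply/funext => z; ring.
have bb : bmf (fun z => U q M z * U q M' z) by exact: bmfM.
rewrite !intB//; try exact: bmfX; try exact: bmfZ; last first.
  by apply: bmfB; [exact: bmfZ|exact: bmfX].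
have E : \int[mu2]_z (U q M z * U q M' z) = step_energy q M.
  rewrite (step_martingale q (dd q (M:=M)) MM').
  by apply: eq_Rintegral => z _; rewrite expr2.
rewrite intZl// E.
transitivity (step_energy q M' - (2 * step_energy q M - step_energy q M)) => //.
by move: (step_energy q M) (step_energy q M') => x y; ring.
Qed.

Lemma step_energy_mono q : nondecreasing_seq (step_energy q).
Proof.
move=> M M' MM'; rewrite -subr_ge0 -step_energy_diff//.
by apply: int_ge0 => z; exact: sqr_ge0.
Qed.

Lemma step_energy_le1 q M : step_energy q M <= 1.
Proof.
apply: int_le_cst; first exact/bmfX/bmf_step.
by move=> z; have /andP[a0 a1] := dd01 q (code2 (c M) z); exact: exprn_ile1.
Qed.

Lemma step_energy_tail q (e : R) : 0 < e ->
  \forall M \near \oo, forall M', (M <= M')%N -> step_energy q M' - step_energy q M <= e.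
Proof.
move=> e0; have cv : cvgn (step_energy q).
  apply: nondecreasing_is_cvgn; first exact: step_energy_mono.
  by exists 1 => _ [M _ <-]; exact: step_energy_le1.
have /cvgrPdist_le/(_ _ e0) := cv; apply: filterS => M H M' MM'.
rewrite (le_trans _ H)//; rewrite (le_trans _ (ler_norm _))// lerD2r.
exact: (nondecreasing_cvgn_le (@step_energy_mono q) cv).
Qed.

(** The energies increase and are bounded by 1, hence converge. Level [Mk k] is taken so far out
    that for [q] at most [k] the energy changes afterwards by at most the square of 2^-k; by Jensen
    the L1 increments along [Mk] are then at most 2^-k, and summability gives convergence almost
    everywhere. *)
Lemma exists_limit_kernels : exists (Mk : nat -> nat) (w : nat -> T * T -> R),
  [/\ {homo Mk : i j / (i < j)%N}, forall q, bmf (w q), forall q z, 0 <= w q z <= 1,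
    forall q, {ae mu2, forall z, (fun k => U q (Mk k) z) @ \oo --> w q z} &
    forall q, (fun k => \int[mu2]_z `|U q (Mk k) z - w q z|) @ \oo --> 0].
Proof.
have [|Mk [Mk_incr MkP]] := @strict_subseq (fun k M => forall q, (q <= k)%N ->
    forall M', (M <= M')%N -> step_energy q M' - step_energy q M <= (2^-1 ^+ k) ^+ 2).
  move=> k N.
  have e0 : 0 < ((2^-1 : R) ^+ k) ^+ 2 by rewrite !exprn_gt0// invr_gt0.
  have H : \forall M \near \oo, forall q : 'I_k.+1, forall M', (M <= M')%N ->
      step_energy q M' - step_energy q M <= (2^-1 ^+ k) ^+ 2.
    by apply: filter_forall => q; exact: step_energy_tail.
  have [M] : exists M, (N <= M)%N /\ forall q : 'I_k.+1, forall M', (M <= M')%N ->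
      step_energy q M' - step_energy q M <= (2^-1 ^+ k) ^+ 2.
    by apply: (@filter_ex _ \oo); apply: filterI => //; exact: nbhs_infty_ge.
  move=> [NM HM]; exists M => // q qk; exact: (HM (Ordinal (qk : (q < k.+1)%N))).
have /choice[w wP] q : exists g : T * T -> R, [/\ bmf g, (forall x, 0 <= g x <= 1),
    {ae mu2, forall x, (fun k => U q (Mk k) x) @ \oo --> g x} &
    (fun k => \int[mu2]_x `|U q (Mk k) x - g x|) @ \oo --> 0].
  apply: (@riesz_fischer _ _ _ mu2 (fun k => U q (Mk k)) q).
  - by move=> k; exact: bmf_step.
  - by move=> k z; exact: dd01.
  - move=> k qk; have MM : (Mk k <= Mk k.+1)%N by apply/ltnW/Mk_incr.
    have bU : bmf (fun z => U q (Mk k.+1) z - U q (Mk k) z) by apply: bmfB; exact: bmf_step.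
    rewrite -ler_sqr ?nnegrE ?exprn_ge0 ?invr_ge0//; last by apply: int_ge0.
    rewrite (le_trans (int_sqr_le _ _))//; first exact: bmf_norm.
    under eq_Rintegral do rewrite real_normK ?num_real//.
    by rewrite step_energy_diff// MkP.
exists Mk, w; split => // q; by case: (wP q).
Qed.

End limit_kernels.

(** * Compactness for sequences of kernels with distinguished sets *)

Section compactness.
Context (R : realType).

(* [None] stands for the threshold -oo, so that a difference of two of these
   is the mass, or the indicator, of an interval that may be unbounded below. *)
Definition opt_kernel (T : Type) (u : nat -> T * T -> R) (o : option nat) (z : T * T) : R :=
  if o is Some q then u q z else 0.

Definition opt_ind (T : Type) (D : nat -> set T) (o : option nat) (x : T) : R :=
  if o is Some q then \1_(D q) x else 0.

Definition opt_hom (d : measure_display) (T : measurableType d) (mu : probability T R)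
    (u : nat -> T * T -> R) (D : nat -> set T) (k l : nat)
    (a a' : 'I_k -> option nat) (b b' : 'I_l -> option nat)
    (v v' : 'I_k * 'I_l -> option nat) : R :=
  hom mu (fun i x => opt_ind D (a i) x - opt_ind D (a' i) x)
    (fun j y => opt_ind D (b j) y - opt_ind D (b' j) y)
    (fun e z => opt_kernel u (v e) z - opt_kernel u (v' e) z).

Lemma cut_leB (d : measure_display) (T : measurableType d) (mu : probability T R)
    (w w' : T * T -> R) (e e' : R) : bmf w -> bmf w' ->
  cut_le mu w e -> cut_le mu w' e' -> cut_le mu (fun z => w z - w' z) (e + e').
Proof.
move=> bw bw' we we' g h mg mh g1 h1.
have bgh : bmf (fun z : T * T => g z.1 * h z.2).
  by apply: bmfM; [apply: bmf_fst|apply: bmf_snd]; exact: bmf1.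
under eq_Rintegral do rewrite mulrBl.
rewrite intB; [|exact: bmfM|exact: bmfM].
by rewrite (le_trans (ler_normB _ _))// lerD// ?we ?we'.
Qed.

Lemma cut_le0 (d : measure_display) (T : measurableType d) (mu : probability T R) (e : R) :
  0 <= e -> cut_le mu (fun _ : T * T => 0 - 0) e.
Proof.
move=> e0 g h _ _ _ _; under eq_Rintegral do rewrite subrr mul0r.
by rewrite int_cst normr0.
Qed.

Lemma ub_sub01 (d : measure_display) (T : measurableType d) (f g : T -> R) :
  bmf f -> bmf g -> (forall x, 0 <= f x <= 1) -> (forall x, 0 <= g x <= 1) ->
  ub (fun x => f x - g x).
Proof.
move=> bf bg f01 g01; split; first by case: (bmfB bf bg).
move=> x; have /andP[f0 f1] := f01 x; have /andP[g0 g1] := g01 x.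
by rewrite ler_norml; lra.
Qed.

Lemma opt_kernel01 (T : Type) (u : nat -> T * T -> R) o z :
  (forall q z, 0 <= u q z <= 1) -> 0 <= opt_kernel u o z <= 1.
Proof. by move=> u01; case: o => [q|] //=; rewrite lexx ler01. Qed.

Lemma bmf_opt_kernel (d : measure_display) (T : measurableType d)
  (u : nat -> T * T -> R) o : (forall q, bmf (u q)) -> bmf (opt_kernel u o).
Proof. by move=> bu; case: o => [q|]; [exact: bu|exact: (bmf_cst _ 0)]. Qed.

Lemma opt_ind01 (T : Type) (D : nat -> set T) o x : 0 <= opt_ind D o x <= 1.
Proof.
case: o => [q|] /=; last by rewrite lexx ler01.
by rewrite indicE; case: (_ \in _); rewrite ?lexx ?ler01.
Qed.

Lemma bmf_opt_ind (d : measure_display) (T : measurableType d)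
  (D : nat -> set T) o : (forall q, measurable (D q)) -> bmf (opt_ind D o).
Proof. by move=> mD; case: o => [q|]; [exact: bmf_indic|exact: (bmf_cst _ 0)]. Qed.

Lemma ub_opt_ind (d : measure_display) (T : measurableType d) (D : nat -> set T) o o' :
  (forall q, measurable (D q)) -> ub (fun x => opt_ind D o x - opt_ind D o' x).
Proof.
by move=> mD; apply: ub_sub01 => [||x|x];
  [exact: bmf_opt_ind|exact: bmf_opt_ind|exact: opt_ind01|exact: opt_ind01].
Qed.

Lemma ub_opt_kernel (d : measure_display) (T : measurableType d) (u : nat -> T * T -> R) o o' :
  (forall q, bmf (u q)) -> (forall q z, 0 <= u q z <= 1) ->
  ub (fun z => opt_kernel u o z - opt_kernel u o' z).
Proof.
by move=> bu u01; apply: ub_sub01 => [||z|z];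
  [exact: bmf_opt_kernel|exact: bmf_opt_kernel|exact: opt_kernel01|exact: opt_kernel01].
Qed.

Lemma opt_ind_code (J : nat -> finType) (T : Type) (D : nat -> set T)
    (c : forall M, T -> levels J M) o M x :
  (forall M x, (c M.+1 x).1 = (c M x, x \in D M)) ->
  (forall a, o = Some a -> (a < M)%N) ->
  opt_ind D o x = if o is Some a then (dbit a (c M x))%:R else 0.
Proof.
by move=> cS; case: o => [a|] //= aM; rewrite indicE (dbitE _ cS)//; exact: aM.
Qed.

Lemma finite_bound (I : finType) (o : I -> option nat) :
  \forall M \near \oo, forall i a, o i = Some a -> (a < M)%N.
Proof.
apply: filter_forall => i; case: (o i) => [a|]; last exact: nearW.
by apply: filterS (nbhs_infty_gt a) => M aM b [<-].
Qed.

Lemma cvg_sumr (I : Type) (r : seq I) (q : pred I) (f : I -> nat -> R) (l : I -> R) :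
  (forall i, f i @ \oo --> l i) ->
  (fun n => \sum_(i <- r | q i) f i n) @ \oo --> \sum_(i <- r | q i) l i.
Proof.
move=> fl; elim: r => [|i r IH].
  by rewrite big_nil; under eq_fun do rewrite big_nil; exact: cvg_cst.
rewrite big_cons; under eq_fun do rewrite big_cons.
by case: (q i) => //; apply: cvgD.
Qed.

Lemma cvg_prodr (I : Type) (r : seq I) (q : pred I) (f : I -> nat -> R) (l : I -> R) :
  (forall i, f i @ \oo --> l i) ->
  (fun n => \prod_(i <- r | q i) f i n) @ \oo --> \prod_(i <- r | q i) l i.
Proof.
move=> fl; elim: r => [|i r IH].
  by rewrite big_nil; under eq_fun do rewrite big_nil; exact: cvg_cst.
rewrite big_cons; under eq_fun do rewrite big_cons.
by case: (q i) => //; apply: cvgM.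
Qed.

Lemma cvg_ge (f : nat -> R) (l a : R) : f @ \oo --> l -> (forall n, a <= f n) -> a <= l.
Proof.
move=> fl fa; rewrite -(cvg_lim _ fl)//; apply: limr_ge; first exact: (cvgP _ fl).
exact: nearW.
Qed.

Lemma cvg_le (f g : nat -> R) (l m : R) : f @ \oo --> l -> g @ \oo --> m ->
  (forall n, f n <= g n) -> l <= m.
Proof.
move=> fl gm fg; rewrite -subr_ge0; apply: (@cvg_ge (fun n => g n - f n)).
  exact: cvgB.
by move=> n; rewrite subr_ge0.
Qed.

Lemma cvg_eq (f g : nat -> R) (l m : R) : f @ \oo --> l -> g @ \oo --> m ->
  (forall n, f n = g n) -> l = m.
Proof.
move=> fl gm fg; apply/eqP; rewrite eq_le (cvg_le fl gm) ?(cvg_le gm fl)//.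
  by move=> n; rewrite fg.
by move=> n; rewrite fg.
Qed.

Section coded_sets.
Context (d : measure_display) (T : measurableType d) (mu : probability T R).
Context (J : nat -> finType) (D : nat -> set T) (c : forall M, T -> levels J M).
Hypotheses (mc : forall M, mcode (c M)) (mD : forall q, measurable (D q)).
Hypothesis cS : forall M x, (c M.+1 x).1 = (c M x, x \in D M).

(** At levels beyond both indices the two sets are unions of classes, so the mass of the
    intersection is a fixed sum of class masses and converges with them. *)
Lemma coded_setI a b M : (a < M)%N -> (b < M)%N ->
  fine (mu (D a `&` D b)) =
  \sum_i (dbit a i && dbit b i)%:R * cprob mu (c M) i.
Proof.
move=> aM bM; rewrite -(int_code mu (@mc M) (fun i => (dbit a i && dbit b i)%:R)).
rewrite -int_indic; last exact: measurableI.
apply: eq_Rintegral => x _; rewrite (dbitE _ cS aM) (dbitE _ cS bM).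
by rewrite indicE in_setI.
Qed.

Definition dweight M (o o' : option nat) (i : levels J M) : R :=
  (if o is Some a then (dbit a i)%:R else 0) - (if o' is Some a then (dbit a i)%:R else 0).

Lemma opt_hom_step (k l : nat) (a a' : 'I_k -> option nat) (b b' : 'I_l -> option nat)
    M (ph : 'I_k * 'I_l -> levels J M * levels J M -> R) :
  (forall i q, a i = Some q -> (q < M)%N) -> (forall i q, a' i = Some q -> (q < M)%N) ->
  (forall i q, b i = Some q -> (q < M)%N) -> (forall i q, b' i = Some q -> (q < M)%N) ->
  hom mu (fun i x => opt_ind D (a i) x - opt_ind D (a' i) x)
    (fun j y => opt_ind D (b j) y - opt_ind D (b' j) y)
    (fun e z => ph e (code2 (c M) z)) =
  \sum_(r : {ffun 'I_k -> levels J M} * {ffun 'I_l -> levels J M})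
    ((\prod_i dweight (a i) (a' i) (r.1 i)) * (\prod_j dweight (b j) (b' j) (r.2 j)) *
      \prod_e ph e (r.1 e.1, r.2 e.2)) *
    ((\prod_i cprob mu (c M) (r.1 i)) * \prod_j cprob mu (c M) (r.2 j)).
Proof.
move=> aM aM' bM bM'; rewrite -(@hom_step _ _ _ mu k l _ (c M) (@mc M)
  (fun i => dweight (a i) (a' i)) (fun j => dweight (b j) (b' j)) ph).
congr (hom mu _ _ _); apply/funext => i; apply/funext => x; rewrite /dweight.
  by rewrite (@opt_ind_code J T D c _ M)// ?(@opt_ind_code J T D c _ M)//; [exact: aM'|exact: aM].
by rewrite (@opt_ind_code J T D c _ M)// ?(@opt_ind_code J T D c _ M)//; [exact: bM'|exact: bM].
Qed.

End coded_sets.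

Context (d : measure_display) (T : measurableType d) (mu : probability T R).
Hypothesis mu_atomless : atomless mu.
Context (dn : nat -> measure_display) (Tn : forall n, measurableType (dn n))
  (mun : forall n, probability (Tn n) R).
Context (u : forall n, nat -> Tn n * Tn n -> R) (D : forall n, nat -> set (Tn n)).
Arguments u : clear implicits.
Arguments D : clear implicits.
Hypotheses (bu : forall n q, bmf (u n q)) (u01 : forall n q z, 0 <= u n q z <= 1).
Hypothesis mD : forall n q, measurable (D n q).

Lemma exists_limit_data : exists (J : nat -> finType)
    (c : forall n M, Tn n -> levels J M) (s : nat -> nat)
    (p : forall M, levels J M -> R) (dd : nat -> forall M, levels J M * levels J M -> R),
  [/\ {homo s : i j / (i < j)%N},
    forall n, code_system (mun n) (u n) (D n) (c n),
    forall M i, (fun n => cprob (mun (s n)) (c (s n) M) i) @ \oo --> p M i &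
    forall q M a, (fun n => avg (mun (s n) \x mun (s n))%E (code2 (c (s n) M)) (u (s n) q) a)
      @ \oo --> dd q M a].
Proof.
have [J HJ] := exists_code_system R.
have Hc n := HJ _ _ (mun n) (u n) (D n) (@bu n) (@u01 n) (@mD n).
pose c n := projT1 (cid (Hc n)).
have cP n : code_system (mun n) (u n) (D n) (c n) := projT2 (cid (Hc n)).
(* Masses and averages at all levels are gathered in one countable family, for a single diagonal
   extraction. Indices that encode no class get the value 0. *)
pose a n (k : (nat * nat) + (nat * nat * nat)) : R :=
  match k with
  | inl (M, j) => if @unpickle (levels J M) j is Some i then cprob (mun n) (c n M) i else 0
  | inr (q, M, j) => if @unpickle (levels J M * levels J M)%type j is Some i
      then avg (mun n \x mun n)%E (code2 (c n M)) (u n q) i else 0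
  end.
have a01 n k : 0 <= a n k <= 1.
  have [mc _ _] := cP n.
  case: k => [[M j]|[[q M] j]] /=; case: unpickle => [i|]; rewrite ?lexx ?ler01//.
    by rewrite cprob_ge0 cprob_le1.
  apply: avg01 => //; exact: (mcode_code2 (@mc M)).
have [s [s_incr [lim limP]]] := diag_subseq a01.
exists J, c, s, (fun M i => lim (inl (M, pickle i))),
  (fun q M i => lim (inr (q, M, pickle i))); split => //.
- move=> M i; have := limP (inl (M, pickle i)).
  by rewrite /a pickleK.
- move=> q M i; have := limP (inr (q, M, pickle i)).
  by rewrite /a pickleK.
Qed.

(** Besides the densities, the order relations are carried over: monotonicity of the kernels in the
    threshold, and, through masses of intersections, the masses of the sets and their inclusions up
    to null sets. The reconstruction of a Latinon relies on them. *)
Theorem compactness : exists (s : nat -> nat) (w : nat -> T * T -> R) (E : nat -> set T),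
  [/\ {homo s : i j / (i < j)%N},
    (forall q, bmf (w q)) /\ (forall q z, 0 <= w q z <= 1) /\ (forall q, measurable (E q)),
    forall q q', (forall n z, u n q z <= u n q' z) ->
      {ae (mu \x mu)%E, forall z, w q z <= w q' z},
    forall a b, (fun n => fine (mun (s n) (D (s n) a `&` D (s n) b))) @ \oo -->
      fine (mu (E a `&` E b)) &
    forall (k l : nat) (a a' : 'I_k -> option nat) (b b' : 'I_l -> option nat)
      (v v' : 'I_k * 'I_l -> option nat),
      (fun n => opt_hom (mun (s n)) (u (s n)) (D (s n)) a a' b b' v v') @ \oo -->
      opt_hom mu w E a a' b b' v v'].
Proof.
have [J [c [s [p [dd [s_incr cP pP ddP]]]]]] := exists_limit_data.
have mc n M : mcode (c n M) by have [] := cP n.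
have cS n M x : (c n M.+1 x).1 = (c n M x, x \in D n M) by have [_ + _] := cP n; apply.
have p0 M i : 0 <= p M i by apply: (cvg_ge (pP M i)) => n; exact: cprob_ge0.
have one : (fun _ : nat => 1 : R) @ \oo --> (1 : R) by exact: cvg_cst.
have p1 : p 0%N tt = 1.
  apply: (cvg_eq (pP 0%N tt) one) => n; rewrite -[RHS](int_cst (mun (s n))).
  by apply: eq_Rintegral => x _; case: (c (s n) 0%N x).
have pS M i : \sum_b \sum_j p M.+1 ((i, b), j) = p M i.
  apply: (cvg_eq _ (pP M i)).
    by apply: cvg_sumr => b; apply: cvg_sumr => j; exact: pP.
  move=> n /=; rewrite (cprob_children (mun (s n)) i (@mc (s n) M.+1)).
  by congr (cprob _ _ _); apply/funext => x; rewrite cS.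
have [e [me eS ep]] := exists_codes mu_atomless p0 p1 pS.
have dd01 q M a : 0 <= dd q M a <= 1.
  have a01 n : 0 <= avg (mun (s n) \x mun (s n))%E (code2 (c (s n) M)) (u (s n) q) a <= 1.
    by apply: avg01 => //; exact: (mcode_code2 (@mc (s n) M)).
  apply/andP; split; first by apply: (cvg_ge (ddP q M a)) => n; case/andP: (a01 n).
  by apply: (cvg_le (ddP q M a) one) => n; case/andP: (a01 n).
have mart q M (h : levels J M * levels J M -> R) :
    \sum_a h (a.1.1.1, a.2.1.1) * dd q M.+1 a *
      (cprob mu (e M.+1) a.1 * cprob mu (e M.+1) a.2) =
    \sum_b h b * dd q M b * (cprob mu (e M) b.1 * cprob mu (e M) b.2).
  under eq_bigr do rewrite !ep; under [RHS]eq_bigr do rewrite !ep.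
  apply: (cvg_eq (f := fun n => \sum_a h (a.1.1.1, a.2.1.1) *
      avg (mun (s n) \x mun (s n))%E (code2 (c (s n) M.+1)) (u (s n) q) a *
      (cprob (mun (s n)) (c (s n) M.+1) a.1 * cprob (mun (s n)) (c (s n) M.+1) a.2))
    (g := fun n => \sum_b h b *
      avg (mun (s n) \x mun (s n))%E (code2 (c (s n) M)) (u (s n) q) b *
      (cprob (mun (s n)) (c (s n) M) b.1 * cprob (mun (s n)) (c (s n) M) b.2))).
  - apply: cvg_sumr => a; apply: cvgM; last by apply: cvgM; exact: pP.
    by apply: cvgM; [exact: cvg_cst|exact: ddP].
  - apply: cvg_sumr => a; apply: cvgM; last by apply: cvgM; exact: pP.
    by apply: cvgM; [exact: cvg_cst|exact: ddP].
  - move=> n; have := avg_refine (mun (s n)) (fun i => i.1.1) h (@mc (s n) M.+1) (@bu (s n) q).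
    rewrite (_ : (fun x => (c (s n) M.+1 x).1.1) = c (s n) M)//.
    by apply/funext => x; rewrite cS.
have [Mk [w [Mk_incr bw w01 w_ae w_L1]]] := exists_limit_kernels me eS dd01 mart.
pose E a := [set x | (e a.+1 x).1.2].
have eSE M x : (e M.+1 x).1 = (e M x, x \in E M).
  rewrite [LHS]surjective_pairing eS; congr (_, _).
  by apply/idP/idP; rewrite inE.
have mE a : measurable (E a).
  exact: (mcode_preimage [set i : levels J a.+1 | i.1.2] (@me a.+1)).
exists s, w, E; split => //.
- move=> q q' uqq'.
  have ddle M a : dd q M a <= dd q' M a.
    apply: (cvg_le (ddP q M a) (ddP q' M a)) => n.
    have b1 := bmf_code_eq R a (mcode_code2 (@mc (s n) M)).
    rewrite /avg ler_wpM2r ?invr_ge0 ?cprob_ge0//; apply: int_le.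
    + exact: (bmfM (@bu (s n) q) b1).
    + exact: (bmfM (@bu (s n) q') b1).
    + by move=> z; rewrite ler_wpM2r.
  apply: filterS2 (w_ae q) (w_ae q') => z wq wq'.
  by apply: (cvg_le wq wq') => k; exact: ddle.
- move=> a b; pose M := (maxn a b).+1.
  have aM : (a < M)%N by rewrite ltnS leq_maxl.
  have bM : (b < M)%N by rewrite ltnS leq_maxr.
  rewrite (coded_setI mu me mE eSE aM bM).
  under eq_fun do rewrite (coded_setI _ (@mc _) (@mD _) (@cS _) aM bM).
  by apply: cvg_sumr => i; apply: cvgM; [exact: cvg_cst|rewrite ep; exact: pP].
- move=> k l a a' b b' v v'.
  pose ostep (A : nat -> forall M, levels J M * levels J M -> R) (o : option nat) M ij : R :=
    if o is Some q then A q M ij else 0.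
  pose An n q M := avg (mun (s n) \x mun (s n))%E (code2 (c (s n) M)) (u (s n) q).
  pose wa n i x := opt_ind (D (s n)) (a i) x - opt_ind (D (s n)) (a' i) x.
  pose wb n j x := opt_ind (D (s n)) (b j) x - opt_ind (D (s n)) (b' j) x.
  pose xs j n := hom (mun (s n)) (wa n) (wb n)
    (fun f z => ostep (An n) (v f) (Mk j) (code2 (c (s n) (Mk j)) z) -
                ostep (An n) (v' f) (Mk j) (code2 (c (s n) (Mk j)) z)).
  pose ea i x := opt_ind E (a i) x - opt_ind E (a' i) x.
  pose eb j x := opt_ind E (b j) x - opt_ind E (b' j) x.
  pose ys j := hom mu ea eb
    (fun f z => ostep dd (v f) (Mk j) (code2 (e (Mk j)) z) -
                ostep dd (v' f) (Mk j) (code2 (e (Mk j)) z)).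
  pose L (o : option nat) j : R := if o is Some q then
    \int[(mu \x mu)%E]_z `|step_kernel e dd q (Mk j) z - w q z| else 0.
  have Mk_ge j : (j <= Mk j)%N.
    by elim: j => // j IH; apply: leq_ltn_trans IH _; exact: Mk_incr.
  have Mk_oo (Q : nat -> Prop) : (\forall M \near \oo, Q M) -> \forall j \near \oo, Q (Mk j).
    by move=> [N _ HN]; exists N => // j /= Nj; apply: HN; exact: leq_trans Nj (Mk_ge j).
  have An01 n q M ij : 0 <= An n q M ij <= 1.
    by apply: avg01 => //; exact: (mcode_code2 (@mc (s n) M)).
  have ostep01 A o M ij : (forall q M ij, 0 <= A q M ij <= 1) -> 0 <= ostep A o M ij <= 1.
    by move=> A01; rewrite /ostep; case: o => [q|] //; rewrite lexx ler01.
  have bostep (d' : measure_display) (T' : measurableType d') A o M (c' : T' -> levels J M) :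
      mcode c' -> bmf (fun z => ostep A o M (code2 c' z)).
    move=> mc'; exact: (bmf_code (ostep A o M) (mcode_code2 mc')).
  (* Kernels are replaced by their averages at level [Mk j]. On the side of the sequence each edge
     carries two kernels, each at cut distance at most 4 / [Mk j] by [cut_set_cut], whence 8. On the
     side of the limit the L1 distance bounds the cut norm. *)
  apply: (@cvg_approx _ _ _ xs ys
    (fun j => \sum_(f : 'I_k * 'I_l) 8 * (Mk j)%:R^-1)
    (fun j => \sum_(f : 'I_k * 'I_l) (L (v f) j + L (v' f) j))).
  + apply: filterS3 (Mk_oo _ (finite_bound v)) (Mk_oo _ (finite_bound v')) (nbhs_infty_gt 0%N) => j vM vM' j0 n.
    have M0 : (0 < Mk j)%N by exact: leq_trans j0 (Mk_ge j).
    have cut1 o : (forall q, o = Some q -> (q < Mk j)%N) ->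
        cut_le (mun (s n)) (fun z => opt_kernel (u (s n)) o z -
          ostep (An n) o (Mk j) (code2 (c (s n) (Mk j)) z)) (4 * (Mk j)%:R^-1).
      case: o => [q|_]; last by apply: cut_le0; rewrite mulr_ge0// invr_ge0.
      move=> /(_ q erefl); case: (Mk j) M0 => // m _; rewrite ltnS => qm.
      have [_ _ reg] := cP (s n).
      apply: cut_set_cut; last exact: (reg m q qm).
      by apply: bmfB; [exact: (bmf_opt_kernel (Some q))|exact: (bostep _ _ (An n) (Some q) m.+1 _ (@mc (s n) m.+1))].
    apply: counting.
    * by move=> i; exact: ub_opt_ind.
    * by move=> i; exact: ub_opt_ind.
    * by move=> f; exact: ub_opt_kernel.
    * by move=> f; apply: ub_sub01; [exact: bostep|exact: bostep|move=> x; exact: ostep01|move=> x; exact: ostep01].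
    * move=> f; rewrite (_ : (fun z => _) = (fun z =>
        (opt_kernel (u (s n)) (v f) z - ostep (An n) (v f) (Mk j) (code2 (c (s n) (Mk j)) z)) -
        (opt_kernel (u (s n)) (v' f) z - ostep (An n) (v' f) (Mk j) (code2 (c (s n) (Mk j)) z)))); last first.
        by apply/funext => z; ring.
      rewrite (_ : 8 * _ = 4 * (Mk j)%:R^-1 + 4 * (Mk j)%:R^-1); last by ring.
      apply: cut_leB; try by apply: bmfB; [exact: bmf_opt_kernel|exact: bostep].
        by apply: cut1 => q; exact: vM.
      by apply: cut1 => q; exact: vM'.
  + apply: nearW => j.
    have cut1 o : cut_le mu (fun z => opt_kernel w o z - ostep dd o (Mk j) (code2 (e (Mk j)) z)) (L o j).
      case: o => [q|]; last exact: cut_le0.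
      rewrite /L; under eq_Rintegral do rewrite distrC.
      by apply: cut_le_L1; apply: bmfB; [exact: bw|exact: (bostep _ _ dd (Some q) (Mk j) _ (@me (Mk j)))].
    apply: counting.
    * by move=> i; exact: ub_opt_ind.
    * by move=> i; exact: ub_opt_ind.
    * by move=> f; exact: ub_opt_kernel.
    * by move=> f; apply: ub_sub01; [exact: bostep|exact: bostep|move=> x; exact: ostep01|move=> x; exact: ostep01].
    * move=> f; rewrite (_ : (fun z => _) = (fun z =>
        (opt_kernel w (v f) z - ostep dd (v f) (Mk j) (code2 (e (Mk j)) z)) -
        (opt_kernel w (v' f) z - ostep dd (v' f) (Mk j) (code2 (e (Mk j)) z)))); last first.
        by apply/funext => z; ring.
      by apply: cut_leB; try by apply: bmfB; [exact: bmf_opt_kernel|exact: bostep].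
  + near=> j.
    have aM : forall i q, a i = Some q -> (q < Mk j)%N by near: j; exact: Mk_oo (finite_bound a).
    have aM' : forall i q, a' i = Some q -> (q < Mk j)%N by near: j; exact: Mk_oo (finite_bound a').
    have bM : forall i q, b i = Some q -> (q < Mk j)%N by near: j; exact: Mk_oo (finite_bound b).
    have bM' : forall i q, b' i = Some q -> (q < Mk j)%N by near: j; exact: Mk_oo (finite_bound b').
    rewrite /ys /ea /eb (@opt_hom_step _ _ mu J E e me eSE k l a a' b b' (Mk j)
      (fun f ij => ostep dd (v f) (Mk j) ij - ostep dd (v' f) (Mk j) ij))//.
    rewrite /xs /wa /wb; under eq_fun do
      rewrite (@opt_hom_step _ _ (mun (s _)) J (D (s _)) (c (s _)) (@mc _) (@cS _) k l a a' b b' (Mk j)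
      (fun f ij => ostep (An _) (v f) (Mk j) ij - ostep (An _) (v' f) (Mk j) ij))//.
    have cA o ij : (fun n => ostep (An n) o (Mk j) ij) @ \oo --> ostep dd o (Mk j) ij.
      by case: o => [q|]; [exact: ddP|exact: cvg_cst].
    apply: cvg_sumr => r; apply: cvgM; last first.
      by apply: cvgM; apply: cvg_prodr => i; rewrite ep; exact: pP.
    apply: cvgM; first exact: cvg_cst.
    by apply: cvg_prodr => f; apply: cvgB; exact: cA.
  + rewrite -[X in _ --> X](_ : \sum_(f : 'I_k * 'I_l) 0 = 0); last by rewrite big1.
    apply: cvg_sumr => f; rewrite -(mulr0 8); apply: cvgM; first exact: cvg_cst.
    apply/cvgrPdist_lt => r r0.
    have H : \forall M \near \oo, `|0 - (M%:R : R)^-1| < r.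
      near=> M; rewrite sub0r normrN ger0_norm ?invr_ge0//.
      rewrite invf_plt ?posrE//; last by rewrite ltr0n; near: M; exact: nbhs_infty_gt.
      near: M; exact: nbhs_infty_gtr.
    exact: Mk_oo H.
  + rewrite -[X in _ --> X](_ : \sum_(f : 'I_k * 'I_l) (0 + 0) = 0); last first.
      by rewrite big1// => f _; rewrite addr0.
    have cL o : L o @ \oo --> 0 by case: o => [q|]; [exact: w_L1|exact: cvg_cst].
    by apply: cvg_sumr => f; apply: cvgD; exact: cL.
Unshelve. all: by end_near.
Qed.

End compactness.

(** * From kernels back to Latinons *)

Section unit_interval_grid.
Context (R : realType).

(* The countable set of thresholds at which Latinons are observed. *)
Definition grid (q : nat) : R := Num.max 0 (Num.min 1 (ratr (odflt 0 (@unpickle rat q)))).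

Lemma grid01 q : 0 <= grid q <= 1.
Proof. by rewrite /grid le_max lexx/= ge_max ler01/= ge_min lexx. Qed.

Lemma grid_pickle (p : rat) : 0 <= p <= 1 -> grid (pickle p) = ratr p.
Proof.
move=> /andP[p0 p1]; rewrite /grid pickleK /= min_r ?max_r//.
  by rewrite ler0q.
by rewrite -(rmorph1 (@ratr R)) ler_rat.
Qed.

Lemma grid_dense (x y : R) : 0 <= x -> x < y -> y <= 1 -> exists q, x < grid q < y.
Proof.
move=> x0 xy y1; have [p] := rat_in_itvoo xy; rewrite in_itv/= => /andP[xp py].
exists (pickle p); rewrite grid_pickle ?xp//; apply/andP; split.
  by rewrite -(ler0q R) (le_trans x0)// ltW.
by rewrite -(ler_rat R) rmorph1 (le_trans _ y1)// ltW.
Qed.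

Lemma grid_frac (N a : nat) : (0 < N)%N -> (a <= N)%N ->
  grid (pickle (a%:R / N%:R : rat)) = a%:R / N%:R.
Proof.
move=> N0 aN; rewrite grid_pickle; first by rewrite fmorph_div/= !ratr_nat.
by rewrite divr_ge0//= ler_pdivrMr ?ltr0n// mul1r ler_nat.
Qed.

Definition clip (x : R) : R := Num.max 0 (Num.min 1 x).

(* [uniform_prob] lives on [measurableTypeR R]; this copies it to the canonical
   measurable structure of [R]. *)
Definition unif : set R -> \bar R := uniform_prob (@ltr01 R).

Let unif0 : unif set0 = 0%E. Proof. exact: measure0. Qed.

Let unif_ge0 (A : set R) : (0 <= unif A)%E. Proof. exact: measure_ge0. Qed.

Let unif_sigma_additive : semi_sigma_additive unif.
Proof. exact: (@measure_semi_sigma_additive _ _ _ (uniform_prob (@ltr01 R))). Qed.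

HB.instance Definition _ := isMeasure.Build _ _ _ unif unif0 unif_ge0 unif_sigma_additive.

Let unif_setT : unif setT = 1%E.
Proof. exact: (probability_setT (uniform_prob (@ltr01 R))). Qed.

HB.instance Definition _ := @Measure_isProbability.Build _ _ R unif unif_setT.

Local Notation I01 := (`[0%R, 1%R]%classic : set R).

Lemma unifE S : measurable S -> unif S = lebesgue_measure (S `&` I01).
Proof.
move=> mS; rewrite /unif/= /uniform_prob integral_uniform_pdf.
rewrite (eq_integral (cst 1%E)); last first.
  by move=> x; rewrite inE/= in_itv/= /uniform_pdf => -[_ ->]; rewrite subr0 invr1.
by rewrite integral_cst ?mul1e//; exact: measurableI.
Qed.

Lemma unif_ray (x : R) : 0 <= x <= 1 -> unif `]-oo, x]%classic = x%:E.
Proof.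
move=> /andP[x0 x1]; rewrite unifE// (_ : _ `&` _ = `[0, x]%classic); last first.
  apply/seteqP; split => y /=; rewrite !in_itv/=.
    by move=> [-> /andP[->]].
  by move=> /andP[-> yx]; rewrite yx (le_trans yx).
rewrite lebesgue_measure_itv/= lte_fin; case: ltgtP x0 => // [x0 _|<- _].
  by rewrite oppr0 adde0.
by [].
Qed.

Lemma unif_Nray (x : R) : 0 <= x <= 1 -> unif [set v | v <= x] = x%:E.
Proof. by move=> x01; rewrite -unif_ray//; congr (unif _); apply/seteqP; split => y; rewrite /= in_itv. Qed.

(** Squeezing between thresholds on either side of [x], which exist arbitrarily close by density of
    the grid. *)
Lemma prob_oray (P : probability R R) (x : R) :
  (forall q, P `]-oo, grid q]%classic = (grid q)%:E) -> P `]-oo, x[%classic = (clip x)%:E.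
Proof.
move=> Pq; have mx : measurable `]-oo, x[%classic by exact: measurable_itv.
rewrite -(fineK (fin_num_measure P _ mx)); congr (_%:E).
set p := fine _.
have p0 : 0 <= p by exact: fine_ge0.
have p1 : p <= 1 by rewrite -lee_fin /p (fineK (fin_num_measure P _ mx)) probability_le1.
have c0 : 0 <= clip x by rewrite /clip le_max lexx.
have c1 : clip x <= 1 by rewrite /clip ge_max ler01/= ge_min lexx.
apply/eqP; rewrite eq_le !leNgt; apply/andP; split; apply/negP.
  move=> /(grid_dense c0)/(_ p1)[q /andP[xq qp]].
  have : p <= grid q.
    rewrite -lee_fin -Pq /p (fineK (fin_num_measure P _ mx)).
    apply: le_measure; rewrite ?inE//= => y; rewrite /= !in_itv/= => yx.
    rewrite (le_trans (ltW yx))//; move: xq; rewrite /clip gt_max => /andP[_].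
    by rewrite gt_min => /orP[|/ltW//]; have /andP[_ q1] := grid01 q; rewrite ltNge q1.
  by rewrite leNgt qp.
move=> /(grid_dense p0)/(_ c1)[q /andP[pq qc]].
have : grid q <= p.
  rewrite -lee_fin -Pq /p (fineK (fin_num_measure P _ mx)).
  apply: le_measure; rewrite ?inE//= => y; rewrite /= !in_itv/= => yq.
  rewrite (le_lt_trans yq)//; move: qc; rewrite /clip lt_max => /orP[|].
    by have /andP[q0 _] := grid01 q; rewrite ltNge q0.
  by rewrite lt_min => /andP[].
by rewrite leNgt pq.
Qed.

Lemma prob_unif (P : probability R R) : (forall q, P `]-oo, grid q]%classic = (grid q)%:E) ->
  forall S, measurable S -> P S = unif S.
Proof.
move=> Pq S mS.
pose G := @RGenInftyO.G R.
have PG A : G A -> P A = unif A.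
  move=> [x ->]; rewrite !prob_oray// => q; apply: unif_ray; exact: grid01.
apply: (@measure_unique _ _ _ G (fun n => `]-oo, n%:R[%classic)) => //.
- exact: RGenInftyO.measurableE.
- move=> A B [x ->] [y ->]; exists (Num.min x y); apply/seteqP; split => z /=; rewrite !in_itv/=.
    by move=> [zx zy]; rewrite lt_min zx.
  by rewrite lt_min => /andP[].
- by move=> n; exists n%:R.
- apply/seteqP; split => // x _; exists (Num.truncn `|x|).+1 => //=.
  by rewrite in_itv/= (le_lt_trans (ler_norm x))// truncnS_gt.
- by move=> n; rewrite -ge0_fin_numE// fin_num_measure.
Qed.

Section grid_infimum.
Context (d : measure_display) (X : measurableType d) (E : nat -> set X).
Hypothesis mE : forall q, measurable (E q).

(** The infimum of this sequence recovers a function from its sublevel sets. It is used twice: for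
    the map [f], and for the quantile functions of the measures W (x, y). The default 1 keeps the
    infimum in [0, 1] for points that lie in no set. *)
Definition grid_seq q x : R := if x \in E q then grid q else 1.

Definition grid_inf x : R := infs (grid_seq ^~ x) 0.

Lemma grid_inf_lb x : lbound (sdrop (grid_seq ^~ x) 0) 0.
Proof.
by move=> _ [q _ <-]; rewrite /grid_seq; case: ifP => // _; case/andP: (grid01 q).
Qed.

Lemma grid_inf_le q x : grid_inf x <= grid_seq q x.
Proof.
apply: ge_inf; first by exists 0; exact: grid_inf_lb.
by exists q.
Qed.

Lemma grid_inf01 x : 0 <= grid_inf x <= 1.
Proof.
apply/andP; split.
  by apply: lb_le_inf; [exists (grid_seq 0 x); exists 0%N|exact: grid_inf_lb].
apply: le_trans (grid_inf_le 0 x) _; rewrite /grid_seq; case: ifP => // _.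
by case/andP: (grid01 0).
Qed.

Lemma grid_inf_mem q x : E q x -> grid_inf x <= grid q.
Proof. by move=> Ex; have := grid_inf_le q x; rewrite /grid_seq mem_set. Qed.

Lemma grid_inf_lt x t : grid_inf x < t -> t <= 1 -> exists2 q, grid q < t & E q x.
Proof.
move=> lt t1; have hi : has_inf (sdrop (grid_seq ^~ x) 0).
  by split; [exists (grid_seq 0 x); exists 0%N|exists 0; exact: grid_inf_lb].
have [_ [q _ <-]] := inf_lt hi.1 lt.
rewrite /grid_seq; case: ifPn => [/set_mem Ex qt|_]; first by exists q.
by rewrite ltNge t1.
Qed.

Lemma measurable_grid_inf : measurable_fun setT grid_inf.
Proof.
apply: measurable_fun_infs => [x _|q].
  by exists 0 => _ [q _ <-]; apply: (grid_inf_lb (x := x)); exists q.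
by apply: measurable_fun_ifT => //; apply: (measurable_fun_bool true);
  rewrite setTI (_ : _ @^-1` _ = E q); [exact: mE|]; apply/seteqP; split => x /=; [exact: set_mem|exact: mem_set].
Qed.

End grid_infimum.
End unit_interval_grid.

Definition to_mfun (d d' : measure_display) (X : measurableType d) (Y : measurableType d')
  (f : X -> Y) (mf : measurable_fun setT f) : {mfun X >-> Y} := mfun_Sub (mem_set mf).

(** * Passing between Latinons and their threshold data *)

Section limit_latinon.
Context (R : realType) (d : measure_display) (T : measurableType d).
Variable mu : probability T R.

Local Notation I01 := (`[0%R, 1%R]%classic : set R).
Local Notation ray q := (`]-oo, grid R q]%classic : set R).
Local Notation mu2 := (mu \x mu)%E.

Lemma fine_prob01 (d' : measure_display) (X : measurableType d') (P : probability X R)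
    (U : set X) : measurable U -> 0 <= fine (P U) <= 1.
Proof.
move=> mU; rewrite fine_ge0//= -lee_fin fineK ?probability_le1//.
exact: fin_num_measure.
Qed.

Section kernels_of_latinon.
Variable L : latinon mu.

Definition ker_of (U : set R) (z : T * T) : R := fine ((lat_W L z : probability R R) U).

Lemma ker_of01 U z : measurable U -> 0 <= ker_of U z <= 1.
Proof. exact: fine_prob01. Qed.

Lemma bmf_ker_of U : measurable U -> bmf (ker_of U).
Proof.
move=> mU; split; last first.
  by exists 1 => z; have /andP[a b] := ker_of01 z mU; rewrite ger0_norm.
apply: (measurableT_comp (@fine_measurable R setT measurableT)).
exact: (measurable_kernel (kprobability (@measurable_funPT _ _ _ _ (lat_W L))) U mU).
Qed.

Lemma lat_WI01 z U : measurable U ->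
  (lat_W L z : probability R R) U = (lat_W L z : probability R R) (U `&` I01).
Proof.
move=> mU; set P := (lat_W L z : probability R R).
have P0 : P (~` I01) = 0%E.
  by rewrite probability_setC ?lat_W01 ?subee//.
have mI : measurable (U `&` ~` I01) by apply: measurableI => //; exact: measurableC.
rewrite -{1}(setIT U) -(setUv I01) setIUr measureU//; first last.
- by rewrite setIACA setICr setI0.
- exact: measurableI.
rewrite [X in (_ + X)%E](_ : _ = 0%E) ?adde0//.
apply/eqP; rewrite eq_le measure_ge0 andbT -P0; apply: le_measure; rewrite ?inE//.
exact: measurableC.
Qed.

Lemma lat_f_law U : measurable U -> mu (lat_f L @^-1` U) = unif U.
Proof.
move=> mU; rewrite unifE// -(lat_f_preserving L); last 2 first.
- exact: measurableI.
- exact: subIsetr.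
by congr (mu _); apply/seteqP; split => x /=; [move=> ?; split => //; exact: lat_f01|case].
Qed.

Lemma preimage_lat_f01 : lat_f L @^-1` I01 = setT.
Proof. by apply/seteqP; split => // x _; exact: lat_f01. Qed.

(** The second marginal of the permuton attached to x: the set [S] is all of [0, 1], so the integral
    extends over the whole space. *)
Lemma lat_marginal1 : {ae mu, forall x, forall U, measurable U ->
  \int[mu]_y ker_of U (x, y) = fine (unif U)}.
Proof.
apply: filterS (lat_permuton1 L) => x [m [_ mperm] mE] U mU.
have mUI : measurable (U `&` I01) by exact: measurableI.
have [_] := mperm _ mUI (@subIsetr _ _ _).
rewrite (mE I01 (U `&` I01) (measurable_itv _) mUI (@subset_refl _ _) (@subIsetr _ _ _)).
rewrite preimage_lat_f01 unifE// => <-; rewrite /Rintegral; congr fine.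
apply: eq_integral => y _; rewrite /ker_of lat_WI01// fineK//.
exact: fin_num_measure.
Qed.

Lemma lat_marginal2 : {ae mu, forall y, forall U, measurable U ->
  \int[mu]_x ker_of U (x, y) = fine (unif U)}.
Proof.
apply: filterS (lat_permuton2 L) => y [m [_ mperm] mE] U mU.
have mUI : measurable (U `&` I01) by exact: measurableI.
have [_] := mperm _ mUI (@subIsetr _ _ _).
rewrite (mE I01 (U `&` I01) (measurable_itv _) mUI (@subset_refl _ _) (@subIsetr _ _ _)).
rewrite preimage_lat_f01 unifE// => <-; rewrite /Rintegral; congr fine.
apply: eq_integral => x _; rewrite /ker_of lat_WI01// fineK//.
exact: fin_num_measure.
Qed.

Definition uL q : T * T -> R := ker_of (ray q).
Definition DL q : set T := lat_f L @^-1` ray q.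

Lemma measurable_DL q : measurable (DL q).
Proof. by rewrite -[X in measurable X]setTI; exact: measurable_funPT. Qed.

End kernels_of_latinon.

Lemma int_le_ae (d' : measure_display) (X : measurableType d') (P : probability X R)
  (f g : X -> R) : bmf f -> bmf g -> {ae P, forall x, f x <= g x} ->
  \int[P]_x f x <= \int[P]_x g x.
Proof.
move=> bf bg fg.
have bm : bmf (fun x => Num.max (f x) (g x)).
  have [mf [c fc]] := bf; have [mg [c' gc]] := bg.
  split; first exact: measurable_maxr.
  exists (Num.max c c') => x; rewrite le_max; case: (leP (f x) (g x)) => _.
    by rewrite gc orbT.
  by rewrite fc.
rewrite (@int_ae _ _ _ P g (fun x => Num.max (f x) (g x)))//.
  by apply: int_le => // x; rewrite le_max lexx.
by apply: filterS fg => x fgx; rewrite max_r.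
Qed.

Lemma ae_xint (g h : T * T -> R) : bmf g -> bmf h -> {ae mu2, forall z, g z = h z} ->
  {ae mu, forall x, \int[mu]_y g (x, y) = \int[mu]_y h (x, y)}.
Proof.
move=> bg bh gh; have bgh : bmf (fun z => g z - h z) by exact: bmfB.
have b1 := bmf_int2 mu mu bgh.
suff /int_norm_eq0 H : \int[mu]_x `|\int[mu]_y (g (x, y) - h (x, y))| = 0.
  apply: filterS (H b1) => x; rewrite intB; [|exact: bmf_xsection|exact: bmf_xsection].
  by move/eqP; rewrite subr_eq0 => /eqP.
apply/eqP; rewrite eq_le int_ge0// andbT.
have b2 := bmf_int2 mu mu (bmf_norm bgh).
apply: (@le_trans _ _ (\int[mu2]_z `|g z - h z|)).
  rewrite int_prod12; last exact: bmf_norm.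
  apply: int_le => //; first exact: bmf_norm.
  by move=> x; apply: (int_norm _ (bmf_xsection x bgh)).
rewrite (@int_ae _ _ _ mu2 _ (fun=> 0)) ?int_cst//.
- exact: bmf_norm.
- exact: bmf_cst.
- by apply: filterS gh => z ->; rewrite subrr normr0.
Qed.

Lemma ae_yint (g h : T * T -> R) : bmf g -> bmf h -> {ae mu2, forall z, g z = h z} ->
  {ae mu, forall y, \int[mu]_x g (x, y) = \int[mu]_x h (x, y)}.
Proof.
move=> bg bh gh; have bgh : bmf (fun z => g z - h z) by exact: bmfB.
have b1 := bmf_int1 mu mu bgh.
suff /int_norm_eq0 H : \int[mu]_y `|\int[mu]_x (g (x, y) - h (x, y))| = 0.
  apply: filterS (H b1) => y; rewrite intB; [|exact: bmf_ysection|exact: bmf_ysection].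
  by move/eqP; rewrite subr_eq0 => /eqP.
apply/eqP; rewrite eq_le int_ge0// andbT.
have b2 := bmf_int1 mu mu (bmf_norm bgh).
apply: (@le_trans _ _ (\int[mu2]_z `|g z - h z|)).
  rewrite int_prod21; last exact: bmf_norm.
  apply: int_le => //; first exact: bmf_norm.
  by move=> y; apply: (int_norm _ (bmf_ysection y bgh)).
rewrite (@int_ae _ _ _ mu2 _ (fun=> 0)) ?int_cst//.
- exact: bmf_norm.
- exact: bmf_cst.
- by apply: filterS gh => z ->; rewrite subrr normr0.
Qed.

Section latinon_of_kernels.
Variables (w : nat -> T * T -> R) (E : nat -> set T).
Hypotheses (bw : forall q, bmf (w q)) (w01 : forall q z, 0 <= w q z <= 1).
Hypothesis mE : forall q, measurable (E q).
Hypothesis Eprob : forall a, mu (E a) = (grid R a)%:E.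
Hypothesis Emono : forall a b, grid R a <= grid R b -> mu (E a `\` E b) = 0%E.
Hypothesis wmono : forall a b, grid R a <= grid R b -> {ae mu2, forall z, w a z <= w b z}.
Hypothesis wmarg1 : forall a, {ae mu, forall x, \int[mu]_y w a (x, y) = grid R a}.
Hypothesis wmarg2 : forall a, {ae mu, forall y, \int[mu]_x w a (x, y) = grid R a}.

Let F := grid_inf R E.

Let mF : measurable_fun setT F.
Proof. exact: measurable_grid_inf. Qed.

Let mFpre U : measurable U -> measurable (F @^-1` U).
Proof. by move=> mU; rewrite -[X in measurable X]setTI; exact: mF. Qed.

Let E_sub_F q : E q `<=` F @^-1` ray q.
Proof. by move=> x Eqx; rewrite /= in_itv/=; exact: grid_inf_mem. Qed.

(** [E q] lies inside the sublevel set of [F]. Conversely, for each larger threshold b, that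
    sublevel set lies in [E b] up to the countably many null sets [E a] minus [E b] with a at most
    b, so its mass does not exceed b; density of the grid concludes. *)
Let F_law q : mu (F @^-1` ray q) = (grid R q)%:E.
Proof.
have mFq : measurable (F @^-1` ray q) by exact: mFpre.
have p01 : 0 <= fine (mu (F @^-1` ray q)) <= 1.
  by rewrite fine_ge0//= -lee_fin fineK ?probability_le1//; exact: fin_num_measure.
rewrite -(fineK (fin_num_measure mu _ mFq)); congr (_%:E); set p := fine _ in p01 *.
have /andP[g0 g1] := grid01 R q; have /andP[p0 p1] := p01.
apply/eqP; rewrite eq_le; apply/andP; split; last first.
  rewrite -lee_fin -Eprob /p (fineK (fin_num_measure mu _ mFq)).
  by apply: le_measure; rewrite ?inE//; exact: E_sub_F.
rewrite leNgt; apply/negP => /(grid_dense g0)/(_ p1)[b /andP[qb bp]].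
pose N a := if grid R a <= grid R b then E a `\` E b else set0.
have mN a : measurable (N a) by rewrite /N; case: ifP => // _; exact: measurableD.
have sub : F @^-1` ray q `<=` E b `|` \bigcup_a N a.
  move=> x /=; rewrite in_itv/= => Fx.
  have [] := @grid_inf_lt R _ _ E x (grid R b) (le_lt_trans Fx qb).
    by case/andP: (grid01 R b).
  move=> a ab Eax; have [Ebx|nEbx] := pselect (E b x); [by left|right].
  by exists a => //; rewrite /N (ltW ab).
have : p <= grid R b.
  rewrite -lee_fin /p (fineK (fin_num_measure mu _ mFq)).
  have mU : measurable (\bigcup_a N a) by exact: bigcupT_measurable.
  have U0 : mu (\bigcup_a N a) = 0%E.
    apply/eqP; rewrite eq_le measure_ge0 andbT.
    apply: le_trans (measure_sigma_subadditive _ _ mU (@subset_refl _ _)) _ => //.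
    rewrite eseries0// => a _ _; rewrite /N; case: ifP => [/Emono //|_].
    exact: measure0.
  rewrite -Eprob -[leRHS]adde0 -U0; apply: le_trans; last exact: measureU2.
  by apply: le_measure; rewrite ?inE//; exact: measurableU.
by rewrite leNgt bp.
Qed.

Let F_E_ae q : {ae mu, forall x, E q x <-> (F @^-1` ray q) x}.
Proof.
have mD : measurable (F @^-1` ray q `\` E q) by apply: measurableD => //; exact: mFpre.
exists (F @^-1` ray q `\` E q); split => //.
  have mFq : measurable (F @^-1` ray q) by exact: mFpre.
  have Ffin : (mu (F @^-1` ray q) < +oo)%E by rewrite F_law ltry.
  have FE : F @^-1` ray q `&` E q = E q by rewrite setIidr//; exact: E_sub_F.
  have := measureD mFq (mE q) Ffin; rewrite FE => ->.
  transitivity ((grid R q)%:E - (grid R q)%:E)%E; last by rewrite subee.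
  by congr (_ - _)%E; [exact: F_law|exact: Eprob].
move=> x /= H; split; last by move=> Ex; apply: H; split => // _; exact: E_sub_F.
by apply: contrapT => nF; apply: H; split => [/E_sub_F|].
Qed.

(** The region below the graph of [w q]. The infimum [Q (z, v)] over these sets is a generalized
    inverse of the threshold function of z, so with v uniform its law is the sought W (z). *)
Let Ew q : set ((T * T) * R) := [set zv | zv.2 <= w q zv.1].

Let mEw q : measurable (Ew q).
Proof.
rewrite -[X in measurable X]setTI; apply: (@measurable_fun_ler _ _ R setT
  (fun zv : (T * T) * R => zv.2) (fun zv => w q zv.1) _ _ measurableT [set true]) => //.
  exact: measurable_snd.
by case: (bw q) => mw _; apply: measurableT_comp mw measurable_fst.
Qed.

Let Q := grid_inf R Ew.

Let mQ : measurable_fun setT Q.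
Proof. exact: measurable_grid_inf. Qed.

Let mQz z : measurable_fun setT (fun v => Q (z, v)).
Proof. by apply: (measurableT_comp mQ); exact: pair1_measurable. Qed.

Definition limW z : probability R R := distribution (unif (R:=R)) (to_mfun (mQz z)).

Lemma limWE z U : limW z U = unif [set v | U (Q (z, v))].
Proof. by []. Qed.

Lemma limW01 z : limW z I01 = 1%E.
Proof.
rewrite limWE (_ : [set _ | _] = setT) ?probability_setT//.
by apply/seteqP; split => // v _; rewrite /= in_itv/=; exact: grid_inf01.
Qed.

Let mQU U z : measurable U -> measurable [set v | U (Q (z, v))].
Proof. by move=> mU; rewrite -[X in measurable X]setTI; exact: mQz. Qed.

Lemma measurable_limW_eval U : measurable U -> measurable_fun setT (fun z => limW z U).
Proof.
move=> mU; have mA : measurable (Q @^-1` U).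
  by rewrite -[X in measurable X]setTI; exact: mQ.
have := measurable_fun_xsection (unif (R:=R)) mA; congr (measurable_fun _ _).
apply/funext => z; rewrite limWE; congr (unif _).
by apply/seteqP; split => v; rewrite /xsection /= ?inE.
Qed.

Lemma measurable_limW : measurable_fun setT (limW : T * T -> pprobability R R).
Proof.
apply: (measurability (@pset _ _ _ : set (set (pprobability _ R)))) => //.
move=> _ -[_ [r r01] [Ys mYs <-]] <-; apply: emeasurable_fun_infty_o => //=.
exact: measurable_limW_eval.
Qed.

Let fW q z := fine (limW z (ray q)).

Let bfW q : bmf (fW q).
Proof.
split; last by exists 1 => z; have /andP[a b] := fine_prob01 (limW z) (measurable_itv `]-oo, grid R q]); rewrite ger0_norm.
apply: (measurableT_comp (@fine_measurable R setT measurableT)).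
exact: measurable_limW_eval.
Qed.

Let measurable_ler (c : R) : measurable [set v : R | v <= c].
Proof.
rewrite (_ : [set v | v <= c] = `]-oo, c]%classic); first exact: measurable_itv.
by apply/seteqP; split => v; rewrite /= in_itv.
Qed.

Let w_le_fW q z : w q z <= fW q z.
Proof.
rewrite -lee_fin /fW fineK; last exact: fin_num_measure.
rewrite -unif_Nray// limWE; apply: le_measure; rewrite ?inE//.
- by apply: mQU.
- by move=> v /= vw; rewrite in_itv/=; exact: grid_inf_mem.
Qed.

Let fW_le_w q q' : grid R q < grid R q' -> {ae mu2, forall z, fW q z <= w q' z}.
Proof.
move=> qq'.
have H a : {ae mu2, forall z, grid R a <= grid R q' -> w a z <= w q' z}.
  have [aq'|aq'] := boolP (grid R a <= grid R q'); last exact: aeW.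
  by apply: filterS (wmono aq') => z + _.
have /ae_foralln : forall a, {ae mu2, forall z, grid R a <= grid R q' -> w a z <= w q' z} := H.
apply: filterS => z Hz.
rewrite -lee_fin /fW fineK; last exact: fin_num_measure.
rewrite -unif_Nray// limWE; apply: le_measure; rewrite ?inE//.
- by apply: mQU.
- move=> v /=; rewrite in_itv/= => Qv.
  have [] := @grid_inf_lt R _ _ Ew (z, v) (grid R q') (le_lt_trans Qv qq').
    by case/andP: (grid01 R q').
  by move=> a aq' va; apply: (le_trans va); apply: Hz; exact: ltW.
Qed.

Let int_w q : \int[mu2]_z w q z = grid R q.
Proof.
rewrite int_prod12// -[RHS](int_cst mu); apply: int_ae => //.
- exact: (bmf_int2 mu mu (bw q)).
- exact: bmf_cst.
Qed.

(** [fW q] dominates [w q] everywhere and is at most [w q'] almost everywhere for each larger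
    threshold. As [w q'] integrates to its threshold, no threshold fits between the integrals of
    [w q] and [fW q], so these agree. Right continuity in the threshold is thus forced by the
    degrees. *)
Let fW_w_ae q : {ae mu2, forall z, fW q z = w q z}.
Proof.
have bd : bmf (fun z => fW q z - w q z) by exact: bmfB.
suff /int_norm_eq0 : \int[mu2]_z `|fW q z - w q z| = 0.
  by move=> /(_ bd); apply: filterS => z /eqP; rewrite subr_eq0 => /eqP.
rewrite (_ : (fun z => `|_|) = (fun z => fW q z - w q z)); last first.
  by apply/funext => z; rewrite ger0_norm// subr_ge0 w_le_fW.
apply/eqP; rewrite intB// int_w subr_eq0 eq_le; apply/andP; split; last first.
  by rewrite -int_w; apply: int_le => // z; exact: w_le_fW.
rewrite leNgt; apply/negP => /grid_dense[||q' /andP[qq' q'W]].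
- by case/andP: (grid01 R q).
- by apply: int_le_cst => // z; have /andP[] := fine_prob01 (limW z) (measurable_itv `]-oo, grid R q]).
have : \int[mu2]_z fW q z <= grid R q'.
  by rewrite -int_w; apply: int_le_ae => //; exact: fW_le_w.
by rewrite leNgt q'W.
Qed.

Let limW_marginal1 : {ae mu, forall x, forall q, \int[mu]_y fW q (x, y) = grid R q}.
Proof.
apply: ae_foralln => q.
apply: filterS2 (ae_xint (bfW q) (bw q) (fW_w_ae q)) (wmarg1 q) => x.
by move=> -> ->.
Qed.

Let limW_marginal2 : {ae mu, forall y, forall q, \int[mu]_x fW q (x, y) = grid R q}.
Proof.
apply: ae_foralln => q.
apply: filterS2 (ae_yint (bfW q) (bw q) (fW_w_ae q)) (wmarg2 q) => y.
by move=> -> ->.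
Qed.

Let F_unif U : measurable U -> mu (F @^-1` U) = unif U.
Proof.
by move=> mU; rewrite -(@prob_unif R (distribution mu (to_mfun mF))).
Qed.

(** The permuton is the joint law of [F y] and [Q (phi y, v)], with y of law [mu] and v uniform and
    independent. The map [phi] fixes either the first or the second variable, which covers both
    conditions. *)
Let section_permuton (phi : T -> T * T) : measurable_fun setT phi ->
  (forall q, \int[mu]_y fW q (phi y) = grid R q) ->
  exists2 m : probability (R * R)%type R, is_permuton m &
    forall S U : set R, measurable S -> measurable U ->
      S `<=` I01 -> U `<=` I01 ->
      m (S `*` U) = (\int[mu]_(y in F @^-1` S) limW (phi y) U)%E.
Proof.
move=> mphi Hphi.
have mq : measurable_fun setT (fun yv : T * R => Q (phi yv.1, yv.2)).
  apply: (measurableT_comp mQ); apply: measurable_fun_pair => //.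
  by apply: measurableT_comp mphi measurable_fst.
have mpsi : measurable_fun setT (fun yv : T * R => (F yv.1, Q (phi yv.1, yv.2))).
  by apply: measurable_fun_pair => //; apply: measurableT_comp mF measurable_fst.
pose m : probability (R * R)%type R := distribution (mu \x unif (R:=R))%E (to_mfun mpsi).
have mE' S U : measurable S -> measurable U ->
    m (S `*` U) = (\int[mu]_(y in F @^-1` S) limW (phi y) U)%E.
  move=> mS mU; rewrite /m /distribution /pushforward /= /product_measure1 /=.
  rewrite [RHS]integral_mkcond; apply: eq_integral => y _; rewrite patchE.
  case: ifPn => [/set_mem FS|/negP FS].
    congr (unif _); apply/seteqP; split => v; rewrite /xsection /= ?inE/=.
      by case.
    by move=> ?; split.
  rewrite (_ : xsection _ _ = set0) ?measure0//.
  apply/seteqP; split => v //; rewrite /xsection /= inE/= => -[FS' _].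
  by apply: FS; rewrite inE.
exists m; last by move=> S U mS mU _ _; exact: mE'.
have F01 : F @^-1` I01 = setT.
  by apply/seteqP; split => // x _; rewrite /= in_itv/=; exact: grid_inf01.
have mray V : measurable V -> (\int[mu]_y limW (phi y) V)%E = unif V.
  pose P' : probability R R := distribution (mu \x unif (R:=R))%E (to_mfun mq).
  have P'E A : measurable A -> P' A = (\int[mu]_y limW (phi y) A)%E.
    move=> mA; rewrite /P' /distribution /pushforward /= /product_measure1 /=.
    apply: eq_integral => y _; congr (unif _).
    by apply/seteqP; split => v; rewrite /xsection /= ?inE.
  move=> mV; rewrite -P'E//; apply: prob_unif => // q; rewrite P'E//.
  transitivity ((\int[mu]_y fW q (phi y))%:E); last by rewrite Hphi.
  rewrite -EFin_int.
    by apply: eq_integral => y _; rewrite /fW fineK//; exact: fin_num_measure.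
  exact: (bmf_comp (bfW q) mphi).
split.
  rewrite mE'// F01 (eq_integral (cst 1%E)); last by move=> y _; rewrite limW01.
  by rewrite (integral_cst mu measurableT) mul1e [RHS](esym (probability_setT mu)).
move=> S mS SI; split.
  rewrite mE'//.
  rewrite (eq_integral (cst 1%E)); last by move=> y _; rewrite limW01.
  rewrite integral_cst ?mul1e; last exact: mFpre.
  by rewrite [LHS](F_unif mS) unifE// setIidl.
by rewrite mE'// F01 mray// unifE// setIidl.
Qed.

Lemma exists_latinon : exists L : latinon mu,
  (forall q, {ae mu2, forall z, uL L q z = w q z}) /\
  (forall q, {ae mu, forall x, E q x <-> DL L q x}).
Proof.
have perm1 : {ae mu, forall x, exists2 m : probability (R * R)%type R,
    is_permuton m &
    forall S U : set R, measurable S -> measurable U ->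
      S `<=` I01 -> U `<=` I01 ->
      m (S `*` U) = (\int[mu]_(y in F @^-1` S) limW (x, y) U)%E}.
  apply: filterS limW_marginal1 => x Hx.
  by apply: section_permuton => //; exact: pair1_measurable.
have perm2 : {ae mu, forall y, exists2 m : probability (R * R)%type R,
    is_permuton m &
    forall S U : set R, measurable S -> measurable U ->
      S `<=` I01 -> U `<=` I01 ->
      m (S `*` U) = (\int[mu]_(x in F @^-1` S) limW (x, y) U)%E}.
  apply: filterS limW_marginal2 => y Hy.
  by apply: (@section_permuton (fun x => (x, y))) => //; exact: pair2_measurable.
pose W : {mfun (T * T)%type >-> pprobability R R} := to_mfun measurable_limW.
pose Fm : {mfun T >-> R} := to_mfun mF.
have F01 x : I01 (Fm x) by rewrite /= in_itv/=; exact: grid_inf01.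
have Fpres S : measurable S -> S `<=` I01 -> mu (Fm @^-1` S) = lebesgue_measure S.
  by move=> mS SI; rewrite [LHS]F_unif// unifE// setIidl.
exists (@Latinon R d T mu W Fm limW01 F01 Fpres perm1 perm2); split => q.
  exact: fW_w_ae.
exact: F_E_ae.
Qed.

End latinon_of_kernels.
End limit_latinon.

(** * Degrees as densities of stars *)

Section stars.
Context (R : realType) (d : measure_display) (T : measurableType d).
Variable mu : probability T R.

(** Given the centre x, the leaves are independent and each contributes the degree of x. *)
Lemma hom_star (u : T * T -> R) n : bmf u ->
  hom mu (fun (_ : 'I_1) _ => 1) (fun (_ : 'I_n) _ => 1) (fun _ => u) =
  \int[mu]_x (\int[mu]_y u (x, y)) ^+ n.
Proof.
move=> bu; rewrite /hom.
have bP := bmf_pattern_fun (fun _ : 'I_1 => bmf_cst T 1) (fun _ : 'I_n => bmf_cst T 1) (fun _ => bu).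
rewrite int_prod12//.
rewrite -(int_tnth mu (n := 1) ord0 (h := fun x => (\int[mu]_y u (x, y)) ^+ n)); last first.
  by apply: bmfX; exact: bmf_int2.
apply: eq_Rintegral => t _.
transitivity (\int[tpow mu n]_y \prod_j u (tnth t ord0, tnth y j)).
  apply: eq_Rintegral => y _; rewrite /pattern_fun 2?big1// !mul1r.
  by rewrite -(pair_bigA _ (fun i j => u (tnth t i, tnth y j))) big_ord1.
rewrite (int_tuple_prod (fun=> mu) (h := fun _ y => u (tnth t ord0, y))).
  by rewrite prodr_const card_ord.
by move=> _; exact: bmf_xsection.
Qed.

Lemma hom_costar (u : T * T -> R) n : bmf u ->
  hom mu (fun (_ : 'I_n) _ => 1) (fun (_ : 'I_1) _ => 1) (fun _ => u) =
  \int[mu]_y (\int[mu]_x u (x, y)) ^+ n.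
Proof.
move=> bu; rewrite /hom.
have bP := bmf_pattern_fun (fun _ : 'I_n => bmf_cst T 1) (fun _ : 'I_1 => bmf_cst T 1) (fun _ => bu).
rewrite int_prod21//.
rewrite -(int_tnth mu (n := 1) ord0 (h := fun y => (\int[mu]_x u (x, y)) ^+ n)); last first.
  by apply: bmfX; exact: bmf_int1.
apply: eq_Rintegral => t _.
transitivity (\int[tpow mu n]_x \prod_i u (tnth x i, tnth t ord0)).
  apply: eq_Rintegral => x _; rewrite /pattern_fun 2?big1// !mul1r.
  rewrite -(pair_bigA _ (fun i j => u (tnth x i, tnth t j))).
  by apply: eq_bigr => i _; rewrite big_ord1.
rewrite (int_tuple_prod (fun=> mu) (h := fun _ x => u (x, tnth t ord0))).
  by rewrite prodr_const card_ord.
by move=> _; exact: bmf_ysection.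
Qed.

Lemma variance0 (phi : T -> R) (r : R) : bmf phi ->
  \int[mu]_x phi x = r -> \int[mu]_x phi x ^+ 2 = r ^+ 2 -> {ae mu, forall x, phi x = r}.
Proof.
move=> bphi m1 m2; have b2 : bmf (fun x => (phi x - r) ^+ 2).
  by apply: bmfX; apply: bmfB => //; exact: bmf_cst.
suff /int_norm_eq0 H : \int[mu]_x `|(phi x - r) ^+ 2| = 0.
  by apply: filterS (H b2) => x /eqP; rewrite sqrf_eq0 subr_eq0 => /eqP.
under eq_Rintegral do rewrite ger0_norm ?sqr_ge0//.
rewrite (_ : (fun x => _) = (fun x => phi x ^+ 2 - (r *+ 2 * phi x - r ^+ 2))); last first.
  by apply/funext => x; ring.
rewrite intB; [|exact: bmfX|by apply: bmfB; [exact: bmfZ|exact: bmf_cst]].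
rewrite intB; [|exact: bmfZ|exact: bmf_cst].
by rewrite intZl// int_cst m1 m2; ring.
Qed.

(** Kernels that agree almost everywhere are at cut distance 0, so the counting lemma applies with
    zero errors. *)
Lemma hom_kernels k l (a : 'I_k -> T -> R) (b : 'I_l -> T -> R) v v' :
  (forall i, ub (a i)) -> (forall j, ub (b j)) ->
  (forall e, ub (v e)) -> (forall e, ub (v' e)) ->
  (forall e, {ae (mu \x mu)%E, forall z, v e z = v' e z}) ->
  hom mu a b v = hom mu a b v'.
Proof.
move=> ua ub' uv uv' vv'; apply/eqP; rewrite -subr_eq0 -normr_le0.
have := @counting _ _ _ mu k l a b v v' (fun=> 0) ua ub' uv uv'.
rewrite big1// => -> // e.
have bvv : bmf (fun z => v e z - v' e z) by apply: bmfB; exact: ub_bmf.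
rewrite (_ : 0 = \int[(mu \x mu)%E]_z `|v e z - v' e z|); first exact: cut_le_L1.
rewrite -[LHS](int_cst (mu \x mu)%E); apply: int_ae; first exact: bmf_cst.
  exact: bmf_norm.
by apply: filterS (vv' e) => z ->; rewrite subrr normr0.
Qed.

End stars.

(** * Compactness for Latinons *)

Section limits_of_latinons.
Context (R : realType).

Lemma uL_mono (d : measure_display) (T : measurableType d) (mu : probability T R)
    (L : latinon mu) q q' z : grid R q <= grid R q' -> uL L q z <= uL L q' z.
Proof.
move=> qq'; rewrite /uL /ker_of -lee_fin !fineK; [|exact: fin_num_measure|exact: fin_num_measure].
apply: le_measure; rewrite ?inE// => x; rewrite /= !in_itv/= => xq.
exact: le_trans qq'.
Qed.

Lemma bmf_uL (d : measure_display) (T : measurableType d) (mu : probability T R)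
    (L : latinon mu) q : bmf (uL L q).
Proof. exact: bmf_ker_of. Qed.

Lemma uL01 (d : measure_display) (T : measurableType d) (mu : probability T R)
    (L : latinon mu) q z : 0 <= uL L q z <= 1.
Proof. exact: ker_of01. Qed.

Lemma DL_mono (d : measure_display) (T : measurableType d) (mu : probability T R)
    (L : latinon mu) q q' : grid R q <= grid R q' -> DL L q `<=` DL L q'.
Proof. by move=> qq' x; rewrite /DL /= !in_itv/= => xq; exact: le_trans qq'. Qed.

Lemma DL_prob (d : measure_display) (T : measurableType d) (mu : probability T R)
    (L : latinon mu) q : mu (DL L q) = (grid R q)%:E.
Proof. by rewrite lat_f_law// unif_ray// grid01. Qed.

(** The threshold 1, which every value of f satisfies: it expresses an undecorated vertex as a
    decorated one. *)
Let top : nat := pickle (1 : rat).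

Let grid_top : grid R top = 1.
Proof. by rewrite grid_pickle ?rmorph1// ler01 lexx. Qed.

Lemma latinon_compactness (d : measure_display) (T : measurableType d) (mu : probability T R)
    (dn : nat -> measure_display) (Tn : forall n, measurableType (dn n))
    (mun : forall n, probability (Tn n) R) (L : forall n, latinon (mun n)) :
  atomless mu ->
  exists (s : nat -> nat) (Lim : latinon mu), {homo s : i j / (i < j)%N} /\
    forall (k l : nat) (a a' : 'I_k -> option nat) (b b' : 'I_l -> option nat)
      (v v' : 'I_k * 'I_l -> option nat),
      (fun n => opt_hom (mun (s n)) (uL (L (s n))) (DL (L (s n))) a a' b b' v v') @ \oo -->
      opt_hom mu (uL Lim) (DL Lim) a a' b b' v v'.
Proof.
move=> mu_atomless.
have [s [w [E [s_incr [bw [w01 mE]] wm EI homE]]]] :=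
  compactness mu_atomless mun (fun n q => bmf_uL (L n) q) (fun n q z => uL01 (L n) q z)
    (fun n q => measurable_DL (L n) q).
have EIab a b : grid R a <= grid R b -> fine (mu (E a `&` E b)) = grid R a.
  move=> ab; apply: (cvg_eq (EI a b) (cvg_cst (grid R a))) => n.
  by rewrite setIidl ?DL_prob//; exact: DL_mono.
have mEI a b : measurable (E a `&` E b) by exact: measurableI.
have Eprob a : mu (E a) = (grid R a)%:E.
  by rewrite -(EIab a a)// setIid fineK//; exact: fin_num_measure.
have Emono a b : grid R a <= grid R b -> mu (E a `\` E b) = 0%E.
  move=> ab; have Ea : (mu (E a) < +oo)%E by rewrite Eprob ltry.
  have := measureD (mE a) (mE b) Ea => ->.
  transitivity ((grid R a)%:E - (grid R a)%:E)%E; last by rewrite subee.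
  congr (_ - _)%E; first exact: Eprob.
  by rewrite -(EIab a b ab) fineK//; exact: fin_num_measure.
have wmono a b : grid R a <= grid R b -> {ae (mu \x mu)%E, forall z, w a z <= w b z}.
  by move=> ab; apply: wm => n z; exact: uL_mono.
have topE : {ae mu, forall x, opt_ind R E (Some top) x - 0 = 1}.
  exists (~` E top); split; first exact: measurableC.
    by rewrite probability_setC// Eprob grid_top subee.
  move=> x /= ne Ex; apply: ne; rewrite indicE mem_set// subr0//.
have ub1 : ub (fun _ : T => 1 : R) by split => // x; rewrite normr1.
have ubE : ub (fun x => opt_ind R E (Some top) x - 0).
  split; first by apply: measurable_funB => //; case: (bmf_indic R (mE top)).
  by move=> x; rewrite subr0 ger0_norm; have /andP[] := opt_ind01 R E (Some top) x.
have ubw q : ub (w q).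
  by split; [case: (bw q)|move=> z; have /andP[w0 w1] := w01 q z; rewrite ger0_norm].
(* Two versions of one reduction: for a Latinon the set of index [top] is the whole space, whereas
   in the limit [E top] only has full measure, which [opt_homE] handles through [hom_weights]. *)
have opt_hom1 (d' : measure_display) (T' : measurableType d') (mu' : probability T' R) u D k l q :
    (forall x, D top x) ->
    opt_hom mu' u D (fun _ : 'I_k => Some top) (fun=> None) (fun _ : 'I_l => Some top) (fun=> None)
      (fun=> Some q) (fun=> None) = hom mu' (fun (_ : 'I_k) _ => 1) (fun (_ : 'I_l) _ => 1) (fun _ => u q).
  move=> Dt; rewrite /opt_hom; congr (hom _ _ _ _).
  - by apply/funext => i; apply/funext => x; rewrite /= indicE mem_set// subr0.
  - by apply/funext => i; apply/funext => x; rewrite /= indicE mem_set// subr0.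
  - by apply/funext => i; apply/funext => x; rewrite /= subr0.
have opt_homE k l q :
    opt_hom mu w E (fun _ : 'I_k => Some top) (fun=> None) (fun _ : 'I_l => Some top) (fun=> None)
      (fun=> Some q) (fun=> None) = hom mu (fun (_ : 'I_k) _ => 1) (fun (_ : 'I_l) _ => 1) (fun _ => w q).
  transitivity (hom mu (fun (_ : 'I_k) x => opt_ind R E (Some top) x - 0)
      (fun (_ : 'I_l) x => opt_ind R E (Some top) x - 0) (fun _ => w q)).
    by congr (hom _ _ _ _); apply/funext => e; apply/funext => z; rewrite /= subr0.
  exact: hom_weights.
have Dtop n x : DL (L n) top x.
  by rewrite /DL /= in_itv/= grid_top; have := lat_f01 (L n) x; rewrite /= in_itv/= => /andP[].
(* Along the sequence the degrees are constant almost everywhere, so their moments are the powers of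
   the threshold; the cases 1 and 2 are fed to [variance0]. *)
have star m q : \int[mu]_x (\int[mu]_y w q (x, y)) ^+ m = grid R q ^+ m.
  rewrite -hom_star// -opt_homE.
  apply: (cvg_eq (homE _ _ _ _ _ _ _ _) (cvg_cst (grid R q ^+ m))) => n.
  rewrite opt_hom1// hom_star; last exact: bmf_uL.
  rewrite -[RHS](int_cst (mun (s n))); apply: int_ae.
  - exact: (bmfX m (bmf_int2 (mun (s n)) (mun (s n)) (bmf_uL (L (s n)) q))).
  - exact: bmf_cst.
  - apply: filterS (lat_marginal1 (L (s n))) => x Hx.
    by rewrite [X in X ^+ _]Hx// unif_ray// grid01.
have costar m q : \int[mu]_y (\int[mu]_x w q (x, y)) ^+ m = grid R q ^+ m.
  rewrite -hom_costar// -opt_homE.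
  apply: (cvg_eq (homE _ _ _ _ _ _ _ _) (cvg_cst (grid R q ^+ m))) => n.
  rewrite opt_hom1// hom_costar; last exact: bmf_uL.
  rewrite -[RHS](int_cst (mun (s n))); apply: int_ae.
  - exact: (bmfX m (bmf_int1 (mun (s n)) (mun (s n)) (bmf_uL (L (s n)) q))).
  - exact: bmf_cst.
  - apply: filterS (lat_marginal2 (L (s n))) => x Hx.
    by rewrite [X in X ^+ _]Hx// unif_ray// grid01.
have wmarg1 q : {ae mu, forall x, \int[mu]_y w q (x, y) = grid R q}.
  apply: variance0; [exact: bmf_int2|exact: (star 1%N)|exact: (star 2%N)].
have wmarg2 q : {ae mu, forall y, \int[mu]_x w q (x, y) = grid R q}.
  apply: variance0; [exact: bmf_int1|exact: (costar 1%N)|exact: (costar 2%N)].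
have [Lim [uw DE]] := exists_latinon bw w01 mE Eprob Emono wmono wmarg1 wmarg2.
exists s, Lim; split => // k l a a' b b' v v'.
have ind_ae o : {ae mu, forall x, opt_ind R E o x = opt_ind R (DL Lim) o x}.
  case: o => [q|]; last exact: aeW.
  apply: filterS (DE q) => x Ex; rewrite /= !indicE; congr (_%:R).
  by congr nat_of_bool; apply/idP/idP; rewrite !inE; apply Ex.
have ker_ae o : {ae (mu \x mu)%E, forall z, opt_kernel w o z = opt_kernel (uL Lim) o z}.
  by case: o => [q|]; [apply: filterS (uw q) => z|exact: aeW].
(* The limits are known for the data [w], [E], which the reconstructed Latinon reproduces almost
   everywhere. *)
suff -> : opt_hom mu (uL Lim) (DL Lim) a a' b b' v v' = opt_hom mu w E a a' b b' v v' by exact: homE.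
have mD q := measurable_DL Lim q; have bu q := bmf_uL Lim q; have u01 q z := uL01 Lim q z.
transitivity (opt_hom mu w (DL Lim) a a' b b' v v').
  apply: hom_kernels => [i|j|e|e|e]; [exact: ub_opt_ind|exact: ub_opt_ind|exact: ub_opt_kernel|exact: ub_opt_kernel|].
  by apply: filterS2 (ker_ae (v e)) (ker_ae (v' e)) => z -> ->.
apply: hom_weights => [i|j|i|j|e|i|j];
  [exact: ub_opt_ind|exact: ub_opt_ind|exact: ub_opt_ind|exact: ub_opt_ind|exact: ub_opt_kernel| |].
  by apply: filterS2 (ind_ae (a i)) (ind_ae (a' i)) => z -> ->.
by apply: filterS2 (ind_ae (b j)) (ind_ae (b' j)) => z -> ->.
Qed.

End limits_of_latinons.

(** * Densities as limits of box sums *)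

Section cells.
Context (R : realType).
Implicit Types (N c : nat) (v : R).

Definition oray (o : option nat) : set R :=
  if o is Some q then `]-oo, grid R q]%classic else set0.

Definition cell_up N c : option nat := Some (pickle (c.+1%:R / N%:R : rat)).

(** The first cell has no lower threshold because ]0, 1/N] would miss the value 0. *)
Definition cell_lo N c : option nat :=
  if c is 0 then None else Some (pickle (c%:R / N%:R : rat)).

(* The interval ]c / N, (c + 1) / N], except that the first one is unbounded below. *)
Definition cell N c : set R := oray (cell_up N c) `\` oray (cell_lo N c).

Lemma measurable_oray o : measurable (oray o).
Proof. by case: o => [q|]; [exact: measurable_itv|exact: measurable0]. Qed.

Lemma measurable_cell N c : measurable (cell N c).
Proof. by apply: measurableD; exact: measurable_oray. Qed.

Lemma cellP N c v : (c < N)%N ->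
  cell N c v <-> v <= c.+1%:R / N%:R /\ (c = 0%N \/ c%:R / N%:R < v).
Proof.
move=> cN; have N0 : (0 < N)%N by exact: leq_ltn_trans cN.
rewrite /cell /cell_up /oray /= in_itv/= grid_frac//; case: c cN => [|c] cN /=.
  by split => -[-> _]; split => //; left.
rewrite in_itv/= grid_frac//; last exact: ltnW.
split => [[-> /negP]|[-> [//|lt]]]; first by rewrite -ltNge => lt; split => //; right.
by split => //; apply/negP; rewrite -ltNge.
Qed.

Lemma cell_exists N v : (0 < N)%N -> v <= 1 -> exists c : 'I_N, cell N c v.
Proof.
move=> N0 v1.
have ex : exists c, v <= c.+1%:R / N%:R.
  by exists N.-1; rewrite prednK// divff// pnatr_eq0 -lt0n.
case: (ex_minnP ex) => c vc cmin.
have cN : (c < N)%N.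
  by rewrite -(prednK N0) ltnS; apply: cmin; rewrite prednK// divff// pnatr_eq0 -lt0n.
exists (Ordinal cN); apply/cellP => //=; split => //.
case: c {cN vc} cmin => [|c] cmin; [by left|right].
by rewrite ltNge; apply/negP => /cmin; rewrite ltnn.
Qed.

Lemma cell_lt N c c' v v' : (c' < N)%N -> (c < c')%N -> cell N c v -> cell N c' v' -> v < v'.
Proof.
move=> c'N cc' /(cellP _ (ltn_trans cc' c'N))[vc _] /(cellP _ c'N)[_ []].
  by move=> c0; rewrite c0 in cc'.
apply: le_lt_trans; apply: le_trans vc _.
by rewrite ler_wpM2r ?invr_ge0// ler_nat.
Qed.

Lemma cell_inj N c c' v : (c < N)%N -> (c' < N)%N -> cell N c v -> cell N c' v -> c = c'.
Proof.
move=> cN c'N vc vc'; case: (ltngtP c c') => // lt.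
  by have := cell_lt c'N lt vc vc'; rewrite ltxx.
by have := cell_lt cN lt vc' vc; rewrite ltxx.
Qed.

(** Nonnegativity of [v'] makes up for the first cell being unbounded below. *)
Lemma cell_width N c v v' : (c < N)%N -> 0 <= v' -> cell N c v -> cell N c v' ->
  v <= v' + N%:R^-1.
Proof.
move=> cN v'0 /(cellP _ cN)[vc _] /(cellP _ cN)[_ ge]; apply: le_trans vc _.
rewrite -addn1 natrD mulrDl mul1r lerD2r; case: ge => [->|/ltW//].
by rewrite mul0r.
Qed.

Lemma oray_lo_up N c : (c < N)%N -> oray (cell_lo N c) `<=` oray (cell_up N c).
Proof.
move=> cN; have N0 : (0 < N)%N by exact: leq_ltn_trans cN.
case: c cN => [|c] cN v //=; rewrite !in_itv/= !grid_frac//; last exact: ltnW.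
by move=> vc; apply: le_trans vc _; rewrite ler_wpM2r ?invr_ge0// ler_nat.
Qed.

Lemma prob_cell (P : probability R R) N c : (c < N)%N ->
  fine (P (cell N c)) = fine (P (oray (cell_up N c))) - fine (P (oray (cell_lo N c))).
Proof.
move=> cN; have m1 := measurable_oray (cell_up N c); have m2 := measurable_oray (cell_lo N c).
have fin1 : (P (oray (cell_up N c)) < +oo)%E by rewrite -ge0_fin_numE// fin_num_measure.
rewrite /cell (measureD m1 m2 fin1) setIidr; last exact: oray_lo_up.
by rewrite fineB// fin_num_measure.
Qed.

Lemma unif_cell N c : (c < N)%N -> fine (unif (R:=R) (cell N c)) = N%:R^-1.
Proof.
move=> cN; have N0 : (0 < N)%N by exact: leq_ltn_trans cN.
rewrite prob_cell// /oray /= unif_ray ?grid01// grid_frac//=.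
case: c cN => [|c] cN; first by rewrite measure0/= subr0 mul1r.
rewrite /= unif_ray ?grid01// grid_frac//=; last exact: ltnW.
by rewrite -mulrBl -natrB// subSnn mul1r.
Qed.

Lemma sum_cell (P : probability R R) N : \sum_(c < N) fine (P (cell N c)) <= 1.
Proof.
have mc (c : 'I_N) : measurable (cell N c) by exact: measurable_cell.
rewrite sum_fine; last by move=> c _; exact: fin_num_measure.
rewrite -(@measure_bigsetU_ord _ _ _ P N xpredT (fun c : 'I_N => cell N c))//.
  have mU : measurable (\big[setU/set0]_(c < N) cell N c) by exact: bigsetU_measurable.
  by rewrite -lee_fin (fineK (fin_num_measure P _ mU)); exact: probability_le1.
by move=> c c' _ _ [v [vc vc']]; apply/val_inj; exact: (cell_inj _ _ vc vc').
Qed.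

Section ordered_values.
Context (I : finType) (r : I -> nat) (N : nat).
Implicit Types (g : I -> R) (ga : {ffun I -> 'I_N}).

(** This covers both order conditions in a density: increasing tuples, with [r] the index, and
    patterns, with [r] the entry of the matrix. *)
Definition ordered g := forall e e', (r e < r e')%N -> g e < g e'.

Definition okcode ga := [forall e, forall e', (r e < r e')%N ==> (ga e < ga e')%N].

Definition in_cells ga g : R := \prod_e \1_(cell N (ga e)) (g e).

(** An inner approximation by boxes of the indicator of the ordered families; for values at most 1,
    what it misses is bounded by the number [ties] of coincidences of cells. *)
Definition osum g : R := \sum_(ga | okcode ga) in_cells ga g.

Definition ties g : R :=
  \sum_e \sum_(e' | e' != e) \sum_(c < N) \1_(cell N c) (g e) * \1_(cell N c) (g e').

Lemma indic_ge0 (X : Type) (A : set X) x : 0 <= \1_A x :> R.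
Proof. by rewrite indicE; case: (_ \in _). Qed.

Lemma in_cells_ge0 ga g : 0 <= in_cells ga g.
Proof. by apply: prodr_ge0 => e _; exact: indic_ge0. Qed.

Lemma osum_ge0 g : 0 <= osum g.
Proof. by apply: sumr_ge0 => ga _; exact: in_cells_ge0. Qed.

Lemma ties_ge0 g : 0 <= ties g.
Proof.
apply: sumr_ge0 => e _; apply: sumr_ge0 => e' _; apply: sumr_ge0 => c _.
by rewrite mulr_ge0// indic_ge0.
Qed.

Lemma in_cells1 ga g : (forall e, cell N (ga e) (g e)) -> in_cells ga g = 1.
Proof. by move=> H; rewrite /in_cells big1// => e _; rewrite indicE mem_set. Qed.

Lemma in_cells_neq0 ga g : in_cells ga g != 0 -> forall e, cell N (ga e) (g e).
Proof.
move=> + e; apply: contraNP => ne; rewrite /in_cells (bigD1 e)//= indicE memNset//.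
by rewrite mul0r.
Qed.

(** Cells are disjoint, so at most one term is nonzero, and values in strictly ordered cells are
    strictly ordered. *)
Lemma osum_le g : osum g <= `[< ordered g >]%:R.
Proof.
have [[ga okga gaP]|none] := pselect (exists2 ga, okcode ga & forall e, cell N (ga e) (g e)).
  have -> : `[< ordered g >].
    apply/asboolP => e e' ee'; apply: (cell_lt (ltn_ord (ga e')) _ (gaP e) (gaP e')).
    by move/forallP: okga => /(_ e)/forallP/(_ e')/implyP; apply.
  rewrite /osum (bigD1 ga)//= in_cells1// big1 ?addr0// => ga' /andP[_ ne].
  apply/eqP; apply: contraNT ne => /in_cells_neq0 ga'P; apply/eqP/ffunP => e.
  by apply/val_inj; exact: (cell_inj (ltn_ord _) (ltn_ord _) (ga'P e) (gaP e)).
rewrite /osum big1// => ga okga; apply/eqP; apply: contrapT => /negP/in_cells_neq0 gaP.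
by apply: none; exists ga.
Qed.

(** Either two values share a cell, which [ties] counts, or the cells are distinct and then ordered
    as the values are. *)
Lemma osum_ties g : injective r -> (0 < N)%N -> (forall e, g e <= 1) -> ordered g ->
  1 <= osum g + ties g.
Proof.
move=> rinj N0 g1 og; have /choice[f fP] : forall e, exists c : 'I_N, cell N c (g e).
  by move=> e; exact: cell_exists.
have [[e [e' [ne ee']]]|dist] := pselect (exists e e', e' != e /\ f e = f e').
  rewrite -[leLHS]add0r lerD ?osum_ge0//.
  rewrite /ties (bigD1 e)//= (bigD1 e')//= (bigD1 (f e))//= !indicE !mem_set//; last first.
    by rewrite ee'.
  rewrite mulr1 -!addrA lerDl !addr_ge0//.
  + by apply: sumr_ge0 => c _; rewrite mulr_ge0// ?ler0n.
  + by apply: sumr_ge0 => e2 _; apply: sumr_ge0 => c _; rewrite mulr_ge0// indic_ge0.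
  + apply: sumr_ge0 => e1 _; apply: sumr_ge0 => e2 _; apply: sumr_ge0 => c _.
    by rewrite mulr_ge0// indic_ge0.
rewrite -[leLHS]addr0 lerD ?ties_ge0//.
have okf : okcode [ffun e => f e].
  apply/forallP => e; apply/forallP => e'; apply/implyP => ee'; rewrite !ffunE.
  rewrite ltn_neqAle; apply/andP; split.
    apply/negP => /eqP/val_inj fe; apply: dist; exists e, e'; split => //.
    by apply/eqP => e'e; rewrite e'e ltnn in ee'.
  rewrite leqNgt; apply/negP => fe.
  by have := cell_lt (ltn_ord (f e)) fe (fP e') (fP e); rewrite ltNge ltW// og.
rewrite /osum (bigD1 [ffun e => f e])//= in_cells1.
  by rewrite lerDl; apply: sumr_ge0 => ga _; exact: in_cells_ge0.
by move=> e; rewrite ffunE; exact: fP.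
Qed.

End ordered_values.
End cells.

(** * Structural equivalence as an order condition *)

Section patterns.
Context (R : realType) (k l : nat).
Local Notation I := ('I_k * 'I_l)%type.
Local Notation I01 := (`[0%R, 1%R]%classic : set R).
Implicit Types (A : 'M[nat]_(k, l)) (B : 'M[R]_(k, l)).

Definition cells_of (X : Type) (A : 'M[X]_(k, l)) (e : I) : X := A e.1 e.2.

Definition entry (M : k.-tuple (l.-tuple R)) (e : I) : R := tnth (tnth M e.1) e.2.

(** The larger entry is counted in its own rank but not in that of a smaller entry, whence the
    strict inequality. *)
Lemma entry_rank_lt B (e e' : I) :
  (entry_rank B (cells_of B e) < entry_rank B (cells_of B e'))%N = (cells_of B e < cells_of B e').
Proof.
have le x y : x <= y -> (entry_rank B x <= entry_rank B y)%N.
  by move=> xy; apply: sub_count => v /= vx; exact: le_trans xy.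
case: ltP => [lt|/le]; last by rewrite leqNgt => /negbTE.
rewrite /entry_rank; set s := undup _.
have es : cells_of B e' \in s by rewrite mem_undup; apply/mapP; exists e'; rewrite ?mem_enum.
rewrite !(permP (perm_to_rem es))/= lexx leNgt lt add0n add1n ltnS.
by apply: sub_count => v /= ve; exact: le_trans (ltW lt).
Qed.

Lemma pattern_injective A : is_pattern A -> injective (cells_of A).
Proof.
move=> [A1 A2] e e' ee'; have [ij [_ uniq_ij]] := A2 _ (A1 e.1 e.2).
by rewrite -(uniq_ij e erefl); apply: uniq_ij; rewrite -[LHS]/(cells_of A e') -ee'.
Qed.

(** Ranks only record comparisons between entries. Conversely, an order inherited from the distinct
    entries of [A] makes the entries of [B] distinct too, so [undup] removes nothing and both ranks
    count the same positions. *)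
Lemma struct_equivP A B : injective (cells_of A) ->
  struct_equiv B (map_mx (fun n => n%:R) A) <-> ordered (cells_of A) (cells_of B).
Proof.
move=> Ainj; set A' := map_mx _ A.
have A'E e : cells_of A' e = (cells_of A e)%:R by rewrite /cells_of mxE.
have A'inj : injective (cells_of A').
  by move=> e e'; rewrite !A'E => /eqP; rewrite eqr_nat => /eqP/Ainj.
split => [eqBA e e'|ord i j].
  have eqr f : entry_rank A' (cells_of A' f) = entry_rank B (cells_of B f) by exact/esym/eqBA.
  by rewrite -(ltr_nat R) -!A'E -(entry_rank_lt A') -(entry_rank_lt B) !eqr.
have lt e e' : (cells_of B e < cells_of B e') = (cells_of A' e < cells_of A' e').
  rewrite !A'E ltr_nat; case: (ltngtP (cells_of A e) (cells_of A e')) => [/ord//|/ord|/Ainj->].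
    by move=> lt; apply/negbTE; rewrite -leNgt ltW.
  by rewrite ltxx.
have Binj : injective (cells_of B).
  move=> e e' ee'; apply: A'inj; apply/eqP; rewrite eq_le !leNgt -!lt ee' ltxx.
  by [].
rewrite /entry_rank !undup_id ?map_inj_uniq// -?enumT ?enum_uniq//.
rewrite !count_map; apply: eq_count => e /=.
by rewrite -[B i j]/(cells_of B (i, j)) -[A' i j]/(cells_of A' (i, j)) !leNgt; congr (~~ _); exact: lt.
Qed.

Lemma struct_classP A M : is_pattern A ->
  struct_class (map_mx (fun n => n%:R) A) I01 M <->
  (forall e, I01 (entry M e)) /\ ordered (cells_of A) (entry M).
Proof.
move=> /pattern_injective Ainj.
have entryE : cells_of (mx_of_rows M) = entry M.
  by apply/funext => e; rewrite /cells_of mxE.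
rewrite -entryE; split => -[M01 /struct_equivP MA]; split => //.
- by move=> e; exact: M01.
- by apply: MA.
- by move=> i j; exact: (M01 (i, j)).
- by apply: MA.
Qed.

Lemma measurable_entry e : measurable_fun setT (entry ^~ e).
Proof.
by apply: (measurableT_comp (@measurable_tnth _ R l e.2)); exact: measurable_tnth.
Qed.

Lemma measurable_ordered (d : measure_display) (X : measurableType d) (J : finType) (r : J -> nat)
  (g : J -> X -> R) : (forall e, measurable_fun setT (g e)) ->
  measurable [set x | ordered r (fun e => g e x)].
Proof.
move=> mg; pose S (e : J * J) : set X := if (r e.1 < r e.2)%N then [set x | g e.1 x < g e.2 x] else setT.
rewrite (_ : [set x | _] = \big[setI/setT]_e S e).
  apply: bigsetI_measurable => -[e e'] _; rewrite /S /=; case: ifP => // _.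
  rewrite -[X in measurable X]setTI.
  by apply: (measurable_fun_ltr (mg e) (mg e') measurableT (Y := [set true])).
apply/seteqP; split => x /=.
  by move=> og; elim/big_ind: _ => // -[e e'] _; rewrite /S/=; case: ifP => // ee'; exact: og.
by move=> + e e' ee'; rewrite (bigD1 (e, e'))//= /S/= ee' => -[].
Qed.

Lemma measurable_struct_class A : is_pattern A ->
  measurable (struct_class (map_mx (fun n => n%:R) A) I01).
Proof.
move=> Apat; rewrite (_ : struct_class _ _ =
    (\big[setI/setT]_e (entry ^~ e @^-1` I01)) `&` [set M | ordered (cells_of A) (entry M)]).
  apply: measurableI; last by apply: measurable_ordered; exact: measurable_entry.
  apply: bigsetI_measurable => e _; rewrite -[X in measurable X]setTI.
  by apply: measurable_entry.
apply/seteqP; split => M.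
  move=> /(struct_classP M Apat)[M01 Mo]; split => //.
  by elim/big_ind: _ => // e _; exact: M01.
move=> [M01 Mo]; apply/(struct_classP M Apat); split => // e.
by move: M01; rewrite (bigD1 e)//= => -[].
Qed.

End patterns.

Lemma prod_pair (R : comNzRingType) (I : finType) (e e' : I) (a b : R) : e' != e ->
  \prod_f (if f == e then a else if f == e' then b else 1) = a * b.
Proof.
move=> ne; rewrite (bigD1 e)//= eqxx (bigD1 e')//= (negbTE ne) eqxx big1 ?mulr1//.
by move=> f /andP[/negbTE -> /negbTE ->].
Qed.

(** * Matrices with independent entries of given laws *)

Section entries.
Context (R : realType) (k l : nat).
Local Notation I := ('I_k * 'I_l)%type.
Local Notation I01 := (`[0%R, 1%R]%classic : set R).
Variable K : I -> probability R R.

Definition entries : probability (k.-tuple (l.-tuple R)) R :=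
  tuple_prob (fun i => tuple_prob (fun j => K (i, j))).

Lemma bmf_entry (h : R -> R) e : bmf h -> bmf (fun M : k.-tuple (l.-tuple R) => h (entry M e)).
Proof. by move=> bh; apply: (bmf_comp bh); exact: measurable_entry. Qed.

Lemma int_entries (h : I -> R -> R) : (forall e, bmf (h e)) ->
  \int[entries]_M \prod_e h e (entry M e) = \prod_e \int[K e]_v h e v.
Proof.
move=> bh.
transitivity (\int[entries]_M \prod_i \prod_j h (i, j) (tnth (tnth M i) j)).
  by apply: eq_Rintegral => M _; rewrite pair_bigA; apply: eq_bigr => -[].
rewrite (int_tuple_prod _ (h := fun i (t : l.-tuple R) => \prod_j h (i, j) (tnth t j))); last first.
  by move=> i; apply: bmf_prod => j; exact: bmf_tnth.
under eq_bigr do rewrite (int_tuple_prod _ (h := fun j => h (_, j)))//.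
by rewrite pair_bigA; apply: eq_bigr => -[].
Qed.

Lemma int_entry e (h : R -> R) : bmf h -> \int[entries]_M h (entry M e) = \int[K e]_v h v.
Proof.
move=> bh; pose H f := if f == e then h else fun=> 1.
transitivity (\int[entries]_M \prod_f H f (entry M f)).
  apply: eq_Rintegral => M _; rewrite (bigD1 e)//= {1}/H eqxx big1 ?mulr1//.
  by move=> f /negbTE fe; rewrite /H fe.
rewrite int_entries; last by move=> f; rewrite /H; case: ifP => // _; exact: bmf_cst.
rewrite (bigD1 e)//= {1}/H eqxx big1 ?mulr1//.
by move=> f /negbTE fe; rewrite /H fe int_cst.
Qed.

Lemma int_entry2 e e' (h h' : R -> R) : bmf h -> bmf h' -> e' != e ->
  \int[entries]_M (h (entry M e) * h' (entry M e')) = (\int[K e]_v h v) * \int[K e']_v h' v.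
Proof.
move=> bh bh' ne; pose H f := if f == e then h else if f == e' then h' else fun=> 1.
rewrite -(prod_pair _ _ ne).
transitivity (\int[entries]_M \prod_f H f (entry M f)).
  apply: eq_Rintegral => M _; rewrite -(prod_pair _ _ ne); apply: eq_bigr => f _.
  by rewrite /H; case: eqVneq => [->//|_]; case: eqVneq => [->|].
rewrite int_entries; last first.
  by move=> f; rewrite /H; case: ifP => // _; case: ifP => // _; exact: bmf_cst.
apply: eq_bigr => f _; rewrite /H; case: eqVneq => [->//|_]; case: eqVneq => [->//|_].
exact: int_cst.
Qed.

Hypothesis K01 : forall e, K e I01 = 1%E.

Lemma entries01 : {ae entries, forall M, forall e, I01 (entry M e)}.
Proof.
apply: filter_forall => e.
have mS : measurable ((fun M : k.-tuple (l.-tuple R) => entry M e) @^-1` I01).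
  by rewrite -[X in measurable X]setTI; apply: measurable_entry.
exists (~` ((fun M : k.-tuple (l.-tuple R) => entry M e) @^-1` I01)); split; first exact: measurableC.
  rewrite probability_setC// -(fineK (fin_num_measure entries _ mS)) -int_indic//.
  rewrite (int_entry e (h := \1_I01)); last exact: bmf_indic.
  by rewrite int_indic// K01 subee.
by move=> M.
Qed.

Variable A : 'M[nat]_(k, l).
Hypothesis Apat : is_pattern A.
Local Notation C := (struct_class (map_mx (fun n => n%:R : R) A) I01).

Let bcell N c : bmf (\1_(cell N c) : R -> R).
Proof. by apply: bmf_indic; exact: measurable_cell. Qed.

Definition entries_boxes N : R :=
  \sum_(ga : {ffun I -> 'I_N} | okcode (cells_of A) ga) \prod_e fine (K e (cell N (ga e))).

Let bin_cells N (ga : {ffun I -> 'I_N}) : bmf (fun M => in_cells ga (entry (R:=R) M)).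
Proof. by apply: bmf_prod => e; exact: bmf_entry. Qed.

Let bosum N : bmf (fun M => osum (cells_of A) N (entry (R:=R) M)).
Proof. exact: bmf_sum. Qed.

Lemma int_osum N : \int[entries]_M osum (cells_of A) N (entry M) = entries_boxes N.
Proof.
rewrite /osum int_sum//; apply: eq_bigr => ga _.
rewrite (int_entries (h := fun e => \1_(cell N (ga e)))) //.
by apply: eq_bigr => e _; rewrite int_indic//; exact: measurable_cell.
Qed.

Let mC : measurable C. Proof. exact: measurable_struct_class. Qed.

Lemma entries_boxes_le N : entries_boxes N <= fine (entries C).
Proof.
rewrite -int_osum -int_indic//; apply: int_le_ae => //; first exact: bmf_indic.
apply: filterS entries01 => M M01; apply: le_trans (osum_le _ _ _) _.
case: asboolP => [Mo|_]; last by rewrite indicE ler0n.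
by rewrite indicE mem_set//; apply/struct_classP.
Qed.

(** The integrated form of [osum_ties]; independence of the entries turns coincidences of cells into
    products of masses. *)
Lemma entries_boxes_ties N : (0 < N)%N -> fine (entries C) <= entries_boxes N +
  \sum_e \sum_(e' | e' != e) \sum_(c < N) fine (K e (cell N c)) * fine (K e' (cell N c)).
Proof.
move=> N0.
have bt (e e' : I) (c : 'I_N) : bmf (fun M : k.-tuple (l.-tuple R) => \1_(cell N c) (entry (R:=R) M e) * \1_(cell N c) (entry M e') : R).
  by apply: bmfM; exact: bmf_entry.
have bties : bmf (fun M : k.-tuple (l.-tuple R) => ties N (entry (R:=R) M)).
  by apply: bmf_sum => e; apply: bmf_sum => e'; exact: bmf_sum.
have -> : \sum_e \sum_(e' | e' != e) \sum_(c < N) fine (K e (cell N c)) * fine (K e' (cell N c)) =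
    \int[entries]_M ties N (entry M).
  rewrite /ties int_sum; last by move=> e; apply: bmf_sum => e'; exact: bmf_sum.
  apply: eq_bigr => e _; rewrite int_sum; last by move=> e'; exact: bmf_sum.
  apply: eq_bigr => e' ne; rewrite int_sum//; apply: eq_bigr => c _.
  rewrite (int_entry2 (h := \1_(cell N c)) (h' := \1_(cell N c)))//.
  by rewrite !int_indic//; exact: measurable_cell.
rewrite -int_osum -intD// -int_indic//; apply: int_le_ae; first exact: bmf_indic.
  exact: bmfD.
apply: filterS entries01 => M M01; rewrite indicE; have [/set_mem CM|_] := boolP (M \in C).
  have [_ Mo] := (struct_classP M Apat).1 CM.
  apply: osum_ties => //; first exact: pattern_injective.
  by move=> e; have := M01 e; rewrite /= in_itv/= => /andP[].
by rewrite addr_ge0// ?osum_ge0 ?ties_ge0.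
Qed.

(** Pointwise in the matrix: distinct entries fall into distinct cells once 1/N is below their gaps,
    and [osum_le] settles the matrices outside the class. This holds for laws with atoms as well,
    and yields the measurability of [class_prob]. *)
Lemma cvg_entries_boxes : entries_boxes @ \oo --> fine (entries C).
Proof.
rewrite -int_indic//; have -> : entries_boxes = (fun N => \int[entries]_M osum (cells_of A) N (entry M)).
  by apply/funext => N; rewrite int_osum.
apply: (int_cvg (c := 1)).
- by move=> N; case: (bosum N).
- move=> N M; rewrite ger0_norm ?osum_ge0//; apply: le_trans (osum_le _ _ _) _.
  by case: asbool; rewrite ?ler01.
- exact: bmf_indic.
apply: filterS entries01 => M M01.
have [CM|nCM] := pselect (C M); last first.
  rewrite indicE memNset// (_ : (fun _ => _) = fun=> 0); first exact: cvg_cst.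
  apply/funext => N; apply/eqP; rewrite eq_le osum_ge0 andbT.
  apply: le_trans (osum_le _ _ _) _; case: asboolP => // Mo; exfalso.
  by apply: nCM; apply/struct_classP.
have [_ Mo] := (struct_classP M Apat).1 CM.
rewrite indicE mem_set//; apply: cvg_near_cst.
have Minj e e' : e' != e -> entry M e != entry M e'.
  move=> ne; have : cells_of A e != cells_of A e'.
    by apply: contra_neq ne => /(pattern_injective Apat).
  by rewrite neq_ltn => /orP[/Mo/lt_eqF->|/Mo/gt_eqF->].
have far e e' : e' != e -> \forall N \near \oo, forall c : 'I_N,
    \1_(cell N c) (entry M e) * \1_(cell N c) (entry M e') = 0 :> R.
  move=> /Minj ne; have d0 : 0 < `|entry M e - entry M e'| by rewrite normr_gt0 subr_eq0.
  near=> N.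
  have Nd : N%:R^-1 < `|entry M e - entry M e'|.
    rewrite invf_plt ?posrE//; last by rewrite ltr0n; near: N; exact: nbhs_infty_gt.
    by near: N; exact: nbhs_infty_gtr.
  move=> c; rewrite !indicE.
  have [/set_mem ce|] := boolP (entry M e \in _); last by rewrite mul0r.
  have [/set_mem ce'|] := boolP (entry M e' \in _); last by rewrite mulr0.
  have M0 f : 0 <= entry M f by have := M01 f; rewrite /= in_itv/= => /andP[].
  have := cell_width (ltn_ord c) (M0 e') ce ce'; have := cell_width (ltn_ord c) (M0 e) ce' ce.
  move: Nd; rewrite ltr_normr => /orP[]; lra.
have far_all : \forall N \near \oo, forall e e', e' != e -> forall c : 'I_N,
    \1_(cell N c) (entry M e) * \1_(cell N c) (entry M e') = 0 :> R.
  apply: filter_forall => e; apply: filter_forall => e'.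
  by have [->|ne] := eqVneq e' e; [exact: nearW|apply: filterS (far e e' ne) => N H _].
apply: filterS2 far_all (nbhs_infty_gt 0%N) => N Nfar N0.
apply/eqP; rewrite eq_le; apply/andP; split.
  by apply: le_trans (osum_le _ _ _) _; case: asbool; rewrite ?ler01.
rewrite -[leRHS]addr0 -(_ : ties N (entry M) = 0).
  apply: osum_ties => //; first exact: pattern_injective.
  by move=> e; have := M01 e; rewrite /= in_itv/= => /andP[].
by rewrite /ties big1// => e _; rewrite big1// => e' ne; rewrite big1// => c _; exact: Nfar.
Unshelve. all: by end_near.
Qed.

End entries.

(** * Independence of entries in distinct rows or columns *)

Section independent_coordinates.
Context (R : realType) (d : measure_display) (T : measurableType d).
Variable mu : probability T R.

Lemma int_tnth2 n (i i' : 'I_n) (h h' : T -> R) : bmf h -> bmf h' -> i' != i ->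
  \int[tpow mu n]_t (h (tnth t i) * h' (tnth t i')) = (\int[mu]_x h x) * \int[mu]_x h' x.
Proof.
move=> bh bh' ne; pose H f := if f == i then h else if f == i' then h' else fun=> 1.
rewrite -(prod_pair _ _ ne).
transitivity (\int[tpow mu n]_t \prod_f H f (tnth t f)).
  apply: eq_Rintegral => t _; rewrite -(prod_pair _ _ ne); apply: eq_bigr => f _.
  by rewrite /H; case: eqVneq => [->//|_]; case: eqVneq => [->|].
rewrite int_tuple_prod; last first.
  by move=> f; rewrite /H; case: ifP => // _; case: ifP => // _; exact: bmf_cst.
apply: eq_bigr => f _; rewrite /H; case: ifP => // _; case: ifP => // _.
exact: int_cst.
Qed.

Lemma ae_tnth n (i : 'I_n) (h : T -> R) (c : R) : bmf h -> {ae mu, forall x, h x = c} ->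
  {ae tpow mu n, forall t, h (tnth t i) = c}.
Proof.
move=> bh hc; have bhc : bmf (fun x => h x - c) by apply: bmfB => //; exact: bmf_cst.
suff /int_norm_eq0 H : \int[tpow mu n]_t `|h (tnth t i) - c| = 0.
  by apply: filterS (H (bmf_tnth i bhc)) => t /eqP; rewrite subr_eq0 => /eqP.
rewrite (int_tnth mu i (h := fun x => `|h x - c|)); last exact: bmf_norm.
rewrite -[RHS](int_cst mu); apply: int_ae; [exact: bmf_norm|exact: bmf_cst|].
by apply: filterS hc => x ->; rewrite subrr normr0.
Qed.

Context (k l : nat).
Local Notation Z := (k.-tuple T * l.-tuple T)%type.
Local Notation PZ := (tpow mu k \x tpow mu l)%E.
Local Notation edge z e := (tnth z.1 e.1, tnth z.2 e.2).
Implicit Types (e : 'I_k * 'I_l) (u v : T * T -> R).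

(** Given the rows, the two columns are independent, and integrating [v] over its own column gives
    the constant [c] for almost every row. *)
Lemma int_edges_row e e' u v c : bmf u -> bmf v -> e'.2 != e.2 ->
  {ae mu, forall x, \int[mu]_y v (x, y) = c} ->
  \int[PZ]_z (u (edge z e) * v (edge z e')) = c * \int[PZ]_z u (edge z e).
Proof.
move=> bu bv ne vc.
have b1 := bmf_edge e.1 e.2 bu; have b2 := bmf_edge e'.1 e'.2 bv.
have b1' := bmf_int2 (tpow mu k) (tpow mu l) b1.
have bmu := bmf_int2 mu mu bu; have bmv := bmf_int2 mu mu bv.
rewrite int_prod12; last exact: bmfM.
rewrite int_prod12//= -intZl; last exact: b1'.
transitivity (\int[tpow mu k]_x ((\int[mu]_y u (tnth x e.1, y)) * \int[mu]_y v (tnth x e'.1, y))).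
  apply: eq_Rintegral => x _ /=.
  apply: (int_tnth2 (h := fun y => u (_, y)) (h' := fun y => v (_, y))) => //; exact: bmf_xsection.
apply: int_ae.
- by apply: bmfM; [exact: (bmf_tnth e.1 bmu)|exact: (bmf_tnth e'.1 bmv)].
- exact: (bmfZ c b1').
apply: filterS (ae_tnth e'.1 bmv vc) => x ->; rewrite mulrC; congr (_ * _).
by rewrite (int_tnth mu e.2 (h := fun y => u (tnth x e.1, y)))//; exact: bmf_xsection.
Qed.

Lemma int_edges_col e e' u v c : bmf u -> bmf v -> e'.1 != e.1 ->
  {ae mu, forall y, \int[mu]_x v (x, y) = c} ->
  \int[PZ]_z (u (edge z e) * v (edge z e')) = c * \int[PZ]_z u (edge z e).
Proof.
move=> bu bv ne vc.
have b1 := bmf_edge e.1 e.2 bu; have b2 := bmf_edge e'.1 e'.2 bv.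
have b1' := bmf_int1 (tpow mu k) (tpow mu l) b1.
have bmu := bmf_int1 mu mu bu; have bmv := bmf_int1 mu mu bv.
rewrite int_prod21; last exact: bmfM.
rewrite int_prod21//= -intZl; last exact: b1'.
transitivity (\int[tpow mu l]_y ((\int[mu]_x u (x, tnth y e.2)) * \int[mu]_x v (x, tnth y e'.2))).
  apply: eq_Rintegral => y _ /=.
  apply: (int_tnth2 (h := fun x => u (x, _)) (h' := fun x => v (x, _))) => //; exact: bmf_ysection.
apply: int_ae.
- by apply: bmfM; [exact: (bmf_tnth e.2 bmu)|exact: (bmf_tnth e'.2 bmv)].
- exact: (bmfZ c b1').
apply: filterS (ae_tnth e'.2 bmv vc) => y ->; rewrite mulrC; congr (_ * _).
by rewrite (int_tnth mu e.1 (h := fun x => u (x, tnth y e.2)))//; exact: bmf_ysection.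
Qed.

End independent_coordinates.

Lemma sum_offdiag_le (R : realType) (I : finType) (f : I -> I -> R) (c : R) : 0 <= c ->
  (forall e e', e' != e -> f e e' <= c) ->
  \sum_e \sum_(e' | e' != e) f e e' <= (#|I| * #|I|)%:R * c.
Proof.
move=> c0 fc; rewrite natrM -mulrA [leRHS]mulr_natl -sumr_const; apply: ler_sum => e _.
rewrite mulr_natl -sumr_const [leLHS]big_mkcond; apply: ler_sum => e' _.
by case: ifPn => // ne; exact: fc.
Qed.

Section box_sums.
Context (R : realType) (d : measure_display) (T : measurableType d) (mu : probability T R).
Context (k l : nat) (A : 'M[nat]_(k, l)) (N : nat).
Local Notation I := ('I_k * 'I_l)%type.

Definition box_sum (u : nat -> T * T -> R) (D : nat -> set T) : R :=
  \sum_(al : {ffun 'I_k -> 'I_N} | okcode val al)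
  \sum_(be : {ffun 'I_l -> 'I_N} | okcode val be)
  \sum_(ga : {ffun I -> 'I_N} | okcode (cells_of A) ga)
    opt_hom mu u D (fun i => cell_up N (al i)) (fun i => cell_lo N (al i))
      (fun j => cell_up N (be j)) (fun j => cell_lo N (be j))
      (fun e => cell_up N (ga e)) (fun e => cell_lo N (ga e)).

End box_sums.

(** * Distance between a density and its box sums *)

Section density.
Context (R : realType) (d : measure_display) (T : measurableType d) (mu : probability T R).
Variable L : latinon mu.
Context (k l : nat) (A : 'M[nat]_(k, l)).
Hypothesis Apat : is_pattern A.
Local Notation I := ('I_k * 'I_l)%type.
Local Notation I01 := (`[0%R, 1%R]%classic : set R).
Local Notation Z := (k.-tuple T * l.-tuple T)%type.
Local Notation PZ := (tpow mu k \x tpow mu l)%E.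
Local Notation C := (struct_class (map_mx (fun n => n%:R : R) A) I01).

Definition edge_law (z : Z) (e : I) : probability R R := lat_W L (tnth z.1 e.1, tnth z.2 e.2).

Definition class_prob (z : Z) : R := fine (entries (edge_law z) C).

Let edge_law01 z e : edge_law z e I01 = 1%E. Proof. exact: lat_W01. Qed.

Lemma bmf_edge_law U e : measurable U -> bmf (fun z => fine (edge_law z e U)).
Proof. by move=> mU; exact: (bmf_edge e.1 e.2 (bmf_ker_of L mU)). Qed.

Lemma bmf_entries_boxes N : bmf (fun z => entries_boxes (edge_law z) A N).
Proof.
apply: bmf_sum => ga; apply: bmf_prod => e; apply: bmf_edge_law; exact: measurable_cell.
Qed.

Let mC : measurable C. Proof. exact: measurable_struct_class. Qed.

Lemma class_prob01 z : 0 <= class_prob z <= 1.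
Proof. by rewrite /class_prob; exact: fine_prob01. Qed.

Lemma bmf_class_prob : bmf class_prob.
Proof.
split; last first.
  by exists 1 => z; have /andP[p0 p1] := class_prob01 z; rewrite ger0_norm.
apply: (measurable_fun_cvg (h := fun N z => entries_boxes (edge_law z) A N)).
  by move=> N; case: (bmf_entries_boxes N).
by move=> z _; apply: cvg_entries_boxes.
Qed.

Local Notation X := (increasing_tuples (k:=k) (lat_f L)).
Local Notation Y := (increasing_tuples (k:=l) (lat_f L)).

Lemma measurable_increasing n : measurable (increasing_tuples (k:=n) (lat_f L)).
Proof.
apply: (@measurable_ordered R _ _ 'I_n val (fun i x => lat_f L (tnth x i))) => i.
by apply: measurableT_comp => //; exact: measurable_tnth.
Qed.

Let mX : measurable X. Proof. exact: measurable_increasing. Qed.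
Let mY : measurable Y. Proof. exact: measurable_increasing. Qed.

Definition ordered_prob : R := \int[PZ]_z (\1_X z.1 * \1_Y z.2 * class_prob z).

Let bXY : bmf (fun z : Z => \1_X z.1 * \1_Y z.2 * class_prob z).
Proof.
apply: bmfM; last exact: bmf_class_prob.
by apply: bmfM; [apply: bmf_fst|apply: bmf_snd]; exact: bmf_indic.
Qed.

Lemma densityE : density A L = ((k`! * l`!)%N%:R * ordered_prob)%:E.
Proof.
rewrite /density EFinM; congr (_ * _)%E.
rewrite /ordered_prob int_prod12// -EFin_int; last exact: (bmf_int2 (tpow mu k) (tpow mu l) bXY).
rewrite integral_mkcond; apply: eq_integral => x _; rewrite patchE.
rewrite -EFin_int; last exact: (bmf_xsection x bXY).
case: ifPn => Xx; last first.
  rewrite (eq_integral (cst 0%E)) ?integral0// => y _.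
  by rewrite /= indicE (negbTE Xx) !mul0r.
rewrite integral_mkcond; apply: eq_integral => y _; rewrite patchE /= !indicE Xx mul1r.
case: ifPn => _; rewrite ?mul0r// mul1r /class_prob fineK//.
by apply: fin_num_measure.
Qed.

Section approximation.
Variable N : nat.
Hypothesis N0 : (0 < N)%N.

Let posum n (x : n.-tuple T) := osum val N (fun i : 'I_n => lat_f L (tnth x i)).

Let bcell c : bmf (fun x => \1_(cell N c) (lat_f L x) : R).
Proof. by apply: (@bmf_comp _ _ _ _ _ (\1_(cell N c))) => //; apply: bmf_indic; exact: measurable_cell. Qed.

Lemma lat_f_cell c : (c < N)%N -> \int[mu]_x \1_(cell N c) (lat_f L x) = N%:R^-1 :> R.
Proof.
move=> cN; rewrite -(unif_cell R cN) -(lat_f_law L (measurable_cell N c)).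
rewrite -int_indic; first by apply: eq_Rintegral => x _; rewrite !indicE.
by rewrite -[X in measurable X]setTI; apply: measurable_funPT => //; exact: measurable_cell.
Qed.

Let bposum n : bmf (fun x : n.-tuple T => posum x).
Proof. by apply: bmf_sum => ga; apply: bmf_prod => i; exact: (bmf_tnth i (bcell _)). Qed.

Lemma box_sumE : box_sum mu A N (uL L) (DL L) =
  \int[PZ]_z (posum z.1 * posum z.2 * entries_boxes (edge_law z) A N).
Proof.
pose a n (al : {ffun 'I_n -> 'I_N}) (x : n.-tuple T) : R :=
  in_cells al (fun i => lat_f L (tnth x i)).
have ba n (al : {ffun 'I_n -> 'I_N}) : bmf (a n al).
  by apply: bmf_prod => i; exact: (bmf_tnth i (bcell _)).
pose b (ga : {ffun I -> 'I_N}) z := \prod_e fine (edge_law z e (cell N (ga e))).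
have bb ga : bmf (b ga).
  by apply: bmf_prod => e; apply: bmf_edge_law; exact: measurable_cell.
have babb al be ga : bmf (fun z : Z => a k al z.1 * a l be z.2 * b ga z).
  apply: bmfM => //; apply: bmfM; first exact: (bmf_fst _ (ba k al)).
  exact: (bmf_snd _ (ba l be)).
transitivity (\int[PZ]_z \sum_(al : {ffun 'I_k -> 'I_N} | okcode val al)
  \sum_(be : {ffun 'I_l -> 'I_N} | okcode val be)
  \sum_(ga : {ffun I -> 'I_N} | okcode (cells_of A) ga) (a k al z.1 * a l be z.2 * b ga z)).
  rewrite int_sum; last by move=> al; apply: bmf_sum => be; exact: bmf_sum.
  apply: eq_bigr => al _; rewrite int_sum; last by move=> be; exact: bmf_sum.
  apply: eq_bigr => be _; rewrite int_sum//; apply: eq_bigr => ga _.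
  have indo o x : opt_ind R (DL L) o x = \1_(oray o) (lat_f L x).
    by case: o => [q|] //=; rewrite indicE in_set0.
  have indE (c : 'I_N) x : opt_ind R (DL L) (cell_up N c) x - opt_ind R (DL L) (cell_lo N c) x =
      \1_(cell N c) (lat_f L x).
    rewrite !indo !indicE /cell in_setD.
    have [/set_mem lo|] := boolP (lat_f L x \in oray (cell_lo N c)); last by rewrite subr0 andbT.
    by rewrite (mem_set (oray_lo_up (ltn_ord c) lo)) subrr.
  have kerE (c : 'I_N) z : opt_kernel (uL L) (cell_up N c) z - opt_kernel (uL L) (cell_lo N c) z =
      fine ((lat_W L z : probability R R) (cell N c)).
    rewrite prob_cell//; congr (_ - _).
    by case: (cell_lo N c) => [q|] //=; rewrite measure0.
  apply: eq_Rintegral => z _; rewrite /pattern_fun; congr (_ * _ * _).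
  - by apply: eq_bigr => i _; exact: indE.
  - by apply: eq_bigr => j _; exact: indE.
  - by apply: eq_bigr => e _; exact: kerE.
apply: eq_Rintegral => z _; rewrite /posum /osum /entries_boxes big_distrlr/= mulr_suml.
apply: eq_bigr => al _; rewrite mulr_suml; apply: eq_bigr => be _.
by rewrite mulr_sumr.
Qed.

(** The values of f at two independent points are independent and uniform: they share a given cell
    with probability 1/N^2, and there are N cells. *)
Lemma int_ties n : \int[tpow mu n]_x ties N (fun i : 'I_n => lat_f L (tnth x i)) <= (n * n)%:R / N%:R.
Proof.
have b2 (i i' : 'I_n) (c : 'I_N) :
    bmf (fun x : n.-tuple T => \1_(cell N c) (lat_f L (tnth x i)) * \1_(cell N c) (lat_f L (tnth x i')) : R).
  by apply: bmfM; exact: (bmf_tnth _ (bcell _)).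
rewrite /ties int_sum; last by move=> i; apply: bmf_sum => i'; exact: bmf_sum.
rewrite -[X in (X * _)%N](card_ord n) -[X in (_ * X)%N](card_ord n).
under eq_bigr => i _.
  rewrite int_sum; last by move=> i'; exact: bmf_sum.
  over.
apply: sum_offdiag_le => [|i i' ne]; first by rewrite invr_ge0.
rewrite int_sum// (eq_bigr (fun=> N%:R^-1 * N%:R^-1)); last first.
  by move=> c _; rewrite (int_tnth2 mu (bcell c) (bcell c) ne) lat_f_cell.
by rewrite sumr_const card_ord -[leLHS]mulr_natl mulrA divff ?mul1r// pnatr_eq0 -lt0n.
Qed.

Definition edge_ties (z : Z) : R :=
  \sum_e \sum_(e' | e' != e) \sum_(c < N) fine (edge_law z e (cell N c)) * fine (edge_law z e' (cell N c)).

Let bel e (c : 'I_N) : bmf (fun z => fine (edge_law z e (cell N c))).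
Proof. by apply: bmf_edge_law; exact: measurable_cell. Qed.

Let bet e e' (c : 'I_N) : bmf (fun z => fine (edge_law z e (cell N c)) * fine (edge_law z e' (cell N c))).
Proof. exact: bmfM. Qed.

Let bedge_ties : bmf edge_ties.
Proof. by apply: bmf_sum => e; apply: bmf_sum => e'; exact: bmf_sum. Qed.

(** Distinct entries differ in their column or in their row. Averaging over that index gives the
    second entry mass 1/N in each cell whatever the first does, and the masses of the cells for the
    first entry sum to at most 1. *)
Lemma int_edge_ties : \int[PZ]_z edge_ties z <= ((k * l) * (k * l))%:R / N%:R.
Proof.
rewrite /edge_ties int_sum; last by move=> i; apply: bmf_sum => i'; exact: bmf_sum.
rewrite (_ : (k * l)%N = #|{: I}|); last by rewrite card_prod !card_ord.
under eq_bigr => i _.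
  rewrite int_sum; last by move=> i'; exact: bmf_sum.
  over.
apply: sum_offdiag_le => [|e e' ne]; first by rewrite invr_ge0.
rewrite int_sum// (eq_bigr (fun c : 'I_N => N%:R^-1 * \int[PZ]_z fine (edge_law z e (cell N c)))); last first.
  move=> c _; have bc := bmf_ker_of L (measurable_cell (R:=R) N c).
  have [ne2|] := boolP (e'.2 != e.2).
    apply: (int_edges_row bc bc ne2); apply: filterS (lat_marginal1 L) => x Hx.
    by rewrite Hx ?unif_cell//; exact: measurable_cell.
  rewrite negbK => e2; have ne1 : e'.1 != e.1.
    apply: contraNN ne => e1; apply/eqP; case: e e' e1 e2 => [a b] [a' b'] /= /eqP -> /eqP ->.
    by [].
  apply: (int_edges_col bc bc ne1); apply: filterS (lat_marginal2 L) => x Hx.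
  by rewrite Hx ?unif_cell//; exact: measurable_cell.
rewrite -mulr_sumr -int_sum// -[leRHS]mulr1 ler_wpM2l ?invr_ge0//.
by apply: int_le_cst => [|z]; [exact: bmf_sum|exact: sum_cell].
Qed.

(** The numerators bound the numbers of ordered pairs of rows, of columns and of entries; each pair
    shares a cell with probability at most 1/N. The bound involves nothing of [L], which makes it
    uniform along a sequence. *)
Lemma box_sum_close : `|ordered_prob - box_sum mu A N (uL L) (DL L)| <=
  ((k * k)%:R + (l * l)%:R + ((k * l) * (k * l))%:R) / N%:R.
Proof.
have bpo : bmf (fun z : Z => posum z.1 * posum z.2 * entries_boxes (edge_law z) A N).
  apply: bmfM; last exact: bmf_entries_boxes.
  by apply: bmfM; [apply: bmf_fst|apply: bmf_snd].
pose tie n (x : n.-tuple T) : R := ties N (fun i => lat_f L (tnth x i)).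
have btie n : bmf (@tie n).
  apply: bmf_sum => i; apply: bmf_sum => i'; apply: bmf_sum => c.
  by apply: bmfM; exact: (bmf_tnth _ (bcell c)).
have posum_le n (x : n.-tuple T) : posum x <= \1_(increasing_tuples (lat_f L)) x.
  apply: le_trans (osum_le _ _ _) _; case: asboolP => [ox|_]; last by rewrite indicE ler0n.
  by rewrite indicE mem_set.
have posum_tie n (x : n.-tuple T) : \1_(increasing_tuples (lat_f L)) x <= posum x + tie n x.
  rewrite indicE; have [/set_mem ox|_] := boolP (x \in _); last first.
    by rewrite addr_ge0// ?osum_ge0 ?ties_ge0.
  apply: osum_ties => //.
  by move=> i; have := lat_f01 L (tnth x i); rewrite /= in_itv/= => /andP[].
have posum0 n (x : n.-tuple T) : 0 <= posum x by exact: osum_ge0.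
have ind1 n (x : n.-tuple T) : \1_(increasing_tuples (lat_f L)) x <= 1 :> R.
  by rewrite indicE; case: (_ \in _).
have eb0 z : 0 <= entries_boxes (edge_law z) A N.
  by apply: sumr_ge0 => ga _; apply: prodr_ge0 => e _; exact: fine_ge0.
(* Factors in [0, 1] are replaced one at a time, so the loss in a product is at most the sum of the
   losses. *)
have mono (a a' b b' c c' : R) : 0 <= a' -> a' <= a -> a <= 1 -> 0 <= b' -> b' <= b -> b <= 1 ->
    0 <= c' -> c' <= c -> c <= 1 ->
    0 <= a * b * c - a' * b' * c' <= (a - a') + (b - b') + (c - c').
  move=> a0 aa a1 b0 bb b1 c0 cc c1.
  rewrite (_ : _ - _ = (a - a') * (b * c) + (a' * ((b - b') * c) + a' * b' * (c - c'))); last by ring.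
  have ge1 (x y : R) : 0 <= x -> 0 <= y -> y <= 1 -> 0 <= x * y <= x.
    by move=> x0 y0 y1; rewrite mulr_ge0//= ler_piMr.
  have /andP[p1 p2] : 0 <= (a - a') * (b * c) <= a - a'.
    by apply: ge1; [lra|apply: mulr_ge0; lra|apply: mulr_ile1; lra].
  have /andP[q1 q2] : 0 <= a' * ((b - b') * c) <= b - b'.
    have /andP[h1 h2] : 0 <= (b - b') * c <= b - b' by apply: ge1; lra.
    rewrite mulrC; have /andP[-> h4] := ge1 _ _ h1 a0 (le_trans aa a1).
    exact: le_trans h4 h2.
  have /andP[r1 r2] : 0 <= a' * b' * (c - c') <= c - c'.
    by rewrite mulrC; apply: ge1; [lra|apply: mulr_ge0; lra|apply: mulr_ile1; lra].
  by apply/andP; split; lra.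
have key z : 0 <= \1_X z.1 * \1_Y z.2 * class_prob z -
    posum z.1 * posum z.2 * entries_boxes (edge_law z) A N <=
    tie k z.1 + tie l z.2 + edge_ties z.
  have /andP[_ p1] := class_prob01 z.
  have /andP[-> h] := mono _ _ _ _ _ _ (posum0 k z.1) (posum_le k z.1) (ind1 k z.1)
    (posum0 l z.2) (posum_le l z.2) (ind1 l z.2) (eb0 z) (entries_boxes_le (edge_law01 z) Apat N) p1.
  apply: le_trans h _; have := posum_tie k z.1; have := posum_tie l z.2.
  have := entries_boxes_ties (edge_law01 z) Apat N0; rewrite -/(class_prob z) -/(edge_ties z); lra.
rewrite box_sumE /ordered_prob -intB// ger0_norm; last first.
  by apply: int_ge0 => z; have /andP[] := key z.
apply: (@le_trans _ _ (\int[PZ]_z (tie k z.1 + tie l z.2 + edge_ties z))).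
  apply: int_le; first exact: bmfB.
    by apply: bmfD => //; apply: bmfD; [exact: (bmf_fst _ (btie k))|exact: (bmf_snd _ (btie l))].
  by move=> z; have /andP[] := key z.
have bf := bmf_fst (l.-tuple T) (btie k); have bs := bmf_snd (k.-tuple T) (btie l).
rewrite intD//; last exact: bmfD.
rewrite intD// !mulrDl !lerD//; last exact: int_edge_ties.
  apply: le_trans (int_ties k); rewrite int_prod12// le_eqVlt; apply/orP; left; apply/eqP.
  by apply: eq_Rintegral => x _; rewrite /= int_cst.
apply: le_trans (int_ties l); rewrite int_prod21// le_eqVlt; apply/orP; left; apply/eqP.
by apply: eq_Rintegral => x _; rewrite /= int_cst.
Qed.


End approximation.
End density.

Theorem theorem3p12 (R : realType)
    (d : measure_display) (T : measurableType d) (mu : probability T R)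
    (mu_separable : separable_prob mu) (mu_atomless : atomless mu)
    (dn : nat -> measure_display) (Tn : forall n, measurableType (dn n))
    (mun : forall n, probability (Tn n) R)
    (mun_separable : forall n, separable_prob (mun n))
    (mun_atomless : forall n, atomless (mun n))
    (L : forall n, latinon (mun n)) :
  exists (s : nat -> nat) (Lim : latinon mu),
    {homo s : i j / (i < j)%N} /\
    forall (k l : nat) (A : 'M[nat]_(k, l)), is_pattern A ->
      (fun i => density A (L (s i))) @ \oo --> density A Lim.
Proof.
have [s [Lim [s_incr homL]]] := latinon_compactness L mu_atomless.
exists s, Lim; split => // k l A Apat.
rewrite densityE//; under eq_fun do rewrite densityE//.
apply: cvg_EFin; first exact: nearW.
apply: cvgM; first exact: cvg_cst.
pose c : R := (k * k)%:R + (l * l)%:R + ((k * l) * (k * l))%:R.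
have c0 : (fun N : nat => c / N%:R) @ \oo --> 0.
  rewrite -(mulr0 c); apply: cvgM; first exact: cvg_cst.
  apply/cvgrPdist_lt => r r0; near=> N.
  rewrite sub0r normrN ger0_norm ?invr_ge0//.
  rewrite invf_plt ?posrE//; last by rewrite ltr0n; near: N; exact: nbhs_infty_gt.
  by near: N; exact: nbhs_infty_gtr.
(* The error does not depend on [n], and for a fixed [N] a box sum is a finite sum of decorated
   densities, each of which converges. *)
apply: (@cvg_approx _ _ _
  (fun N n => box_sum (mun (s n)) A N (uL (L (s n))) (DL (L (s n))))
  (fun N => box_sum mu A N (uL Lim) (DL Lim)) (fun N => c / N%:R) (fun N => c / N%:R)) => //.
- by apply: filterS (nbhs_infty_gt 0%N) => N N0 n; exact: box_sum_close.
- by apply: filterS (nbhs_infty_gt 0%N) => N N0; exact: box_sum_close.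
- by apply: nearW => N; apply: cvg_sumr => al; apply: cvg_sumr => be; exact: cvg_sumr.
Unshelve. all: by end_near.
Qed.
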